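(* Let $p\ge1$ be noninteger and set $k=\lceil p\rceil$. Let $(X^{(n)}_i)_{i\in T_n}$ be a sequence of mean-zero random fields as in the context, and let $\sigma_n$, $W_n$ be as in the context. Suppose that $$\liminf_{n\to\infty}\frac{\sigma_n^2}{|T_n|}>0,\qquad \sup_{n,\,i\in T_n}\|X^{(n)}_i\|_{p+2}<\infty,$$ and that there is a fixed $R\in\mathbb N_+$ such that $\alpha^{[k+1]}_{R+1,n}=0$ for every $n$. Then, uniformly over $h\in\Lambda_p$, $$\mathbb E[h(W_n)]-\mathcal N h=\sum_{(a,s_{1:a})\in\Gamma(k-1)}(-1)^a\prod_{j=1}^a\frac{\kappa_{s_j+2}(W_n)}{(s_j+1)!}\;\mathcal N\Bigl[(\partial^{s_1+1}\Theta)\circ\cdots\circ(\partial^{s_a+1}\Theta)\,h\Bigr]+\mathcal O(|T_n|^{-p/2}),$$ and, for every integer $1\le j\le k-1$, $$|\kappa_{j+2}(W_n)|=\mathcal O(|T_n|^{-j/2}).$$ Moreover, $$\mathcal W_p(\mathcal L(W_n),N(0,1))=\mathcal O(|T_n|^{-1/2}).$$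
   Context: Setting. Fix $d\in\mathbb N_+$. $T_1\subseteq T_2\subseteq\cdots$ are finite nonempty subsets of $\mathbb Z^d$ with $|T_n|\to\infty$. For each $n$, $(X^{(n)}_i)_{i\in T_n}$ is a family of real random variables with mean zero and finite second moments (no stationarity is assumed). Put $\sigma_n^2:=\operatorname{Var}(\sum_{i\in T_n}X^{(n)}_i)$ and $W_n:=\sigma_n^{-1}\sum_{i\in T_n}X^{(n)}_i$ (defined when $\sigma_n>0$). $\|X\|_r:=(\mathbb E|X|^r)^{1/r}$. $\kappa_j(W_n)$ is the $j$-th cumulant of $W_n$. Mixing coefficients. For sub-$\sigma$-algebras $\mathcal A,\mathcal B$, $\alpha(\mathcal A,\mathcal B):=\sup_{A\in\mathcal A,B\in\mathcal B}|\mathbb P(A\cap B)-\mathbb P(A)\mathbb P(B)|$. For positive integers $\ell,q$, $\alpha^{[q]}_{\ell,n}:=0\vee\sup\{\alpha(\sigma(X^{(n)}_i:i\in U_1),\sigma(X^{(n)}_i:i\in U_2)):U_1,U_2\subseteq T_n,\ |U_1|\le q,\ d(U_1,U_2)\ge\ell\}$, where $d(U_1,U_2)=\min\{\|i_1-i_2\|:i_1\in U_1,i_2\in U_2\}$ and $\|\cdot\|$ is the maximum norm. Function class. For $k\in\mathbb N$ and $\omega\in(0,1]$, $f\in\mathcal C^{k,\omega}(\mathbb R)$ means $f\in\mathcal C^k(\mathbb R)$ and $|f|_{k,\omega}:=\sup_{x\ne y}|f^{(k)}(x)-f^{(k)}(y)|/|x-y|^\omega<\infty$. For $p>0$, with $\omega=p+1-\lceil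 p\rceil$, $\Lambda_p:=\{f\in\mathcal C^{\lceil p\rceil-1,\omega}(\mathbb R):|f|_{\lceil p\rceil-1,\omega}\le1\}$. Operators. $\mathcal N h:=\mathbb E[h(Z)]$ with $Z\sim N(0,1)$. $\partial$ is differentiation. $\Theta h$ is the standard solution $f$ of Stein's equation $xf(x)-f'(x)=\mathcal N h-h(x)$, i.e. $\Theta h(x)=e^{x^2/2}\int_{-\infty}^x(h(w)-\mathcal N h)e^{-w^2/2}\,dw$. For an integer $q\ge0$, $\Gamma(q):=\{(a,s_1,\dots,s_a): a,s_1,\dots,s_a\in\mathbb N_+,\ \sum_{j=1}^a s_j\le q\}$; $s_{1:a}$ abbreviates $s_1,\dots,s_a$. Wasserstein distance. $\mathcal W_p(\nu,\mu):=\inf_\gamma(\mathbb E_{(X,Y)\sim\gamma}|X-Y|^p)^{1/p}$, the infimum being over all couplings $\gamma$ of $\nu$ and $\mu$. $\mathcal L(W)$ is the law of $W$. $\mathcal O$-notation is as $n\to\infty$: implied constants do not depend on $n$ (nor on $h\in\Lambda_p$ in the expansion). *)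

(* Defs.v *)
From HB Require Import structures.
From mathcomp Require Import all_boot all_order all_algebra finmap.
From mathcomp Require Import all_classical all_reals all_analysis.
From mathcomp Require Import measurable_realfun.

Set Implicit Arguments.
Unset Strict Implicit.
Unset Printing Implicit Defensive.

Import Order.TTheory GRing.Theory Num.Theory.
Import numFieldNormedType.Exports.

Local Open Scope classical_set_scope.
Local Open Scope ring_scope.

Definition natceil (R : realType) (p : R) : nat := `|Num.ceil p|%N.

Definition maxnorm (d : nat) (i : 'rV[int]_d) : nat :=
  \max_(j < d) `|i ord0 j|%N.

(* [d(U1, U2) >= l]; it holds vacuously when U1 or U2 is empty, in which case
   the generated sigma-algebra is trivial and the mixing coefficient is 0. *)
Definition separated (d : nat) (l : nat) (U1 U2 : {fset 'rV[int]_d}) : Prop :=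
  forall i1 i2, i1 \in U1 -> i2 \in U2 -> (l <= maxnorm (i1 - i2))%N.

Section Mixing.
Context {R : realType} {disp : measure_display} {Om : measurableType disp}.
Variable P : probability Om R.
Local Open Scope ereal_scope.

Definition alpha (A B : set (set Om)) : \bar R :=
  ereal_sup [set x | exists E F,
    [/\ A E, B F & x = `|P (E `&` F) - P E * P F|]].

Definition sigma_field (I : choiceType) (X : I -> Om -> R) (U : {fset I}) :
    set (set Om) :=
  <<s [set E | exists i, i \in U /\
         exists2 B : set R, measurable B & E = X i @^-1` B] >>.

Definition alpha_mixing (d : nat) (T : {fset 'rV[int]_d})
    (X : 'rV[int]_d -> Om -> R) (q l : nat) : \bar R :=
  maxe 0 (ereal_sup [set x | exists U1 U2 : {fset 'rV[int]_d},
    [/\ (U1 `<=` T)%fset, (U2 `<=` T)%fset, (#|` U1| <= q)%N,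
        separated l U1 U2 &
        x = alpha (sigma_field X U1) (sigma_field X U2)]]).

End Mixing.

Section FunctionClass.
Context {R : realType}.

Definition is_Ck (k : nat) (f : R -> R) : Prop :=
  (forall j x, (j < k)%N -> derivable (derive1n j f) x 1) /\
  continuous (derive1n k f).

Definition holder_seminorm (k : nat) (w : R) (f : R -> R) : \bar R :=
  ereal_sup [set z | exists x y, x != y /\
    z = (`|derive1n k f x - derive1n k f y| / `|x - y| `^ w)%:E].

Definition Ckw (k : nat) (w : R) : set (R -> R) :=
  [set f | is_Ck k f /\ (holder_seminorm k w f < +oo)%E].

Definition Lambda (p : R) : set (R -> R) :=
  let k := (natceil p).-1 in
  let w := p + 1 - (natceil p)%:R in
  [set f | Ckw k w f /\ (holder_seminorm k w f <= 1)%E].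

End FunctionClass.

Section Operators.
Context {R : realType}.

Definition gauss_mean (h : R -> R) : R := \int[normal_prob 0 1]_x h x.

Definition Theta (h : R -> R) (x : R) : R :=
  expR (x ^+ 2 / 2) *
  \int[lebesgue_measure]_(w in `]-oo, x])
    ((h w - gauss_mean h) * expR (- (w ^+ 2 / 2))).

(* [:: s1; ...; sa] |-> (D^(s1+1) Theta) o ... o (D^(sa+1) Theta) *)
Definition Theta_comp (s : seq nat) (h : R -> R) : R -> R :=
  foldr (fun sj f => derive1n sj.+1 (Theta f)) h s.

(* The tuple (a, s1, ..., sa) is the sequence [:: s1; ...; sa] of size a. *)
Definition Gamma (q : nat) : set (seq nat) :=
  [set s | [/\ (0 < size s)%N, all (leq 1) s & (sumn s <= q)%N]].

End Operators.

Section Cumulant.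
Context {R : realType} {disp : measure_display} {Om : measurableType disp}.
Variables (P : probability Om R) (X : Om -> R).

Definition charfun_re (t : R) : R := fine 'E_P[fun w => cos (t * X w)].
Definition charfun_im (t : R) : R := fine 'E_P[fun w => sin (t * X w)].

(* Real and imaginary parts of log phi near 0, phi(t) = E[exp(i t X)], for the
   branch of log vanishing at phi(0) = 1 (where the real part of phi is
   positive). *)
Definition log_charfun_re (t : R) : R :=
  ln (Num.sqrt (charfun_re t ^+ 2 + charfun_im t ^+ 2)).
Definition log_charfun_im (t : R) : R := atan (charfun_im t / charfun_re t).

(* kappa_j = (-i)^j (log phi)^(j)(0).  As phi(-t) is the conjugate of phi(t),
   only the real (resp. imaginary) part of log phi contributes for j even
   (resp. odd), with sign (-i)^j = (-1)^(j/2) (resp. (-i)^j i = (-1)^((j-1)/2)).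
   This only requires a finite moment of order j. *)
Definition cumulant (j : nat) : R :=
  (-1) ^+ j./2 *
  derive1n j (if odd j then log_charfun_im else log_charfun_re) 0.

End Cumulant.

Section Wasserstein.
Context {R : realType}.
Local Open Scope ereal_scope.

(* [nu] and [mu] are plain set functions because the library puts the laws of
   random variables on [R] with its Borel structure, but [normal_prob] on
   [measurableTypeR R]; the two types have the same measurable sets. *)
Definition coupling (nu mu : set R -> \bar R) :
    set (probability (R * R)%type R) :=
  [set gamma | forall A : set R, measurable A ->
     gamma (A `*` setT) = nu A /\ gamma (setT `*` A) = mu A].

Definition Wasserstein (p : R) (nu mu : set R -> \bar R) : \bar R :=
  ereal_inf [set (\int[gamma]_z (`|z.1 - z.2| `^ p)%:E) `^ p^-1 |
             gamma in coupling nu mu].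

End Wasserstein.

Section NormalizedSum.
Context {R : realType} {disp : measure_display} {Om : measurableType disp}.
Variables (P : probability Om R) (I : choiceType) (T : {fset I}).
Variable X : I -> {RV P >-> R}.

Definition field_sum : {mfun Om >-> R} :=
  \sum_(i <- T) (X i : {mfun Om >-> R}).

Definition sigma2 : \bar R := 'V_P[field_sum].
Definition sigma : R := Num.sqrt (fine sigma2).

(* W = S / sigma, meaningful only when sigma > 0 (it is 0 when sigma = 0). *)
Definition normalized_sum : {RV P >-> R} := scale_mfun sigma^-1 field_sum.

End NormalizedSum.

(* Main.v *)
(* Put e = |T|^(-1/2) and w = p + 1 - k. Taylor expansion and independence, with
   the neighbourhood of each summand removed, give
   E[W f(W)] = sum_j a_j E[f^(j)(W)] + O(e^(L-1+w)) for f in C^(L,w). The remainder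
   vanishes on monomials, which forces a_j = kappa_(j+1) / j! and bounds the
   cumulants. For f = Theta h, Stein's equation turns E h(W) - N h into a
   combination of the E[(d^(j+1) Theta h)(W)]; as Theta gains one derivative on
   the Hoelder scale, the expansion follows by induction on the smoothness of h.

   For the Wasserstein distance, let Q be monotone with Q(Z) distributed as W,
   put A = E|Q(Z) - Z|^p, and let h' be a smoothing at scale e of the signed power
   p - 1 of the displacement Q(x) - x. Then h is in C Lambda_p and
   E h(W) - N h >= c A - C e^p. By Gaussian integration by parts the terms of the
   expansion of E h(W) - N h are at most e^j E(|q(Z)| |h^(j)(Z)|) for polynomials
   q, hence at most (c/2) A + C e^p by Young's inequality, so A = O(e^p). *)
Require Import Defs.
From HB Require Import structures.
From mathcomp Require Import all_boot all_order all_algebra finmap.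
From mathcomp Require Import all_classical all_reals all_analysis.
From mathcomp Require Import measurable_realfun ring lra zify.

Set Implicit Arguments.
Unset Strict Implicit.
Unset Printing Implicit Defensive.

Import Order.TTheory GRing.Theory Num.Theory.
Import numFieldNormedType.Exports.

Local Open Scope classical_set_scope.
Local Open Scope ring_scope.

(** * Chains of derivatives *)

(** For [h] in [Lambda p] a term of the expansion is in general only of order [e^j] with [j < p], so
    the expansion by itself does not give the Wasserstein rate. The test function is therefore
    adapted to [Q]: its derivative of order [j] is at most of the order [(|Q x - x| + e)^(p - j)].
    Such bounds are pointwise, and [Theta], an integral operator, does not keep them. This is why
    integration by parts moves every [Theta] onto polynomials that depend on the tuple only, until a
    single derivative of [h] is left.

    The moment exponent [p + 2 = k + 1 + w] is exactly that of a product of [k + 1] summands times a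
    [w]-Hölder factor. A Taylor term of degree [l] costs [l] derivatives and adds [l] summands, so
    the number of summands plus the order of smoothness never exceeds [k + 1]; this is also where
    the cardinality [k + 1] in the mixing coefficient comes from.

    Uniformity in [n] is obtained by collecting in [stein_expansion] all that is used about [W],
    with its constants, and by choosing every later constant before the probability space. *)

Section RealAnalysis.
Context {R : realType}.
Local Notation isd f x d := (is_derive (x : R) (1 : R) (f : R -> R) (d : R)).
Implicit Types (f g : R -> R) (F : nat -> R -> R) (x y w H : R).

(** A function travels together with its derivatives, [F j] being the [j]-th one. Passing to the
    [l]-th derivative is then a mere shift of the index. *)
Definition deriv_chain (L : nat) F :=
  forall j x, (j < L)%N -> is_derive x 1 (F j) (F j.+1 x).

Definition holder w H f := forall x y, `|f x - f y| <= H * `|x - y| `^ w.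

Definition deriv_shift (l : nat) F : nat -> R -> R := fun j => F (l + j)%N.

Lemma deriv_chain_shift L l F :
  deriv_chain L F -> deriv_chain (L - l) (deriv_shift l F).
Proof.
move=> dF j x jL; rewrite /deriv_shift addnS; apply: dF.
by rewrite -ltn_subRL.
Qed.

Lemma is_derive_cont f x d : is_derive x 1 f d -> {for x, continuous f}.
Proof. by move=> df; apply/differentiable_continuous/derivable1_diffP. Qed.

Lemma isd_eq f x d e : is_derive x 1 f d -> d = e -> is_derive x 1 f e.
Proof. by move=> + <-. Qed.

Lemma isd_of f x d : derivable f x 1 -> f^`()%classic x = d -> is_derive x 1 f d.
Proof. by move=> df <-; rewrite derive1E; exact: derivableP. Qed.

Lemma isd_cst c x : is_derive x 1 (fun=> c : R) 0.
Proof. exact: is_derive_cst. Qed.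

Lemma isd_id x : is_derive x 1 (fun y : R => y) 1.
Proof. exact: is_derive_id. Qed.

Lemma isdD f g x d e : is_derive x 1 f d -> is_derive x 1 g e ->
  is_derive x 1 (fun y => f y + g y) (d + e).
Proof. exact: is_deriveD. Qed.

Lemma isdN f x d : is_derive x 1 f d -> is_derive x 1 (fun y => - f y) (- d).
Proof. exact: is_deriveN. Qed.

Lemma isdB f g x d e : is_derive x 1 f d -> is_derive x 1 g e ->
  is_derive x 1 (fun y => f y - g y) (d - e).
Proof. exact: is_deriveB. Qed.

Lemma isdM f g x d e : is_derive x 1 f d -> is_derive x 1 g e ->
  is_derive x 1 (fun y => f y * g y) (d * g x + f x * e).
Proof.
move=> df dg; apply: (isd_eq (is_deriveM df dg)).
by rewrite /GRing.scale /= addrC [d * _]mulrC.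
Qed.

Lemma isdZ c f x d : is_derive x 1 f d -> is_derive x 1 (fun y => c * f y) (c * d).
Proof. exact: is_deriveZ. Qed.

Lemma isd_exp n x : is_derive x 1 (fun y : R => y ^+ n) (n%:R * x ^+ n.-1).
Proof.
apply: DeriveDef; first exact: exprn_derivable.
by rewrite exp_derive /GRing.scale /= mulr1.
Qed.

Lemma isd_comp f g x d e : is_derive (g x) 1 f d -> is_derive x 1 g e ->
  is_derive x 1 (fun y => f (g y)) (d * e).
Proof. by move=> df dg; exact: is_derive1_comp. Qed.

Lemma isd_sum n (f : nat -> R -> R) x (d : nat -> R) :
  (forall i, (i < n)%N -> is_derive x 1 (f i) (d i)) ->
  is_derive x 1 (fun y => \sum_(i < n) f i y) (\sum_(i < n) d i).
Proof.
elim: n => [|n IH] df.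
  rewrite big_ord0; have -> : (fun y => \sum_(i < 0) f i y) = (fun=> 0).
    by apply/funext => y; rewrite big_ord0.
  exact: isd_cst.
have -> : (fun y => \sum_(i < n.+1) f i y) =
    (fun y => \sum_(i < n) f i y + f n y).
  by apply/funext => y; rewrite big_ord_recr.
rewrite big_ord_recr /=; apply: isdD; last exact: df.
by apply: IH => i /ltnW; exact: df.
Qed.

Lemma isd_shift f x y d : is_derive (x + y) 1 f d ->
  is_derive y 1 (fun t => f (x + t)) d.
Proof.
move=> df; apply: (isd_eq (isd_comp df (isdD (isd_cst x y) (isd_id y)))).
by rewrite add0r mulr1.
Qed.

Lemma mvt_bound f f' a b K :
  (forall x, is_derive x 1 f (f' x)) ->
  (forall x, Num.min a b <= x <= Num.max a b -> `|f' x| <= K) ->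
  `|f b - f a| <= K * `|b - a|.
Proof.
move=> df bf.
have cf : forall x, {for x, continuous f} by move=> x; exact: is_derive_cont.
wlog ab : a b bf / a <= b.
  move=> wl; have [ab|/ltW ba] := leP a b; first exact: wl.
  rewrite distrC (distrC b); apply: wl => // x xab; apply: bf.
  by rewrite minC maxC.
rewrite min_l // max_r // in bf.
have [c cab ->] := @MVT_segment R f f' a b ab (fun x _ => df x)
  (continuous_subspaceT cf).
rewrite normrM ler_wpM2r //; apply: bf.
by move: cab; rewrite in_itv.
Qed.

(** The derivative in [t] of the remainder of order [L + 1] is the remainder of order [L] for [F 1],
    so induction and the mean value inequality suffice; the factorial that integration would gain is
    given up. *)
Lemma taylor_holder L F w H x t :
  0 <= w -> 0 <= H -> deriv_chain L F -> holder w H (F L) ->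
  `|F 0%N (x + t) - \sum_(l < L.+1) t ^+ l / l`!%:R * F l x|
    <= H * `|t| `^ (L%:R + w).
Proof.
move=> w0 H0; elim: L F t => [|L IH] F t dF hF.
  rewrite big_ord_recl big_ord0 /= expr0 fact0 divr1 mul1r addr0 add0r.
  by have := hF (x + t) x; rewrite addrAC subrr add0r.
pose G t := F 0%N (x + t) - \sum_(l < L.+2) t ^+ l / l`!%:R * F l x.
pose G' t := F 1%N (x + t) - \sum_(l < L.+1) t ^+ l / l`!%:R * F l.+1 x.
have dG s : isd G s (G' s).
  apply: isdB; first by apply: isd_shift; exact: dF.
  apply: (isd_eq (@isd_sum L.+2 (fun l t => t ^+ l / l`!%:R * F l x) s
    (fun l => if l is m.+1 then s ^+ m / m`!%:R * F l x else 0) _)); last first.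
    by rewrite big_ord_recl /= add0r.
  case=> [|m] _.
    have -> : (fun t : R => t ^+ 0 / 0`!%:R * F 0%N x) = (fun=> F 0%N x).
      by apply/funext => u; rewrite expr0 fact0 divr1 mul1r.
    exact: isd_cst.
  have -> : (fun t : R => t ^+ m.+1 / m.+1`!%:R * F m.+1 x) =
      (fun t => (m.+1`!%:R^-1 * F m.+1 x) * t ^+ m.+1).
    by apply/funext => u; ring.
  apply: (isd_eq (isdZ _ (isd_exp m.+1 s))) => /=.
  rewrite factS natrM; field.
  by rewrite [1 + _]addrC natr1 !pnatr_eq0 -!lt0n fact_gt0.
have G0 : G 0 = 0.
  rewrite /G addr0 big_ord_recl big1 ?addr0 /= ?expr0 ?fact0 ?divr1 ?mul1r ?subrr //.
  by move=> i _; rewrite exprS !mul0r.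
have := @mvt_bound G G' 0 t (H * `|t| `^ (L%:R + w)) dG.
rewrite G0 !subr0 => GG; apply: (le_trans (GG _)).
  move=> s sr.
  have st : `|s| <= `|t|.
    have [t0|t0] := leP 0 t; [rewrite min_l // max_r // in sr|].
      by rewrite !ger0_norm //; case/andP: sr.
    rewrite (min_r (ltW t0)) (max_l (ltW t0)) in sr.
    by case/andP: sr => ts s0; rewrite !ler0_norm ?lerN2 // ltW.
  have dF1 : deriv_chain L (fun j => F j.+1) by move=> j y jL; apply: dF.
  apply: (le_trans (IH _ s dF1 hF)).
  rewrite ler_wpM2l // ge0_ler_powR // ?nnegrE ?addr_ge0 //.
rewrite -mulrA ler_wpM2l // -natr1 -addrA (addrC 1) addrA.
have [->|t0] := eqVneq t 0.
  by rewrite normr0 mulr0 powR_ge0.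
rewrite (@powRD _ `|t| (L%:R + w) 1) ?powRr1 //.
by rewrite normr_eq0 t0 implybT.
Qed.

End RealAnalysis.

(** * Expectations of real-valued functions *)

Section Mean.
Context {R : realType} {d : measure_display} {Om : measurableType d}.
Variable P : probability Om R.
Implicit Types f g : Om -> R.

Definition Itg f := P.-integrable setT (EFin \o f).
Definition mean f : R := (\int[P]_w f w)%R.

Lemma eq_mean f g : f =1 g -> mean f = mean g.
Proof. by move=> fg; apply: eq_Rintegral => w _; exact: fg. Qed.

Lemma Itg_measurable f : Itg f -> measurable_fun setT f.
Proof. by move=> /measurable_int /measurable_EFinP. Qed.

Lemma Itg_le f g : measurable_fun setT f -> (forall w, `|f w| <= g w) ->
  Itg g -> Itg f.
Proof.
move=> mf fg ig; apply: (@le_integrable _ _ _ P setT _ (EFin \o f) (EFin \o g)) => //.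
  exact/measurable_EFinP.
by move=> w _ /=; rewrite lee_fin (le_trans (fg w)) // ler_norm.
Qed.

Lemma Itg_cst (c : R) : Itg (fun=> c).
Proof. exact: finite_measure_integrable_cst. Qed.

Lemma ItgD f g : Itg f -> Itg g -> Itg (fun w => f w + g w).
Proof. exact: (@integrableD _ _ _ P setT measurableT (EFin \o f) (EFin \o g)). Qed.

Lemma ItgB f g : Itg f -> Itg g -> Itg (fun w => f w - g w).
Proof. exact: (@integrableB _ _ _ P setT measurableT (EFin \o f) (EFin \o g)). Qed.

Lemma ItgZ (c : R) f : Itg f -> Itg (fun w => c * f w).
Proof. exact: (@integrableZl _ _ _ P setT measurableT c (EFin \o f)). Qed.

Lemma Itg_norm f : Itg f -> Itg (fun w => `|f w|).
Proof. by move=> If; apply: (@integrable_norm _ _ _ P setT f). Qed.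

Lemma Itg_sum (I : eqType) (s : seq I) (F : I -> Om -> R) :
  (forall i, i \in s -> Itg (F i)) -> Itg (fun w => \sum_(i <- s) F i w).
Proof.
elim: s => [|i s IH] Is.
  have -> : (fun w => \sum_(i <- [::]) F i w) = (fun=> 0).
    by apply/funext => w; rewrite big_nil.
  exact: Itg_cst.
have -> : (fun w => \sum_(j <- i :: s) F j w) =
    (fun w => F i w + \sum_(j <- s) F j w).
  by apply/funext => w; rewrite big_cons.
apply: ItgD; first by apply: Is; rewrite mem_head.
by apply: IH => j js; apply: Is; rewrite in_cons js orbT.
Qed.

Lemma meanD f g : Itg f -> Itg g -> mean (fun w => f w + g w) = mean f + mean g.
Proof. by move=> If Ig; exact: RintegralD. Qed.

Lemma meanB f g : Itg f -> Itg g -> mean (fun w => f w - g w) = mean f - mean g.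
Proof. by move=> If Ig; exact: RintegralB. Qed.

Lemma meanZ (c : R) f : Itg f -> mean (fun w => c * f w) = c * mean f.
Proof. by move=> If; exact: RintegralZl. Qed.

Lemma mean_cst (c : R) : mean (fun=> c) = c.
Proof. by rewrite /mean Rintegral_cst //= probability_setT mulr1. Qed.

Lemma mean_sum (I : eqType) (s : seq I) (F : I -> Om -> R) :
  (forall i, i \in s -> Itg (F i)) ->
  mean (fun w => \sum_(i <- s) F i w) = \sum_(i <- s) mean (F i).
Proof.
elim: s => [|i s IH] Is.
  rewrite big_nil; under eq_mean do rewrite big_nil; exact: mean_cst.
rewrite big_cons; under eq_mean do rewrite big_cons.
have IsS j : j \in s -> Itg (F j) by move=> js; apply: Is; rewrite in_cons js orbT.
rewrite meanD ?IH //; first by apply: Is; rewrite mem_head.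
exact: Itg_sum.
Qed.

Lemma mean_le f g : Itg f -> Itg g -> (forall w, f w <= g w) -> mean f <= mean g.
Proof. by move=> If Ig fg; apply: le_Rintegral. Qed.

Lemma mean_ge0 f : (forall w, 0 <= f w) -> 0 <= mean f.
Proof. by move=> f0; apply: Rintegral_ge0. Qed.

Lemma mean_norm f : Itg f -> `|mean f| <= mean (fun w => `|f w|).
Proof. by move=> If; apply: le_normr_Rintegral. Qed.

Lemma mean_bound f g : Itg f -> Itg g -> (forall w, `|f w| <= g w) ->
  `|mean f| <= mean g.
Proof.
move=> If Ig fg; apply: (le_trans (mean_norm If)).
by apply: mean_le => //; exact: Itg_norm.
Qed.

Lemma EFin_mean f : Itg f -> (mean f)%:E = (\int[P]_w (f w)%:E)%E.
Proof.
by move=> If; rewrite /mean /Rintegral fineK //; exact: integrable_fin_num.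
Qed.

End Mean.

(** * Growth of functions with a Hölder derivative *)

Section Growth.
Context {R : realType}.
Implicit Types (f g : R -> R) (F : nat -> R -> R) (x y w H : R).

Lemma holder_continuous w H f : 0 < w -> holder w H f -> continuous f.
Proof.
move=> w0 hf x; apply/cvgrPdist_le => e e0.
have H0 : 0 <= H.
  have := hf 1 0; rewrite subr0 normr1 powR1 mulr1; exact: le_trans.
near=> y.
apply: (le_trans (hf x y)).
have de : `|x - y| <= (e / (H + 1)) `^ w^-1.
  near: y; apply: cvgr_dist_le => //.
  by rewrite powR_gt0 // divr_gt0 // ltr_wpDl.
have : `|x - y| `^ w <= ((e / (H + 1)) `^ w^-1) `^ w.
  by rewrite ge0_ler_powR ?nnegrE ?powR_ge0 // ltW.
rewrite -powRrM mulVf ?gt_eqF // powRr1; last first.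
  by rewrite divr_ge0 ?addr_ge0 // ltW.
move=> /(ler_wpM2l H0) /le_trans; apply.
rewrite mulrA ler_pdivrMr ?ltr_wpDl // mulrC ler_wpM2l ?ltW //.
by rewrite ltrDl.
Unshelve. all: end_near. Qed.

Lemma chain_continuous w H L F j : 0 < w -> deriv_chain L F ->
  holder w H (F L) -> (j <= L)%N -> continuous (F j).
Proof.
move=> w0 dF hF; rewrite leq_eqVlt => /orP[/eqP ->|jL x].
  exact: holder_continuous hF.
exact: is_derive_cont (dF j x jL).
Qed.

Lemma holder_ge0 w H f : holder w H f -> 0 <= H.
Proof.
move=> hf; have := hf 1 0; rewrite subr0 normr1 powR1 mulr1; exact: le_trans.
Qed.

(** Taylor expansion at 0. The constant depends on [F] and serves integrability only; the
    quantitative bounds involve [F] through [H] alone. *)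
Lemma chain_growth w H L F j : 0 <= w -> deriv_chain L F ->
  holder w H (F L) -> (j <= L)%N ->
  exists c, forall x, `|F j x| <= c * (1 + `|x|) `^ ((L - j)%:R + w).
Proof.
move=> w0 dF hF jL.
have dS := deriv_chain_shift (l := j) dF.
have hS : holder w H (deriv_shift j F (L - j)%N) by rewrite /deriv_shift subnKC.
have H0 := holder_ge0 hF.
exists (H + \sum_(l < (L - j).+1) `|F (j + l)%N 0|) => x.
have := taylor_holder 0 x w0 H0 dS hS; rewrite add0r /deriv_shift addn0 => T.
rewrite -[F j x](subrK (\sum_(l < (L - j).+1) x ^+ l / l`!%:R * F (j + l)%N 0)).
apply: (le_trans (ler_normD _ _)); rewrite mulrDl lerD //.
  apply: (le_trans T); rewrite ler_wpM2l // ge0_ler_powR ?nnegrE ?addr_ge0 //.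
  by rewrite lerDr.
apply: (le_trans (ler_norm_sum _ _ _)); rewrite mulr_suml ler_sum // => l _.
rewrite normrM mulrC ler_wpM2l // normrM normfV (ger0_norm (ler0n _ _)).
have y1 : 1 <= 1 + `|x| by rewrite lerDl.
apply: (@le_trans _ _ (`|x ^+ l|)).
  by rewrite ler_pdivrMr ?ltr0n ?fact_gt0 // ler_peMr // ler1n fact_gt0.
rewrite normrX -powR_mulrn //.
apply: (@le_trans _ _ ((1 + `|x|) `^ l%:R)).
  by rewrite ge0_ler_powR ?nnegrE ?addr_ge0 // lerDr.
apply: ler_powR => //; rewrite ler_wpDr // ler_nat -ltnS; exact: ltn_ord.
Qed.

End Growth.

(** * Expansion of [E(W f(W))] under local dependence *)

Section LocalExpansion.
Context {R : realType} {d : measure_display} {Om : measurableType d}.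
Variables (P : probability Om R) (I : eqType) (T : seq I) (X : I -> Om -> R).
Variables (k B : nat) (w M : R) (nb : seq I -> seq I).
Let q : R := k%:R + 1 + w.
Hypothesis w_gt0 : 0 < w.
Hypothesis mX : forall i, measurable_fun setT (X i).
Hypothesis X_int : forall i, i \in T -> Itg P (fun om => `|X i om| `^ q).
Hypothesis X_mom : forall i, i \in T -> mean P (fun om => `|X i om| `^ q) <= M.
Hypothesis M_ge0 : 0 <= M.
Hypothesis B_gt0 : (0 < B)%N.
Hypothesis nbT : forall J : seq I, {subset nb J <= T}.
Hypothesis nbB : forall J, (size J <= k.+1)%N -> (size (nb J) <= B)%N.

Definition sumX (A : seq I) (om : Om) : R := \sum_(i <- A) X i om.
Definition prodX (A : seq I) (om : Om) : R := \prod_(i <- A) X i om.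
Let S := sumX T.

Hypothesis indep : forall (J : seq I) (g : R -> R), {subset J <= T} -> (size J <= k.+1)%N ->
  continuous g -> Itg P (prodX J) ->
  Itg P (fun om => g (S om - sumX (nb J) om)) ->
  mean P (fun om => prodX J om * g (S om - sumX (nb J) om)) =
  mean P (prodX J) * mean P (fun om => g (S om - sumX (nb J) om)).

Let q_ge0 : 0 <= q.
Proof. by rewrite /q !addr_ge0 // ltW. Qed.

(** One variable that dominates every [X i] with [i] in [A] and every partial sum over [A]. Being at
    least 1, it allows exponents to be raised, so its moment of order [q] controls all products of
    total degree at most [q]. *)
Definition envelope (A : seq I) (om : Om) : R := 1 + \sum_(i <- A) `|X i om|.
Local Notation U := envelope.

Let U_ge1 A om : 1 <= U A om.
Proof. by rewrite /U lerDl sumr_ge0. Qed.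

Let U_gt0 A om : 0 < U A om.
Proof. exact: lt_le_trans ltr01 (U_ge1 _ _). Qed.

Let U_ge0 A om : 0 <= U A om.
Proof. exact: ltW. Qed.

(** The envelope is at most [size A + 1] times the maximum of 1 and the [|X i|], and the power [q]
    of that maximum is one of the terms on the right. *)
Let U_pow A om : U A om `^ q <= (size A).+1%:R `^ q * (1 + \sum_(i <- A) `|X i om| `^ q).
Proof.
pose b := \big[Num.max/1]_(i <- A) `|X i om|.
have b1 : 1 <= b.
  rewrite /b; elim: (A) => [|i s IH]; first by rewrite big_nil.
  by rewrite big_cons le_max IH orbT.
have bq : b `^ q <= 1 + \sum_(i <- A) `|X i om| `^ q.
  rewrite /b; elim: {b b1} A => [|i A IH]; first by rewrite !big_nil powR1 addr0.
  rewrite !big_cons maxEle; case: ifP => _.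
    by rewrite addrCA (le_trans IH) // lerDr powR_ge0.
  by rewrite addrCA lerDl addr_ge0 // sumr_ge0 // => j _; rewrite powR_ge0.
have Ub : U A om <= (size A).+1%:R * b.
  rewrite /U /b; elim: {b b1 bq} A => [|i A IH].
    by rewrite !big_nil addr0 mulr1.
  rewrite !big_cons addrCA /=.
  set b := \big[Num.max/_]_(_ <- A) _ in IH *.
  have bm : b <= Num.max `|X i om| b by rewrite le_max lexx orbT.
  have Xm : `|X i om| <= Num.max `|X i om| b by rewrite le_max lexx.
  rewrite -[(size A).+2%:R]natr1 mulrDl mul1r addrC lerD //.
  by rewrite (le_trans IH) // ler_wpM2l.
apply: le_trans (ler_wpM2l (powR_ge0 _ _) bq).
rewrite -powRM // ?(le_trans _ b1) //.
have b0 : 0 <= b by exact: le_trans b1.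
by apply: ge0_ler_powR; rewrite ?nnegrE ?mulr_ge0 // ltW.
Qed.

Let mU A : measurable_fun setT (U A).
Proof.
apply: measurable_funD => //.
apply: measurable_sum => i; exact: measurableT_comp.
Qed.

Definition env_bound (n : nat) : R := n.+1%:R `^ q * (1 + n%:R * M).

Let U_int A : {subset A <= T} -> Itg P (fun om => U A om `^ q).
Proof.
move=> AT.
apply: (@Itg_le _ _ _ P _
  (fun om => (size A).+1%:R `^ q * (1 + \sum_(i <- A) `|X i om| `^ q))).
- exact: measurableT_comp (measurable_powR q) (mU A).
- by move=> om; rewrite ger0_norm ?powR_ge0.
- apply: ItgZ; apply: ItgD; first exact: Itg_cst.
  by apply: Itg_sum => i /AT; exact: X_int.
Qed.

Let U_mean A n : {subset A <= T} -> (size A <= n)%N ->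
  mean P (fun om => U A om `^ q) <= env_bound n.
Proof.
move=> AT An.
have Is : Itg P (fun om => \sum_(i <- A) `|X i om| `^ q).
  by apply: Itg_sum => i /AT; exact: X_int.
have I1 : Itg P (fun om => 1 + \sum_(i <- A) `|X i om| `^ q).
  by apply: ItgD => //; exact: Itg_cst.
apply: (@le_trans _ _ (mean P
  (fun om => (size A).+1%:R `^ q * (1 + \sum_(i <- A) `|X i om| `^ q)))).
  by apply: mean_le => //; [exact: U_int|exact: ItgZ].
rewrite meanZ // meanD //; last exact: Itg_cst.
rewrite mean_cst mean_sum //; last by move=> i /AT; exact: X_int.
rewrite /env_bound ler_pM ?powR_ge0 //.
- rewrite addr_ge0 // sumr_ge0 // => i _; apply: mean_ge0 => om; exact: powR_ge0.
- by rewrite ge0_ler_powR ?nnegrE // ler_nat.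
- rewrite lerD2l.
  apply: (@le_trans _ _ (\sum_(i <- A) M)).
    by rewrite big_seq_cond [leRHS]big_seq_cond ler_sum // => i /andP[/AT /X_mom].
  by rewrite big_const_seq count_predT iter_addr_0 -(mulr_natl M) ler_wpM2r // ler_nat.
Qed.


(** Bookkeeping for integrability: orders add under products, and an order of at most [q] is
    integrable. The constant may grow with [T] and never enters an estimate. *)
Definition order (t : R) (f : Om -> R) :=
  measurable_fun setT f /\ exists c, forall om, `|f om| <= c * U T om `^ t.

Let order_Itg t f : t <= q -> order t f -> Itg P f.
Proof.
move=> tq [mf [c fc]].
apply: (@Itg_le _ _ _ P _ (fun om => `|c| * U T om `^ q)) => //.
  move=> om; apply: (le_trans (fc om)).
  apply: (@le_trans _ _ (`|c| * U T om `^ t)).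
    by rewrite ler_wpM2r ?powR_ge0 // ler_norm.
  by rewrite ler_wpM2l // ler_powR.
by apply: ItgZ; exact: U_int.
Qed.

Let orderM s t f g : order s f -> order t g ->
  order (s + t) (fun om => f om * g om).
Proof.
move=> [mf [c fc]] [mg [e ge]]; split; first exact: measurable_funM.
exists (c * e) => om; rewrite normrM powRD; last by rewrite (gt_eqF (U_gt0 _ _)) implybT.
by rewrite mulrACA ler_pM.
Qed.

Let order_prod J : {subset J <= T} -> order (size J)%:R (prodX J).
Proof.
move=> JT; split; first by apply: measurable_prod.
exists 1 => om; rewrite mul1r powR_mulrn ?U_ge0 //.
elim: J JT => [|i J IH] JT; first by rewrite /prodX big_nil expr0 normr1.
rewrite /prodX big_cons normrM exprS ler_pM //; last first.
  by apply: IH => j jJ; apply: JT; rewrite in_cons jJ orbT.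
have iT : i \in T by apply: JT; rewrite mem_head.
by rewrite /U (big_rem i) //= addrCA lerDl addr_ge0 // sumr_ge0.
Qed.

Let order_sum J : {subset J <= T} -> order 1 (sumX J).
Proof.
move=> JT; split; first by apply: measurable_sum.
exists (size J)%:R => om; rewrite powRr1 ?U_ge0 //.
elim: J JT => [|i J IH] JT; first by rewrite /sumX big_nil normr0 mul0r.
rewrite /sumX big_cons (le_trans (ler_normD _ _)) //= -natr1 mulrDl mul1r addrC lerD //.
  by apply: IH => j jJ; apply: JT; rewrite in_cons jJ orbT.
have iT : i \in T by apply: JT; rewrite mem_head.
by rewrite /U (big_rem i) //= addrCA lerDl addr_ge0 // sumr_ge0.
Qed.

Let orderX n f : order 1 f -> order n%:R (fun om => f om ^+ n).
Proof.
move=> [mf [c fc]]; split; first exact: measurable_funX.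
exists (c ^+ n) => om; rewrite normrX powR_mulrn ?U_ge0 // -exprMn.
have Uc : `|f om| <= c * U T om by have := fc om; rewrite powRr1 ?U_ge0.
by apply: lerXn2r; rewrite ?nnegrE // (le_trans _ Uc).
Qed.

Let order_chain L F H j (V : Om -> R) : deriv_chain L F -> holder w H (F L) ->
  (j <= L)%N -> order 1 V -> order ((L - j)%:R + w) (fun om => F j (V om)).
Proof.
move=> dF hF jL [mV [c Vc]].
have [e Fe] := chain_growth (ltW w_gt0) dF hF jL.
have e0 : 0 <= e.
  have := Fe 0; rewrite normr0 addr0 powR1 mulr1; exact: le_trans.
have c0 : 0 <= c.
  have [om] : [set: Om] !=set0.
    apply/set0P/eqP => O0; have := @probability_setT _ _ _ P.
    by rewrite O0 measure0 => /eqP; rewrite eq_sym onee_eq0.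
  move=> _; have := Vc om; rewrite powRr1 ?U_ge0 // => /(le_trans (normr_ge0 _)).
  by rewrite pmulr_lge0.
split.
  apply: measurableT_comp => //; apply: continuous_measurable_fun.
  exact: (chain_continuous w_gt0 dF hF).
exists (e * (1 + c) `^ ((L - j)%:R + w)) => om; apply: (le_trans (Fe _)).
rewrite -mulrA ler_wpM2l // -powRM ?U_ge0 ?addr_ge0 //.
have Lw : 0 <= (L - j)%:R + w by rewrite addr_ge0 // ltW.
apply: ge0_ler_powR => //; rewrite ?nnegrE ?mulr_ge0 ?U_ge0 ?addr_ge0 //.
rewrite mulrDl mul1r lerD //.
by have := Vc om; rewrite powRr1 ?U_ge0.
Qed.

Let S_order : order 1 S.
Proof. exact: order_sum. Qed.

(** The functional [Lam] is, up to an error controlled by the Hölder constant, a combination of the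
    [E[F j (S)]] whose coefficients do not depend on [F]. One constant bounds both coefficients and
    error, which makes the notion stable under the operations that follow. *)
Definition approx (L : nat) (Lam : (nat -> R -> R) -> R) (C : R) :=
  exists b : nat -> R, (forall j, `|b j| <= C) /\
    forall F H, deriv_chain L F -> holder w H (F L) ->
    `|Lam F - \sum_(j < L.+1) b j * mean P (fun om => F j (S om))| <= C * H.

Let approx_ge0 L Lam C : approx L Lam C -> 0 <= C.
Proof. by move=> [b [bC _]]; exact: le_trans (bC 0%N). Qed.

Let approx_le L Lam C C' : C <= C' -> approx L Lam C -> approx L Lam C'.
Proof.
move=> CC' [b [bC h]]; exists b; split => [j|F H dF hF].
  exact: le_trans CC'.
by rewrite (le_trans (h _ _ dF hF)) // ler_wpM2r // (holder_ge0 hF).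
Qed.

Let approx_pert L A A' C C' : 0 <= C' ->
  (forall F H, deriv_chain L F -> holder w H (F L) -> `|A' F - A F| <= C' * H) ->
  approx L A C -> approx L A' (C + C').
Proof.
move=> C0 AA [b [bC h]]; exists b; split => [j|F H dF hF].
  by rewrite (le_trans (bC j)) // lerDl.
rewrite -[A' F](subrK (A F)) -addrA (le_trans (ler_normD _ _)) //.
by rewrite mulrDl [leRHS]addrC lerD //; [exact: AA|exact: h].
Qed.

Let approx_ext L A A' C :
  (forall F H, deriv_chain L F -> holder w H (F L) -> A' F = A F) ->
  approx L A C -> approx L A' C.
Proof.
move=> AA [b [bC h]]; exists b; split => // F H dF hF.
by rewrite (AA _ _ dF hF); exact: h.
Qed.

Let approxD L A1 A2 C1 C2 : approx L A1 C1 -> approx L A2 C2 ->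
  approx L (fun F => A1 F + A2 F) (C1 + C2).
Proof.
move=> [b1 [bC1 h1]] [b2 [bC2 h2]]; exists (fun j => b1 j + b2 j); split.
  by move=> j; rewrite (le_trans (ler_normD _ _)) // lerD.
move=> F H dF hF; under eq_bigr do rewrite mulrDl.
rewrite big_split /= opprD addrACA (le_trans (ler_normD _ _)) // mulrDl.
by rewrite lerD; [| exact: h1| exact: h2].
Qed.

Let approxZ L A c C : approx L A C -> approx L (fun F => c * A F) (`|c| * C).
Proof.
move=> [b [bC h]]; exists (fun j => c * b j); split.
  by move=> j; rewrite normrM ler_wpM2l.
move=> F H dF hF; under eq_bigr do rewrite -mulrA.
by rewrite -mulr_sumr -mulrBr normrM -mulrA ler_wpM2l // h.
Qed.

Let approx_sum (K : eqType) L (s : seq K) A C :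
  (forall i, i \in s -> approx L (A i) C) ->
  approx L (fun F => \sum_(i <- s) A i F) ((size s)%:R * C).
Proof.
elim: s => [|i s IH] As.
  exists (fun=> 0); split=> [j|F H dF hF]; first by rewrite mul0r normr0.
  by rewrite big_nil big1 ?subrr ?normr0 ?mul0r // => j _; rewrite mul0r.
apply: (@approx_ext _ (fun F => A i F + \sum_(j <- s) A j F)).
  by move=> F H _ _; rewrite big_cons.
rewrite /= -natr1 mulrDl mul1r addrC; apply: approxD.
  by apply: As; rewrite mem_head.
by apply: IH => j js; apply: As; rewrite in_cons js orbT.
Qed.

Let approx_shift L l A C : (l <= L)%N -> approx (L - l) A C ->
  approx L (fun F => A (deriv_shift l F)) C.
Proof.
move=> lL appA; have C0 := approx_ge0 appA; move: appA => [b [bC h]].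
exists (fun j => if (j < l)%N then 0 else b (j - l)%N); split.
  by move=> j; case: ifP => _ //; rewrite normr0.
move=> F H dF hF.
have -> : \sum_(j < L.+1) (if (j < l)%N then 0 else b (j - l)%N) *
    mean P (fun om => F j (S om)) =
  \sum_(j < (L - l).+1) b j * mean P (fun om => deriv_shift l F j (S om)).
  rewrite -(big_mkord xpredT (fun j => (if (j < l)%N then 0 else b (j - l)%N) *
    mean P (fun om => F j (S om)))).
  rewrite -(big_mkord xpredT (fun j => b j *
    mean P (fun om => deriv_shift l F j (S om)))).
  rewrite (big_cat_nat (n := l)) //=; last exact: leqW.
  rewrite big_nat_cond big1 ?add0r; last first.
    by move=> j; rewrite andbT => /andP[_ ->]; rewrite mul0r.
  rewrite -{1}[l]add0n big_addn subSn //; apply: eq_bigr => j _.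
  by rewrite ltnNge leq_addl /= addnK /deriv_shift addnC.
apply: h; first exact: deriv_chain_shift.
by rewrite /deriv_shift subnKC.
Qed.

Let approx_mean L : approx L (fun F => mean P (fun om => F 0%N (S om))) 1.
Proof.
exists (fun j => (j == 0%N)%:R); split.
  by case=> [|j] /=; rewrite ?normr1 ?normr0.
move=> F H dF hF; rewrite big_ord_recl big1 /= ?mul1r ?addr0 ?subrr ?normr0 ?mul1r.
  exact: holder_ge0 hF.
by move=> j _; rewrite mul0r.
Qed.

Let size_le_q (n : nat) L : (n + L <= k.+1)%N -> n%:R + (L%:R + w) <= q.
Proof. by move=> nL; rewrite /q addrA lerD2r natr1 -natrD ler_nat. Qed.

(** One factor of the power is written as a sum over [N] and its index is absorbed into [J]. Each
    such step costs a factor [B] and leaves [size J + l + L] unchanged, so the moments still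
    suffice. *)
Let approx_mulsum N L C l J : 0 <= C -> {subset N <= T} -> (size N <= B)%N ->
  {subset J <= T} -> (size J + l + L <= k.+1)%N ->
  (forall J' : seq I, {subset J' <= T} -> size J' = (size J + l)%N ->
    approx L (fun F => mean P (fun om => prodX J' om * F 0%N (S om))) C) ->
  approx L (fun F => mean P
    (fun om => prodX J om * sumX N om ^+ l * F 0%N (S om))) (B%:R ^+ l * C).
Proof.
move=> C0 NT NB; elim: l J => [|l IH] J JT sz hJ.
  rewrite expr0 mul1r; apply: approx_ext (hJ J JT (esym (addn0 _))) => F H _ _.
  by apply: eq_mean => om; rewrite expr0 mulr1.
have sz' i : (size (i :: J) + l + L <= k.+1)%N by rewrite /= addSnnS.
have JT' i : i \in N -> {subset i :: J <= T}.
  by move=> iN j; rewrite in_cons => /orP[/eqP ->|/JT //]; exact: NT.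
have H1 i : i \in N -> approx L (fun F => mean P (fun om =>
   prodX (i :: J) om * sumX N om ^+ l * F 0%N (S om))) (B%:R ^+ l * C).
  move=> iN; apply: IH => //; first exact: JT'.
  by move=> J' J'T sJ'; apply: hJ => //; rewrite sJ' /= addSnnS.
apply: (@approx_le _ _ ((size N)%:R * (B%:R ^+ l * C))).
  by rewrite exprS -mulrA ler_wpM2r ?mulr_ge0 ?exprn_ge0 // ler_nat.
apply: approx_ext (approx_sum H1) => F H dF hF.
rewrite -mean_sum.
  apply: eq_mean => om; rewrite exprS /prodX.
  under [RHS]eq_bigr do rewrite big_cons.
  rewrite /sumX -!mulr_suml; ring.
move=> i iN; apply: (@order_Itg ((size (i :: J))%:R + l%:R + (L%:R + w))).
  by rewrite -natrD; exact: size_le_q.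
apply: orderM; first apply: orderM; first by apply: order_prod; exact: JT'.
  by apply: orderX; exact: order_sum.
by have := order_chain dF hF (leq0n L) S_order; rewrite subn0.
Qed.

Let K := env_bound (k.+1 + B).

Let K_ge1 : 1 <= K.
Proof.
rewrite /K /env_bound; have M1 : 1 <= 1 + (k.+1 + B)%:R * M by rewrite lerDl mulr_ge0.
rewrite -[X in X <= _]mulr1 ler_pM //.
by rewrite -[X in X <= _](powRr0 (k.+1 + B).+1%:R) ler_powR // ler1n.
Qed.

(** [K * K + K] bounds the two Taylor remainders and the next [K] is the coefficient of
    [E[F 0 (S)]]. Each of the [L] Taylor terms costs at most [1 + K] times the expansion of a power
    of the neighbourhood sum at a lower order. *)
Fixpoint approx_cst (L : nat) : R :=
  if L is L'.+1 then
    K * K + K + (K + L'.+1%:R * ((1 + K) * (B%:R ^+ k.+1 * approx_cst L')))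
  else K * K + K + (K + 0).

Let approx_cst_ge0 L : 0 <= approx_cst L.
Proof.
have K0 : 0 <= K by exact: le_trans K_ge1.
by elim: L => [|L IH] /=;
  do ![exact: K0 | exact: IH | apply: addr_ge0 | apply: mulr_ge0 | apply: exprn_ge0 | done].
Qed.

Let approx_cst_le L L' : (L <= L')%N -> approx_cst L <= approx_cst L'.
Proof.
have K0 : 0 <= K by exact: le_trans K_ge1.
have B1 : 1 <= B%:R ^+ k.+1 :> R by rewrite exprn_ege1 // ler1n.
move=> /subnK <-; elim: (_ - _)%N => [|m IH]; first by rewrite add0n.
rewrite addSn; apply: (le_trans IH) => /=.
set c := approx_cst _.
have c0 : 0 <= c by exact: approx_cst_ge0.
have e1 : c <= B%:R ^+ k.+1 * c by rewrite ler_peMl.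
have e2 : B%:R ^+ k.+1 * c <= (1 + K) * (B%:R ^+ k.+1 * c).
  by apply: ler_peMl; [exact: le_trans e1|rewrite lerDl].
have e3 : (1 + K) * (B%:R ^+ k.+1 * c) <=
    (m + L).+1%:R * ((1 + K) * (B%:R ^+ k.+1 * c)).
  by apply: ler_peMl; [exact: le_trans (le_trans e1 e2)|rewrite ler1n].
have KK : 0 <= K * K by exact: mulr_ge0.
apply: (le_trans e1); apply: (le_trans e2); apply: (le_trans e3).
by rewrite addrA lerDr; do 2!apply: addr_ge0 => //.
Qed.

(* [F 0 (S - S_N)], with [N] the neighbourhood of [J], is Taylor expanded around
   [S]. The product over [J] is independent of [S - S_N]; in the remaining terms
   the powers of [S_N] are expanded into products over longer index sequences,
   to which the induction on [L] applies. *)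
Lemma local_approx L J : {subset J <= T} -> (size J + L <= k.+1)%N ->
  approx L (fun F => mean P (fun om => prodX J om * F 0%N (S om))) (approx_cst L).
Proof.
have K0 : 0 <= K by exact: le_trans K_ge1.
elim/ltn_ind: L J => L IH J JT sJL.
have sJ : (size J <= k.+1)%N by exact: leq_trans (leq_addr _ _) sJL.
(* The remainders are bounded by the envelope over [A] alone, whose moment does not depend on the
   size of [T]. *)
pose N := nb J; pose A := J ++ N.
have AT : {subset A <= T} by move=> i; rewrite mem_cat => /orP[/JT|/nbT].
have sA : (size A <= k.+1 + B)%N by rewrite size_cat leq_add // nbB.
have JU om : `|prodX J om| <= U A om `^ (size J)%:R.
  rewrite powR_mulrn ?U_ge0 // /prodX /U /A big_cat /= addrA; set c := \sum_(i <- N) _.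
  have c0 : 0 <= c by rewrite sumr_ge0.
  elim: (J) => [|i s IHs]; first by rewrite !big_nil expr0 normr1.
  rewrite !big_cons normrM exprS ler_pM //.
    have s0 : 0 <= \sum_(j <- s) `|X j om| by rewrite sumr_ge0.
    by have := normr_ge0 (X i om); lra.
  rewrite (le_trans IHs) // lerXn2r ?nnegrE ?addr_ge0 ?sumr_ge0 //.
  by rewrite lerD2r lerD2l lerDr.
have NU om : `|sumX N om| <= U A om.
  rewrite /sumX (le_trans (ler_norm_sum _ _ _)) // /U /A big_cat /=.
  by rewrite addrA lerDr addr_ge0 // sumr_ge0.
have intJ : Itg P (prodX J).
  apply: (@order_Itg (size J)%:R); last exact: order_prod.
  by rewrite (le_trans _ (size_le_q sJL)) // lerDl addr_ge0 // ltW.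
have EJ : `|mean P (prodX J)| <= K.
  apply: le_trans (U_mean AT sA); apply: mean_bound => //; first exact: (U_int AT).
  move=> om; apply: (le_trans (JU om)); apply: ler_powR => //.
  by rewrite (le_trans _ (size_le_q sJL)) // lerDl addr_ge0 // ltW.
pose rem F om : R := F 0%N (S om - sumX N om) -
  \sum_(l < L.+1) (- sumX N om) ^+ l / l`!%:R * F l (S om).
pose LamA l F := mean P (fun om => prodX J om * sumX N om ^+ l * F l (S om)).
pose LamB l F := mean P (fun om => sumX N om ^+ l * F l (S om)).
pose c l : R := (-1) ^+ l / l`!%:R.
have SN_order : order 1 (sumX N) by apply: order_sum => i; exact: nbT.
have D_order : order 1 (fun om => S om - sumX N om).
  case: S_order => mS [a Sa]; case: SN_order => mN [b Nb]; split.
    exact: measurable_funB.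
  exists (a + b) => om; rewrite (le_trans (ler_normB _ _)) // mulrDl.
  by rewrite lerD // ?Sa ?Nb.
(* With [Y] the product over [J] and [G] the value of [F 0] at [S - S_N], both sides of [E[Y G] =
   E[Y] E[G]] are Taylor expanded around [S] and the result is solved for [E[Y F 0 (S)]]; [main] is
   what is left without the remainders. *)
pose main F := mean P (prodX J) * mean P (fun om => F 0%N (S om)) +
  \sum_(l <- iota 1 L) c l * (mean P (prodX J) * LamB l F - LamA l F).
have ordB F H l : deriv_chain L F -> holder w H (F L) -> (l <= L)%N ->
    order (L%:R + w) (fun om => sumX N om ^+ l * F l (S om)).
  move=> dF hF lL; have -> : L%:R + w = l%:R + ((L - l)%:R + w).
    by rewrite addrA -natrD subnKC.
  apply: orderM; first exact: orderX.
  exact: (order_chain dF hF).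
have intB F H l : deriv_chain L F -> holder w H (F L) -> (l <= L)%N ->
    Itg P (fun om => sumX N om ^+ l * F l (S om)).
  move=> dF hF lL; apply: order_Itg (ordB _ _ _ dF hF lL).
  by rewrite (le_trans _ (size_le_q sJL)) // lerDr.
have intA F H l : deriv_chain L F -> holder w H (F L) -> (l <= L)%N ->
    Itg P (fun om => prodX J om * (sumX N om ^+ l * F l (S om))).
  move=> dF hF lL; apply: order_Itg (orderM (order_prod JT) (ordB _ _ _ dF hF lL)).
  exact: size_le_q.
have rem_bound F H om : deriv_chain L F -> holder w H (F L) ->
    `|rem F om| <= H * U A om `^ (L%:R + w).
  move=> dF hF; have H0 := holder_ge0 hF.
  apply: (le_trans (taylor_holder _ _ (ltW w_gt0) H0 dF hF)).
  by rewrite ler_wpM2l // normrN ge0_ler_powR ?nnegrE ?U_ge0 // addr_ge0 // ltW.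
have mrem F H : deriv_chain L F -> holder w H (F L) -> measurable_fun setT (rem F).
  move=> dF hF; apply: measurable_funB.
    by have [] := order_chain dF hF (leq0n L) D_order.
  apply: measurable_sum => l; apply: measurable_funM.
    by apply: measurable_funM => //; apply: measurable_funX; apply: measurableT_comp => //; case: SN_order.
  have lL : (l <= L)%N by rewrite -ltnS.
  by have [] := order_chain dF hF lL S_order.
have UAq t om : t <= q -> U A om `^ t <= U A om `^ q by move=> tq; exact: ler_powR.
have Lq : L%:R + w <= q by rewrite (le_trans _ (size_le_q sJL)) // lerDr.
have intU : Itg P (fun om => U A om `^ q) by exact: (U_int AT).
have rem_q F H om : deriv_chain L F -> holder w H (F L) ->
    `|rem F om| <= H * U A om `^ q.
  move=> dF hF; apply: (le_trans (rem_bound _ _ om dF hF)).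
  by rewrite ler_wpM2l ?(holder_ge0 hF) // UAq.
have Yrem_q F H om : deriv_chain L F -> holder w H (F L) ->
    `|prodX J om * rem F om| <= H * U A om `^ q.
  move=> dF hF; rewrite normrM.
  apply: (@le_trans _ _ (U A om `^ (size J)%:R * (H * U A om `^ (L%:R + w)))).
    by rewrite ler_pM // (rem_bound _ _ _ dF hF).
  rewrite mulrCA -powRD; last by rewrite (gt_eqF (U_gt0 _ _)) implybT.
  by rewrite ler_wpM2l ?(holder_ge0 hF) // UAq // size_le_q.
have intrem F H : deriv_chain L F -> holder w H (F L) -> Itg P (rem F).
  move=> dF hF; apply: (@Itg_le _ _ _ P _ (fun om => H * U A om `^ q)).
  - exact: (mrem _ _ dF hF).
  - by move=> om; exact: rem_q.
  - exact: ItgZ.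
have intYrem F H : deriv_chain L F -> holder w H (F L) ->
    Itg P (fun om => prodX J om * rem F om).
  move=> dF hF; apply: (@Itg_le _ _ _ P _ (fun om => H * U A om `^ q)).
  - by apply: measurable_funM; [case: (order_prod JT)|exact: (mrem _ _ dF hF)].
  - by move=> om; exact: Yrem_q.
  - exact: ItgZ.
have expand F om : F 0%N (S om - sumX N om) = F 0%N (S om) +
    \sum_(l <- iota 1 L) c l * (sumX N om ^+ l * F l (S om)) + rem F om.
  rewrite /rem -(big_mkord xpredT
    (fun l => (- sumX N om) ^+ l / l`!%:R * F l (S om))).
  rewrite big_ltn // expr0 fact0 divr1 mul1r /index_iota subSS subn0.
  have -> : \sum_(l <- iota 1 L) (- sumX N om) ^+ l / l`!%:R * F l (S om) =
      \sum_(l <- iota 1 L) c l * (sumX N om ^+ l * F l (S om)).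
    by apply: eq_bigr => l _; rewrite /c (exprNn (sumX N om)); ring.
  by rewrite addrCA subrr addr0.
have iotaL l : l \in iota 1 L -> (0 < l)%N /\ (l <= L)%N.
  by rewrite mem_iota add1n ltnS => /andP[].
have main_eq F H : deriv_chain L F -> holder w H (F L) ->
    mean P (fun om => prodX J om * F 0%N (S om)) - main F =
    mean P (prodX J) * mean P (rem F) - mean P (fun om => prodX J om * rem F om).
  move=> dF hF.
  have i0 : Itg P (fun om => F 0%N (S om)).
    apply: eq_integrable (intB _ _ _ dF hF (leq0n L)) => // om _ /=.
    by rewrite expr0 mul1r.
  have iY0 : Itg P (fun om => prodX J om * F 0%N (S om)).
    apply: eq_integrable (intA _ _ _ dF hF (leq0n L)) => // om _ /=.
    by rewrite expr0 mul1r.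
  have iB : Itg P (fun om => \sum_(l <- iota 1 L) c l * (sumX N om ^+ l * F l (S om))).
    by apply: Itg_sum => l /iotaL[_ lL]; apply: ItgZ; exact: (intB _ _ _ dF hF).
  have iA : Itg P (fun om =>
      \sum_(l <- iota 1 L) c l * (prodX J om * (sumX N om ^+ l * F l (S om)))).
    by apply: Itg_sum => l /iotaL[_ lL]; apply: ItgZ; exact: (intA _ _ _ dF hF).
  have iR := intrem _ _ dF hF; have iYR := intYrem _ _ dF hF.
  have E1 : mean P (fun om => F 0%N (S om - sumX N om)) =
      mean P (fun om => F 0%N (S om)) + \sum_(l <- iota 1 L) c l * LamB l F + mean P (rem F).
    under eq_mean do rewrite expand.
    rewrite meanD //; last exact: ItgD.
    rewrite meanD // mean_sum; last first.
      by move=> l /iotaL[_ lL]; apply: ItgZ; exact: (intB _ _ _ dF hF).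
    congr (_ + _ + _); apply: eq_big_seq => l /iotaL[_ lL].
    by rewrite meanZ //; exact: (intB _ _ _ dF hF).
  have E2 : mean P (fun om => prodX J om * F 0%N (S om - sumX N om)) =
      mean P (fun om => prodX J om * F 0%N (S om)) +
      \sum_(l <- iota 1 L) c l * LamA l F + mean P (fun om => prodX J om * rem F om).
    have -> : mean P (fun om => prodX J om * F 0%N (S om - sumX N om)) =
      mean P (fun om => prodX J om * F 0%N (S om) +
        \sum_(l <- iota 1 L) c l * (prodX J om * (sumX N om ^+ l * F l (S om)))
        + prodX J om * rem F om).
      apply: eq_mean => om; rewrite expand !mulrDr mulr_sumr; congr (_ + _ + _).
      by apply: eq_bigr => l _; ring.
    rewrite meanD //; last exact: ItgD.
    rewrite meanD // mean_sum; last first.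
      by move=> l /iotaL[_ lL]; apply: ItgZ; exact: (intA _ _ _ dF hF).
    congr (_ + _ + _); apply: eq_big_seq => l /iotaL[_ lL].
    rewrite meanZ; last exact: (intA _ _ _ dF hF).
    by congr (_ * _); apply: eq_mean => om; rewrite mulrA.
  have iD : Itg P (fun om => F 0%N (S om - sumX N om)).
    apply: order_Itg (order_chain dF hF (leq0n L) D_order).
    by rewrite subn0.
  have := indep JT sJ (chain_continuous w_gt0 dF hF (leq0n L)) intJ iD.
  rewrite E1 E2 /main.
  have -> : \sum_(l <- iota 1 L) c l * (mean P (prodX J) * LamB l F - LamA l F) =
     mean P (prodX J) * (\sum_(l <- iota 1 L) c l * LamB l F) -
     \sum_(l <- iota 1 L) c l * LamA l F.
    by rewrite mulr_sumr -sumrB; apply: eq_bigr => l _; ring.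
  by rewrite !mulrDr => ind; lra.
have cst_eq : approx_cst L = (K + L%:R * ((1 + K) * (B%:R ^+ k.+1 * approx_cst L.-1)))
    + (K * K + K).
  by case: (L) => [|L'] /=; rewrite addrC // mul0r.
rewrite cst_eq; apply: (@approx_pert _ main) => [|F H dF hF|].
- by rewrite addr_ge0 // mulr_ge0.
- rewrite (main_eq _ _ dF hF) (le_trans (ler_normB _ _)) // mulrDl.
  have HK : mean P (fun om => H * U A om `^ q) <= H * K.
    by rewrite meanZ // ler_wpM2l ?(holder_ge0 hF) // U_mean.
  rewrite normrM -mulrA lerD //.
    rewrite ler_pM // [leRHS]mulrC; apply: le_trans HK.
    apply: mean_bound => [||om]; [exact: (intrem _ _ dF hF)|exact: ItgZ|exact: rem_q].
  rewrite [leRHS]mulrC; apply: le_trans HK.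
  apply: mean_bound => [||om]; [exact: (intYrem _ _ dF hF)|exact: ItgZ|exact: Yrem_q].
- apply: approxD.
    apply: (@approx_le _ _ (`|mean P (prodX J)| * 1)); first by rewrite mulr1.
    by apply: approxZ; exact: approx_mean.
  have -> : L%:R = (size (iota 1 L))%:R :> R by rewrite size_iota.
  apply: approx_sum => l /iotaL[l0 lL].
  set D := B%:R ^+ k.+1 * _.
  (* The power [l] of the neighbourhood sum comes with the [l]-th derivative, so only smoothness
     [L - l] is left, and it is smaller than [L] because [l] is positive. *)
  have lL1 : (L - l <= L.-1)%N by rewrite -subn1 leq_sub2l.
  have CD : B%:R ^+ l * approx_cst (L - l) <= D.
    rewrite ler_pM ?exprn_ge0 //; last exact: approx_cst_le.
    rewrite ler_weXn2l ?ler1n // (leq_trans lL) //.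
    by rewrite (leq_trans _ sJL) // leq_addl.
  have LL : (L - l < L)%N by rewrite ltn_subrL l0 (leq_trans l0).
  have szJ : (size J + l + (L - l) <= k.+1)%N by rewrite -addnA subnKC.
  have szN : (0 + l + (L - l) <= k.+1)%N by rewrite add0n subnKC // (leq_trans _ sJL) // leq_addl.
  have aA : approx L (LamA l) D.
    apply: approx_le CD _.
    apply: (@approx_ext _ (fun F => mean P (fun om =>
      prodX J om * sumX N om ^+ l * deriv_shift l F 0%N (S om)))) => [F H _ _|].
      by apply: eq_mean => om; rewrite /deriv_shift addn0.
    apply: (@approx_shift _ _ (fun G => mean P (fun om =>
      prodX J om * sumX N om ^+ l * G 0%N (S om)))) => //.
    apply: approx_mulsum => //; [exact: nbT|exact: nbB|].
    by move=> J' J'T sJ'; apply: IH => //; rewrite sJ'.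
  have aB : approx L (LamB l) D.
    apply: approx_le CD _.
    apply: (@approx_ext _ (fun F => mean P (fun om =>
      prodX [::] om * sumX N om ^+ l * deriv_shift l F 0%N (S om)))) => [F H _ _|].
      by apply: eq_mean => om; rewrite /deriv_shift addn0 /prodX big_nil mul1r.
    apply: (@approx_shift _ _ (fun G => mean P (fun om =>
      prodX [::] om * sumX N om ^+ l * G 0%N (S om)))) => //.
    apply: approx_mulsum => //; [exact: nbT|exact: nbB|].
    by move=> J' J'T sJ'; apply: IH => //; rewrite sJ'.
  apply: (@approx_le _ _ (`|c l| * (`|mean P (prodX J)| * D + `|-1| * D))).
    have D0 : 0 <= D by rewrite /D mulr_ge0 ?exprn_ge0.
    have c1 : `|c l| <= 1.
      rewrite /c normrM normrX normrN1 expr1n mul1r normfV ger0_norm //.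
      by rewrite invf_le1 ?ltr0n ?fact_gt0 // ler1n fact_gt0.
    rewrite normrN1 -mulrDl -[leRHS]mul1r ler_pM ?mulr_ge0 ?addr_ge0 //.
    by rewrite addrC ler_wpM2r // lerD2l.
  apply: approxZ; apply: (@approx_ext _
    (fun F => mean P (prodX J) * LamB l F + -1 * LamA l F)).
    by move=> F H _ _; rewrite mulN1r.
  by apply: approxD; exact: approxZ.
Qed.

Lemma sumX_Itg : Itg P (fun om => `|S om| `^ q).
Proof.
case: S_order => mS [c Sc].
have Sc' om : `|S om| <= `|c| * U T om.
  by rewrite (le_trans (Sc om)) // powRr1 ?U_ge0 // ler_wpM2r // ler_norm.
apply: (@Itg_le _ _ _ P _ (fun om => `|c| `^ q * U T om `^ q)).
- by apply: measurableT_comp (measurable_powR q) _; exact: measurableT_comp.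
- move=> om; rewrite ger0_norm ?powR_ge0 // -powRM ?U_ge0 //.
  by rewrite ge0_ler_powR ?nnegrE // mulr_ge0 ?U_ge0.
- by apply: ItgZ; exact: U_int.
Qed.

Let scaled_order s : order 1 (fun om => S om / s).
Proof.
case: S_order => mS [c Sc]; split; first exact: measurable_funM.
exists (c * `|s^-1|) => om; rewrite normrM mulrAC ler_wpM2r //; exact: Sc.
Qed.

Lemma chain_Itg L F H s j : (L <= k)%N -> deriv_chain L F -> holder w H (F L) ->
  (j <= L)%N -> Itg P (fun om => F j (S om / s)).
Proof.
move=> Lk dF hF jL; apply: order_Itg (order_chain dF hF jL (scaled_order s)).
by rewrite /q lerD2r natr1 ler_nat (leq_trans (leq_subr _ _)) // leqW.
Qed.

Lemma chainM_Itg L F H s : (L <= k)%N -> deriv_chain L F -> holder w H (F L) ->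
  Itg P (fun om => S om / s * F 0%N (S om / s)).
Proof.
move=> Lk dF hF.
apply: order_Itg (orderM (scaled_order s) (order_chain dF hF (leq0n L) (scaled_order s))).
by rewrite /q addrA lerD2r subn0 addrC lerD2r ler_nat.
Qed.

Lemma local_stein L (s : R) : (L <= k)%N -> 0 < s ->
  exists a : nat -> R,
    (forall j, `|a j| <= (size T)%:R * approx_cst L * s ^- j.+1) /\
    forall F H, deriv_chain L F -> holder w H (F L) ->
    `|mean P (fun om => S om / s * F 0%N (S om / s)) -
      \sum_(j < L.+1) a j * mean P (fun om => F j (S om / s))| <=
      (size T)%:R * approx_cst L * s ^- L.+1 * s `^ (- w) * H.
Proof.
move=> Lk s0; have s0' := ltW s0.
have sn j : 0 <= s ^- j by rewrite invr_ge0 exprn_ge0.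
have sV0 : 0 <= s^-1 by rewrite invr_ge0.
have : approx L (fun F => \sum_(i <- T) mean P (fun om => prodX [:: i] om * F 0%N (S om)))
   ((size T)%:R * approx_cst L).
  apply: approx_sum => i iT; apply: local_approx => // j.
  by rewrite inE => /eqP ->.
move=> [b [bC h]]; exists (fun j => b j * s ^- j.+1); split.
  move=> j; rewrite normrM (ger0_norm (sn j.+1)).
  by rewrite ler_wpM2r.
move=> F H dF hF.
pose G j x := s ^- j.+1 * F j (x / s).
have dG : deriv_chain L G.
  move=> j x jL; have d1 := isdM (isd_id x) (isd_cst s^-1 x).
  have d2 := @isd_comp _ (F j) (fun y => y * s^-1) x _ _ (dF j (x / s) jL) d1.
  apply: (isd_eq (isdZ (s ^- j.+1) d2)).
  by rewrite mulr0 addr0 mul1r /G (exprS s j.+1) invfM; ring.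
have H0 := holder_ge0 hF.
have hG : holder w (s ^- L.+1 * (s `^ (- w) * H)) (G L).
  move=> x y; rewrite /G -mulrBr normrM (ger0_norm (sn L.+1)) -mulrA ler_wpM2l //.
  apply: (le_trans (hF _ _)).
  rewrite -mulrBl normrM (ger0_norm sV0) powRM // -powR_inv1 // -powRrM mulN1r.
  by rewrite [s `^ _ * H]mulrC -mulrA [s `^ _ * _]mulrC.
have := h G _ dG hG.
have -> : \sum_(i <- T) mean P (fun om => prodX [:: i] om * G 0%N (S om)) =
    mean P (fun om => S om / s * F 0%N (S om / s)).
  rewrite -mean_sum; last first.
    move=> i iT; apply: (@order_Itg (1%N%:R + (L%:R + w))); first exact: size_le_q.
    apply: orderM.
      by apply: (@order_prod [:: i]) => j; rewrite inE => /eqP ->.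
    by have := order_chain dG hG (leq0n L) S_order; rewrite subn0.
  apply: eq_mean => om; rewrite -mulr_suml /G expr1 /S /sumX mulrA.
  congr (_ / _ * _); apply: eq_bigr => i _.
  by rewrite /prodX big_seq1.
have -> : \sum_(j < L.+1) b j * mean P (fun om => G j (S om)) =
    \sum_(j < L.+1) b j / s ^+ j.+1 * mean P (fun om => F j (S om / s)).
  apply: eq_bigr => j _; rewrite /G meanZ ?mulrA //.
  by apply: (chain_Itg s Lk dF hF); rewrite -ltnS.
by rewrite !mulrA.
Qed.

End LocalExpansion.

(** * Integrals over half-lines and their limits *)

Section LebesgueLimits.
Context {R : realType}.
Local Notation mu := (@lebesgue_measure R).
Implicit Types f g : R -> R.

Definition vanishing f :=
  forall e, 0 < e -> exists A, forall x, A <= `|x| -> `|f x| <= e.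

(** Dominated convergence. The limit set [B] is a parameter so that the endpoints -oo ([B] empty)
    and +oo ([B] the line) are treated at once. *)
Lemma cvg_integral_ray f (u : nat -> R) (B : set (measurableTypeR R)) : measurable B ->
  mu.-integrable setT (EFin \o f) ->
  (forall x, \forall n \near \oo, (u n < x)%R = (~` B) x :> Prop) ->
  (\int[mu]_(t in `]-oo, u n]) f t)%R @[n --> \oo] --> (\int[mu]_(t in B) f t)%R.
Proof.
move=> mB intf uB; rewrite Rintegral_mkcond.
under eq_fun do rewrite Rintegral_mkcond.
rewrite /Rintegral; apply: fine_cvg; rewrite fineK; last first.
  apply: integrable_fin_num => //.
  rewrite (_ : (fun x => _) = (EFin \o f) \_ B); last first.
    by apply/funext => x; rewrite /patch /=; case: ifP.
  by rewrite -integrable_mkcond //; exact: (integrableS _ _ (@subsetT _ B) intf).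
have mf : measurable_fun setT f by move/integrableP : intf => -[/measurable_EFinP].
apply: (@dominated_cvg _ _ _ mu setT _ _ _ (fun x => `|f x|%:E)) => //.
- move=> n; apply/measurable_EFinP.
  by apply/(measurable_restrictT f) => //; exact: measurable_funTS.
- move=> x _; apply: cvg_near_cst; near=> n.
  have E : (u n < x)%R = (~` B) x :> Prop by near: n; exact: uB.
  rewrite /patch.
  have -> : (x \in `]-oo, u n]%classic) = (x \in B); last by [].
  apply/idP/idP; rewrite !inE /= in_itv /= leNgt.
    by move/negP => un; apply: contrapT; rewrite -[~ B x]/((~` B) x) -E.
  by move=> Bx; apply/negP; rewrite E.
- exact: (@integrable_norm _ _ _ mu setT f).
- move=> n x _; rewrite lee_fin /patch; case: ifP => // _.
  by rewrite normr0.
Unshelve. all: end_near. Qed.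

Lemma integral_ray_Ny f : mu.-integrable setT (EFin \o f) ->
  (\int[mu]_(t in `]-oo, x]) f t)%R @[x --> -oo] --> (0 : R).
Proof.
move=> intf; apply/cvg_ninftyP => u uy.
rewrite -(Rintegral_set0 mu f).
apply: cvg_integral_ray => // x.
have /cvgrNyPlt/(_ x) := uy; apply: filterS => n unx.
by rewrite setC0 unx; apply/propext; split.
Qed.

Lemma integral_ray_y f : mu.-integrable setT (EFin \o f) ->
  (\int[mu]_(t in `]-oo, x]) f t)%R @[x --> +oo] --> (\int[mu]_t f t)%R.
Proof.
move=> intf; apply/cvg_pinftyP => u uy.
apply: cvg_integral_ray => // x.
have /cvgryPge/(_ x) := uy; apply: filterS => n unx.
by rewrite setCT ltNge unx; apply/propext; split.
Qed.

Lemma vanishingP f : f x @[x --> -oo] --> (0 : R) -> f x @[x --> +oo] --> (0 : R) ->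
  vanishing f.
Proof.
move=> /cvgr0Pnorm_le fN /cvgr0Pnorm_le fy e e0.
have [A [_ hA]] := fN _ e0; have [B [_ hB]] := fy _ e0.
exists (Num.max (1 - A) (1 + B)) => x; rewrite ge_max => /andP[xA xB].
have [x0|x0] := leP 0 x.
  by apply: hB; rewrite ger0_norm // in xB; lra.
by apply: hA; rewrite ltr0_norm // in xA; lra.
Qed.

Lemma continuous_measurable f : continuous f -> measurable_fun (setT : set (measurableTypeR R)) f.
Proof. exact: continuous_measurable_fun. Qed.

Lemma derive0_cst f : (forall x : R, is_derive x (1 : R) f 0) -> forall x y, f x = f y.
Proof. by move=> df x y; exact: is_derive_0_is_cst. Qed.

(** [u] and the primitive of [v] from -oo have the same derivative, and their constant difference is
    0 because both vanish at -oo. The limit at +oo then gives the total integral. *)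
Lemma integral_derive0 u v : (forall x : R, is_derive x (1 : R) u (v x)) -> continuous v ->
  vanishing u -> mu.-integrable setT (EFin \o v) ->
  (\int[mu]_t v t)%R = 0 /\
  forall x, u x = (\int[mu]_(t in `]-oo, x]) v t)%R.
Proof.
move=> du cv vu iv.
pose F x := (\int[mu]_(t in `]-oo, x]) v t)%R.
have dF (x : R) : is_derive x (1 : R) F (v x).
  have xx : x < x + 1 by rewrite ltrDl.
  have ix : mu.-integrable `]-oo, x + 1] (EFin \o v).
    by apply: (integrableS _ _ (@subsetT _ _) iv).
  have [d e] := @continuous_FTC1 R v -oo%O x (x + 1) xx ix (ltNyr x) (cv x).
  exact: isd_of d e.
have dD (x : R) : is_derive x (1 : R) (fun x => F x - u x) 0.
  by apply: (isd_eq (isdB (dF x) (du x))); rewrite subrr.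
have cst := derive0_cst dD.
have FN := integral_ray_Ny iv; have Fy := integral_ray_y iv.
have E x : F x - u x = 0.
  apply/eqP; rewrite -normr_le0; apply/ler_addgt0Pl => e e0; rewrite addr0.
  have e2 : 0 < e / 2 by rewrite divr_gt0.
  have [A hA] := vu _ e2.
  have [B [_ hB]] : \forall y \near -oo, `|F y| <= e / 2.
    by move/cvgr0Pnorm_le : FN => /(_ _ e2).
  pose y := Num.min (- A) (B - 1) - 1.
  have yB : y < B by rewrite /y ltrBlDr gt_min orbC; apply/orP; left; lra.
  have yA : A <= `|y|.
    rewrite ler_normr; apply/orP; right.
    have : Num.min (- A) (B - 1) <= - A by rewrite ge_min lexx.
    by rewrite /y; lra.
  rewrite (cst x y) (le_trans (ler_normB _ _)) // [leRHS]splitr lerD //.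
    exact: hB.
  exact: hA.
split; last by move=> x; apply/esym/eqP; rewrite -subr_eq0 E.
apply/eqP; rewrite -normr_le0; apply/ler_addgt0Pl => e e0; rewrite addr0.
have e2 : 0 < e / 2 by rewrite divr_gt0.
have [A hA] := vu _ e2.
have [B [_ hB]] : \forall y \near +oo, `|(\int[mu]_t v t)%R - F y| <= e / 2.
  by move/cvgrPdist_le : Fy => /(_ _ e2).
pose y := Num.max A (B + 1) + 1.
have yB : B < y.
  have : B + 1 <= Num.max A (B + 1) by rewrite le_max lexx orbT.
  by rewrite /y; lra.
have yA : A <= `|y|.
  have : A <= Num.max A (B + 1) by rewrite le_max lexx.
  by rewrite ler_normr; rewrite /y; lra.
rewrite -[X in `|X|](subrK (F y)) (le_trans (ler_normD _ _)) // [leRHS]splitr lerD //.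
  exact: hB.
by have /eqP := E y; rewrite subr_eq0 => /eqP ->; exact: hA.
Qed.

End LebesgueLimits.

(** * Gaussian integration by parts *)

Section GaussianWeight.
Context {R : realType}.
Local Notation mu := (@lebesgue_measure R).
Local Notation N := (normal_prob (0 : R) 1).
Implicit Types f g : R -> R.

Definition gauss_weight (x : R) : R := expR (- (x ^+ 2 / 2)).
Local Notation gw := gauss_weight.

Lemma gauss_weight_gt0 x : 0 < gw x. Proof. exact: expR_gt0. Qed.

Lemma is_derive_gauss_weight (x : R) : is_derive x (1 : R) gw (- x * gw x).
Proof.
have d1 := isdN (isdM (isd_exp 2 x) (isd_cst (2 : R)^-1 x)).
apply: (isd_eq (@isd_comp _ expR (fun y => - (y ^+ 2 / 2)) x _ _ (is_derive_expR _) d1)).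
by rewrite /gauss_weight /= expr1; field.
Qed.

Lemma continuous_gauss_weight : continuous gw.
Proof. by move=> x; exact: is_derive_cont (is_derive_gauss_weight x). Qed.

Definition poly_growth f := continuous f /\
  exists C n, forall x, `|f x| <= C * (1 + `|x|) ^+ n.

(** Half of the Gaussian exponent absorbs any polynomial; the other half remains as an integrable
    majorant that vanishes at infinity. *)
Let gw4 (x : R) := expR (- (x ^+ 2 / 4)).

Let pow_gw n : exists K, 0 < K /\ forall x, (1 + `|x|) ^+ n * gw x <= K * gw4 x.
Proof.
(* The power [y^n] is at most [exp y] times the factorial of [n], here with [y = 1 + |x|]; and
   [1 + |x| <= x^2 / 4 + 2] because [(|x| - 2)^2 >= 0]. *)
exists (n`!%:R * expR 2); split.
  by rewrite mulr_gt0 ?expR_gt0 // ltr0n fact_gt0.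
move=> x; rewrite /gauss_weight /gw4.
have -> : - (x ^+ 2 / 2) = - (x ^+ 2 / 4) + - (x ^+ 2 / 4) by field.
rewrite expRD mulrA ler_wpM2r ?expR_ge0 //.
have n0 : (0 : R) < n`!%:R by rewrite ltr0n fact_gt0.
have -> : (2 : R) = (x ^+ 2 / 4 + 2) - x ^+ 2 / 4 by ring.
rewrite expRD mulrA ler_wpM2r ?expR_ge0 //.
have y1 : 0 <= 1 + `|x| by rewrite addr_ge0.
apply: (@le_trans _ _ (n`!%:R * expR (1 + `|x|))).
  case: n n0 => [|n] n0.
    by rewrite expr0 fact0 mul1r -[leLHS]expR0 ler_expR.
  rewrite mulrC -ler_pdivrMr //; apply: le_trans (expR_ge1Dxn n y1).
  by rewrite lerDr.
rewrite (ler_wpM2l (ltW n0)) // ler_expR -real_normK ?num_real //.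
have : 0 <= (`|x| - 2) ^+ 2 by exact: sqr_ge0.
rewrite sqrrB; nra.
Qed.

Let gw4_pdf x : gw4 x = normal_fun 0 (Num.sqrt 2) x.
Proof.
rewrite /normal_fun subr0 sqr_sqrtr // /gw4; congr expR.
by rewrite mulNr -mulrnA.
Qed.

Let gw4_int : mu.-integrable setT (EFin \o gw4).
Proof.
have s0 : Num.sqrt 2 != 0 :> R by rewrite gt_eqF // sqrtr_gt0.
have i := integrable_normal_pdf (0 : R) (Num.sqrt 2).
have p0 : normal_peak (Num.sqrt (2 : R)) != 0 by rewrite gt_eqF // normal_peak_gt0.
have := @integrableZl _ _ _ mu setT measurableT (normal_peak (Num.sqrt (2 : R)))^-1 _ i.
apply: eq_integrable => // x _; rewrite /= normal_pdfE // -EFinM; congr EFin.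
by rewrite gw4_pdf mulKf.
Qed.

Let gw4_vanish : vanishing gw4.
Proof.
move=> e e0; exists (4 / e + 1) => x xA.
have x0 : 0 < 4 / e by rewrite divr_gt0.
rewrite ger0_norm ?expR_ge0 // /gw4 expRN.
have x2 : x ^+ 2 / 4 <= expR (x ^+ 2 / 4).
  by apply: le_trans (expR_ge1Dx _); rewrite lerDr.
have h : e^-1 <= x ^+ 2 / 4.
  have : (4 / e) <= x ^+ 2.
    rewrite -real_normK ?num_real // expr2.
    by nra.
  move=> h; have -> : e^-1 = 4 / e / 4 by (field; rewrite gt_eqF).
  by rewrite ler_pM2r ?invr_gt0.
rewrite -[leRHS]invrK lef_pV2 ?posrE ?expR_gt0 ?invr_gt0 //.
exact: le_trans x2.
Qed.

Let pg_bound f : poly_growth f -> exists K, 0 < K /\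
  forall x, `|f x * gw x| <= K * gw4 x.
Proof.
move=> [cf [C [n fC]]]; have [K [K0 hK]] := pow_gw n.
have C0 : 0 <= C.
  by have := fC 0; rewrite normr0 addr0 expr1n mulr1; exact: le_trans.
exists ((C + 1) * K); split; first by rewrite mulr_gt0 // ltr_wpDl.
move=> x; rewrite normrM (ger0_norm (ltW (gauss_weight_gt0 x))).
apply: (@le_trans _ _ (C * (1 + `|x|) ^+ n * gw x)).
  by rewrite ler_wpM2r // ltW // gauss_weight_gt0.
rewrite -mulrA; apply: (le_trans (ler_wpM2l C0 (hK x))).
by rewrite mulrA ler_wpM2r ?expR_ge0 // ler_wpM2r ?lerDl // ltW.
Qed.

Lemma poly_growth_vanishing f : poly_growth f -> vanishing (fun x => f x * gw x).
Proof.
move=> /pg_bound[K [K0 hK]] e e0.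
have [A hA] := gw4_vanish (divr_gt0 e0 K0).
exists A => x /hA; rewrite ger0_norm ?expR_ge0 // => h.
by apply: (le_trans (hK x)); rewrite mulrC -ler_pdivlMr.
Qed.

Lemma continuousM_gw f : continuous f -> continuous (fun x => f x * gw x).
Proof.
move=> cf x; apply: (@cvgM _ _ _ _ f gw); first exact: cf.
exact: continuous_gauss_weight.
Qed.

Lemma poly_growth_integrable f : poly_growth f ->
  mu.-integrable setT (EFin \o (fun x => f x * gw x)).
Proof.
move=> pf; have [K [K0 hK]] := pg_bound pf.
have iK := @integrableZl _ _ _ mu setT measurableT K _ gw4_int.
apply: (@le_integrable _ _ _ mu setT _ _ _ _ _ iK) => //.
  apply/measurable_EFinP; apply: continuous_measurable; apply: continuousM_gw.
  by case: pf.
move=> x _ /=; rewrite lee_fin (le_trans (hK x)) // ler_norm //.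
Qed.

(** The Radon-Nikodym derivative of the normal law has the same integral as the density over every
    measurable set, so the two agree almost everywhere. *)
Lemma normal_ge0_integral (f : measurableTypeR R -> \bar R) :
  measurable_fun setT f -> (forall x, (0 <= f x)%E) ->
  (\int[N]_x f x = \int[mu]_x (f x * (normal_pdf 0 1 x)%:E))%E.
Proof.
move=> mf f0; have dom := normal_prob_dominates (0 : R) 1.
rewrite -(Radon_Nikodym_SigmaFinite.change_of_variables dom f0 measurableT mf).
have iRN := Radon_Nikodym_SigmaFinite.f_integrable dom.
have mpdf : measurable_fun setT (fun x : measurableTypeR R => (normal_pdf 0 1 x)%:E).
  by apply/measurable_EFinP; exact: measurable_normal_pdf.
apply: ae_eq_integral => //.
- by apply: emeasurable_funM => //; exact: measurable_int iRN.
- exact: emeasurable_funM.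
apply: ae_eqe_mul2l; apply: integral_ae_eq => //.
by move=> E _ mE; rewrite -(Radon_Nikodym_SigmaFinite.f_integral dom).
Qed.

Let c0 : R := normal_peak 1.

Let pdf_gw x : normal_pdf 0 1 x = c0 * gw x.
Proof.
rewrite normal_pdfE ?oner_neq0 //; congr (_ * _).
by rewrite /normal_fun subr0 expr1n /gauss_weight mulNr.
Qed.

Lemma normal_peak1_gt0 : 0 < c0. Proof. exact: normal_peak_gt0 (oner_neq0 _). Qed.

Lemma poly_growth_Itg f : poly_growth f -> Itg N f.
Proof.
move=> pf; have iw := poly_growth_integrable pf.
have mf : measurable_fun (setT : set (measurableTypeR R)) f.
  by apply: continuous_measurable; case: pf.
apply/integrableP; split; first exact/measurable_EFinP.
rewrite normal_ge0_integral //; last first.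
  by apply: measurableT_comp => //; exact/measurable_EFinP.
have /integrableP[_] := @integrableZl _ _ _ mu setT measurableT c0 _ iw.
apply: le_lt_trans; rewrite le_eqVlt; apply/orP; left; apply/eqP.
apply: eq_integral => x _; rewrite /= pdf_gw -!EFinM /=; congr EFin.
by rewrite !normrM (ger0_norm (ltW normal_peak1_gt0)) (ger0_norm (ltW (gauss_weight_gt0 x))); ring.
Qed.

Lemma poly_growth_le f C n : continuous f ->
  (forall x, `|f x| <= C * (1 + `|x|) ^+ n) -> poly_growth f.
Proof. by move=> cf h; split=> //; exists C, n. Qed.

Lemma poly_growth_cst (c : R) : poly_growth (fun=> c).
Proof.
apply: (@poly_growth_le _ `|c| 0%N); first by move=> x; exact: cvg_cst.
by move=> x; rewrite expr0 mulr1.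
Qed.

Lemma poly_growth_id : poly_growth (fun x => x).
Proof.
apply: (@poly_growth_le _ 1 1%N); first by move=> x; exact: cvg_id.
by move=> x; rewrite expr1 mul1r lerDr.
Qed.

Lemma poly_growthD f g : poly_growth f -> poly_growth g ->
  poly_growth (fun x => f x + g x).
Proof.
move=> [cf [C [n fC]]] [cg [D [m gD]]].
apply: (@poly_growth_le _ (`|C| + `|D|) (n + m)).
  by move=> x; apply: cvgD; [exact: cf|exact: cg].
move=> x; rewrite (le_trans (ler_normD _ _)) // mulrDl.
have y1 : 1 <= 1 + `|x| by rewrite lerDl.
apply: lerD.
  apply: (le_trans (fC x)); apply: (@le_trans _ _ (`|C| * (1 + `|x|) ^+ n)).
    by rewrite ler_wpM2r ?ler_norm // exprn_ge0 // (le_trans _ y1).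
  by rewrite ler_wpM2l // ler_weXn2l // leq_addr.
apply: (le_trans (gD x)); apply: (@le_trans _ _ (`|D| * (1 + `|x|) ^+ m)).
  by rewrite ler_wpM2r ?ler_norm // exprn_ge0 // (le_trans _ y1).
by rewrite ler_wpM2l // ler_weXn2l // leq_addl.
Qed.

Lemma poly_growthM f g : poly_growth f -> poly_growth g ->
  poly_growth (fun x => f x * g x).
Proof.
move=> [cf [C [n fC]]] [cg [D [m gD]]].
apply: (@poly_growth_le _ (C * D) (n + m)).
  by move=> x; apply: cvgM; [exact: cf|exact: cg].
by move=> x; rewrite normrM exprD mulrACA ler_pM.
Qed.

Lemma poly_growthZ (c : R) f : poly_growth f -> poly_growth (fun x => c * f x).
Proof. by apply: poly_growthM; exact: poly_growth_cst. Qed.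

Lemma poly_growthB f g : poly_growth f -> poly_growth g ->
  poly_growth (fun x => f x - g x).
Proof.
move=> pf /(poly_growthZ (-1)) pg; have := poly_growthD pf pg.
by under eq_fun do rewrite mulN1r.
Qed.

Lemma poly_growth_norm f : poly_growth f -> poly_growth (fun x => `|f x|).
Proof.
move=> [cf [C [n fC]]]; apply: (@poly_growth_le _ C n).
  by move=> x; apply: (@cvg_norm _ _ _ _ _ f); exact: cf.
by move=> x; rewrite normr_id.
Qed.

Let ge0_gauss_meanE f : poly_growth f -> (forall x, 0 <= f x) ->
  mean N f = c0 * (\int[mu]_x (f x * gw x))%R.
Proof.
move=> pf f0; rewrite /mean /Rintegral normal_ge0_integral; last 2 first.
- by apply/measurable_EFinP; apply: continuous_measurable; case: pf.
- by move=> x; rewrite lee_fin.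
rewrite -/(Rintegral mu setT _) -RintegralZl //; last exact: poly_growth_integrable.
congr fine; apply: eq_integral => x _; rewrite pdf_gw -EFinM; congr EFin; ring.
Qed.

(** [f] is the difference of [|f|] and [|f| - f], which are nonnegative and still continuous of
    polynomial growth. *)
Lemma gauss_meanE f : poly_growth f ->
  mean N f = c0 * (\int[mu]_x (f x * gw x))%R.
Proof.
move=> pf; have pn := poly_growth_norm pf; have pd := poly_growthB pn pf.
have -> : mean N f = mean N (fun x => `|f x|) - mean N (fun x => `|f x| - f x).
  rewrite -meanB; [|exact: poly_growth_Itg..].
  by apply: eq_mean => x; rewrite opprB addrCA subrr addr0.
rewrite !ge0_gauss_meanE //; last by move=> x; rewrite subr_ge0 ler_norm.
rewrite -mulrBr -RintegralB //; [|exact: poly_growth_integrable..].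
by congr (_ * _); apply: eq_Rintegral => x _; rewrite -mulrBl opprB addrCA subrr addr0.
Qed.

(** [(v - x u) gw] is the derivative of [u gw], which vanishes at infinity. *)
Lemma gauss_ibp (u v : R -> R) : (forall x : R, is_derive x (1 : R) u (v x)) ->
  poly_growth u -> poly_growth v -> mean N v = mean N (fun x => x * u x).
Proof.
move=> du pu pv; have pxu := poly_growthM poly_growth_id pu.
have pd := poly_growthB pv pxu.
apply/eqP; rewrite -subr_eq0 -meanB; [|exact: poly_growth_Itg..].
rewrite gauss_meanE //; have dug (x : R) : is_derive x (1 : R) (fun x => u x * gw x)
    ((v x - x * u x) * gw x).
  by apply: (isd_eq (isdM (du x) (is_derive_gauss_weight x))); ring.
have [|||->] := integral_derive0 dug.
- by apply: continuousM_gw; case: pd.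
- exact: poly_growth_vanishing.
- exact: poly_growth_integrable.
- by rewrite mulr0.
Qed.

(** Times the weight, [Theta h] is the primitive from -oo of [(h - N h) gw]; it also vanishes at +oo
    because the centring makes the total integral 0. This boundary condition excludes the other
    solutions, which differ from it by multiples of [exp (x^2 / 2)]. *)
Lemma Theta_ode h : poly_growth h ->
  (forall x : R, is_derive x (1 : R) (Theta h)
     (x * Theta h x + (h x - gauss_mean h))) /\
  vanishing (fun x => Theta h x * gw x).
Proof.
move=> ph; set m := gauss_mean h.
have pg : poly_growth (fun x => h x - m).
  by apply: poly_growthB => //; exact: poly_growth_cst.
have ig := poly_growth_integrable pg.
pose F (x : R) := (\int[mu]_(t in `]-oo, x]) ((h t - m) * gw t))%R.
have ThF x : Theta h x = expR (x ^+ 2 / 2) * F x by [].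
have Thg x : Theta h x * gw x = F x.
  by rewrite ThF mulrAC -expRD subrr expR0 mul1r.
have cg : continuous (fun x => (h x - m) * gw x).
  by apply: continuousM_gw; case: pg.
have dF (x : R) : is_derive x (1 : R) F ((h x - m) * gw x).
  have xx : x < x + 1 by rewrite ltrDl.
  have ix : mu.-integrable `]-oo, x + 1] (EFin \o (fun x => (h x - m) * gw x)).
    by apply: (integrableS _ _ (@subsetT _ _) ig).
  have [d e] := @continuous_FTC1 R _ -oo%O x (x + 1) xx ix (ltNyr x) (cg x).
  exact: isd_of d e.
split=> [x|].
  have d1 := isdM (isd_exp 2 x) (isd_cst (2 : R)^-1 x).
  have d2 := @isd_comp _ expR (fun y => y ^+ 2 / 2) x _ _ (is_derive_expR _) d1.
  apply: (isd_eq (isdM d2 (dF x))).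
  rewrite -/m ThF /= expr1 mulr0 addr0 mulrC [in X in _ + X]mulrC.
  have gE : gw x * expR (x ^+ 2 / 2) = 1.
    by rewrite /gauss_weight -expRD addrC subrr expR0.
  rewrite -[_ * gw x * _]mulrA gE mulr1; congr (_ + _).
  by field.
have -> : (fun x => Theta h x * gw x) = F by apply/funext => x; exact: Thg.
have int0 : (\int[mu]_t ((h t - m) * gw t))%R = 0.
  have := gauss_meanE pg; rewrite meanB; [|exact: poly_growth_Itg|exact: Itg_cst].
  rewrite mean_cst /m /gauss_mean -/(mean N h) subrr => /esym/eqP.
  by rewrite mulf_eq0 (gt_eqF normal_peak1_gt0) => /eqP.
have FN := integral_ray_Ny ig; have := integral_ray_y ig; rewrite int0 => Fy.
exact: vanishingP.
Qed.

End GaussianWeight.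

(** * Inequalities for real powers *)

Section PowR.
Context {R : realType}.
Implicit Types x y a b r : R.

Lemma powR_ge1 x r : 1 <= x -> 0 <= r -> 1 <= x `^ r.
Proof. by move=> x1 r0; rewrite -[X in X <= _](powRr0 x) ler_powR. Qed.

Lemma powR_le1 x r : 0 <= x -> x <= 1 -> 0 <= r -> x `^ r <= 1.
Proof.
move=> x0 x1 r0; have : x `^ r <= 1 `^ r by apply: ge0_ler_powR; rewrite ?nnegrE.
by rewrite powR1.
Qed.

Lemma powR_le_id1 x r : 0 <= x -> r <= 1 -> 0 <= r -> x `^ r <= 1 + x.
Proof.
move=> x0 r1 r0; have [x1|/ltW x1] := leP 1 x.
  by rewrite (le_trans (ler1_powR x1 r1)) // lerDr.
by rewrite (le_trans (powR_le1 x0 x1 r0)) // lerDl.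
Qed.

Lemma powR_anti x y r : 0 < x -> x <= y -> r <= 0 -> y `^ r <= x `^ r.
Proof.
move=> x0 xy r0; have y0 : 0 < y by exact: lt_le_trans xy.
rewrite -[r]opprK (powRN x) (powRN y) lef_pV2 ?posrE ?powR_gt0 //.
by apply: ge0_ler_powR; rewrite ?nnegrE ?oppr_ge0 //; exact: ltW.
Qed.

Lemma powR_pred x r : 0 < x -> x `^ r = x * x `^ (r - 1).
Proof.
move=> x0; rewrite -[in X in _ = X * _](powRr1 (ltW x0)) -powRD.
  by rewrite addrC subrK.
by rewrite (gt_eqF x0) implybT.
Qed.

End PowR.

(** * Regularity of the solution of Stein's equation *)

Section SteinEquation.
Context {R : realType}.
Local Notation N := (normal_prob (0 : R) 1).
Local Notation gw := gauss_weight.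
Local Notation isd f x d := (is_derive (x : R) (1 : R) (f : R -> R) (d : R)).
Implicit Types (u v g B : R -> R) (x y w H G C : R).

Definition decay u := forall e, 0 < e -> exists A, forall x, A <= x -> `|u x| <= e.

Lemma vanishing_decay u : vanishing u -> decay u.
Proof.
move=> vu e /vu[A hA]; exists A => x Ax; apply: hA.
by rewrite (le_trans Ax) // ler_norm.
Qed.

Lemma nonincr (D D' : R -> R) x0 : (forall x, x0 <= x -> isd D x (D' x)) ->
  (forall x, x0 <= x -> D' x <= 0) -> forall x y, x0 <= x -> x <= y -> D y <= D x.
Proof.
move=> dD D0 x y x0x xy.
have dI z : z \in `]x, y[ -> isd D z (D' z).
  by rewrite in_itv /= => /andP[xz _]; apply: dD; rewrite (le_trans x0x) // ltW.
have cD : {within `[x, y], continuous D}.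
  apply: continuous_in_subspaceT => z; rewrite inE /= in_itv /= => /andP[xz _].
  by apply: (is_derive_cont (dD z _)); rewrite (le_trans x0x).
have [c + E] := MVT_segment xy dI cD.
rewrite in_itv /= => /andP[xc _].
by rewrite -subr_le0 E mulr_le0_ge0 ?subr_ge0 // D0 // (le_trans x0x).
Qed.

(* Barrier argument: [(B -+ u) gw] is nonincreasing on [x0, +oo[ and tends to 0. *)
Lemma stein_compare x0 u g B (B' : R -> R) :
  (forall x, x0 <= x -> isd u x (x * u x + g x)) ->
  (forall x, x0 <= x -> isd B x (B' x)) ->
  decay (fun x => u x * gw x) -> decay (fun x => B x * gw x) ->
  (forall x, x0 <= x -> `|g x| <= x * B x - B' x) ->
  forall x, x0 <= x -> `|u x| <= B x.
Proof.
move=> du dB decu decB gB x x0x.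
have key (s : R) : `|s| = 1 -> s * u x <= B x.
  move=> s1; rewrite leNgt; apply/negP => Bu.
  pose D y := (B y - s * u y) * gw y.
  have dD y : x0 <= y -> isd D y ((B' y - y * B y - s * g y) * gw y).
    move=> y0; apply: (isd_eq (isdM (isdB (dB y y0) (isdZ s (du y y0)))
      (is_derive_gauss_weight y))); ring.
  have D0 y : x0 <= y -> (B' y - y * B y - s * g y) * gw y <= 0.
    move=> y0; rewrite pmulr_lle0 ?gauss_weight_gt0 //.
    have : - (s * g y) <= `|g y|.
      by rewrite (le_trans (ler_norm _)) // normrN normrM s1 mul1r.
    have := gB y y0; lra.
  have DN : D x < 0 by rewrite /D pmulr_llt0 ?gauss_weight_gt0 // subr_lt0.
  have e0 : 0 < - D x / 4 by rewrite divr_gt0 // oppr_gt0.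
  have [A1 h1] := decu _ e0; have [A2 h2] := decB _ e0.
  pose y := Num.max x (Num.max A1 A2).
  have xy : x <= y by rewrite /y le_max lexx.
  have y1 : A1 <= y by rewrite /y !le_max lexx orbT.
  have y2 : A2 <= y by rewrite /y !le_max lexx !orbT.
  have Dxy := nonincr dD D0 x0x xy.
  have Dy : D y = B y * gw y - s * u y * gw y by rewrite /D mulrBl.
  have : `|s * u y * gw y| <= - D x / 4 by rewrite -mulrA normrM s1 mul1r h1.
  have := h2 _ y2; rewrite !ler_norml => /andP[+ _] /andP[_ +].
  move: (B y * gw y) (s * u y * gw y) (D x) (D y) DN Dy Dxy => p q r t; lra.
have := key 1 (normr1 _); have := key (-1); rewrite normrN1 => /(_ erefl).
by rewrite mul1r mulN1r ler_norml lerNl => -> ->.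
Qed.

Definition stein u g := (forall x, isd u x (x * u x + g x)) /\
  vanishing (fun x => u x * gw x).

(** This symmetry reduces the estimates of solutions to [x >= 0]. *)
Lemma stein_reflect u g : stein u g -> stein (fun x => - u (- x)) (fun x => g (- x)).
Proof.
move=> [du vu]; split=> [x|e /vu[A hA]].
  have d1 := isdN (isd_id x).
  have d2 := @isd_comp _ u (fun y => - y) x _ _ (du (- x)) d1.
  by apply: (isd_eq (isdN d2)); ring.
exists A => x Ax; have := hA (- x); rewrite normrN => /(_ Ax).
by rewrite /gauss_weight sqrrN mulNr normrN.
Qed.

Lemma weight_nat_decay n : vanishing (fun x => (1 + `|x|) ^+ n * gw x).
Proof.
apply: poly_growth_vanishing; apply: (@poly_growth_le _ _ 1 n).
  move=> x; apply: (@continuous_comp _ _ _ (fun x => 1 + `|x|) (fun y => y ^+ n)).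
    apply: cvgD; first exact: cvg_cst.
    exact: norm_continuous.
  exact: exprn_continuous.
by move=> x; rewrite mul1r ger0_norm // exprn_ge0 // addr_ge0.
Qed.

Lemma powR_le_nat a : exists n : nat, forall y, 1 <= y -> y `^ a <= y ^+ n.
Proof.
exists (Num.bound `|a|) => y y1; rewrite -powR_mulrn ?(le_trans _ y1) //.
by apply: ler_powR => //; exact: le_trans (ler_norm _) (ltW (archi_boundP (normr_ge0 a))).
Qed.

(** The bound is itself a barrier: from [a + 1] on, the term [x B] exceeds [B'] by enough to
    dominate the data. *)
Let stein_growth_far a G u g : 0 <= a -> 0 <= G -> stein u g ->
  (forall x, `|g x| <= G * (1 + `|x|) `^ a) ->
  forall x, a + 1 <= x -> `|u x| <= 4 * G * (1 + x) `^ (a - 1).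
Proof.
move=> a0 G0 [du vu] gG x0 ax0.
have pos x : a + 1 <= x -> 0 < 1 + x by move=> ax; lra.
pose B' x := 4 * G * ((a - 1) * (1 + x) `^ (a - 1 - 1)).
apply: (@stein_compare (a + 1) u g (fun x => 4 * G * (1 + x) `^ (a - 1)) B').
- move=> x ax.
  apply: (isd_eq (isdZ (4 * G) (isd_comp (is_derive1_powR (a - 1) (pos x ax))
    (isdD (isd_cst 1 x) (isd_id x))))).
  by rewrite add0r mulr1.
- exact: vanishing_decay.
- move=> e e0; have [n an] := powR_le_nat (a - 1).
  have e1 : 0 < e / (4 * G + 1) by rewrite divr_gt0 // ltr_wpDl // mulr_ge0.
  have [A hA] := weight_nat_decay n e1.
  exists (Num.max A 0) => x; rewrite ge_max => /andP[Ax x0'].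
  have xn : `|x| = x by rewrite ger0_norm.
  have := hA x; rewrite xn => /(_ Ax).
  have x1 : 1 <= 1 + x by rewrite lerDl.
  have gw0 := gauss_weight_gt0 x.
  rewrite ger0_norm; last by rewrite mulr_ge0 ?exprn_ge0 ?(ltW gw0) // (le_trans _ x1).
  rewrite ler_pdivlMr ?ltr_wpDl ?mulr_ge0 // => h.
  rewrite ger0_norm; last by rewrite !mulr_ge0 ?powR_ge0 ?(ltW gw0).
  apply: le_trans h; rewrite -mulrA mulrC.
  apply: ler_pM; rewrite ?mulr_ge0 ?powR_ge0 ?(ltW gw0) ?lerDl //.
  by rewrite ler_wpM2r ?(ltW gw0) // an.
- move=> x ax; apply: (le_trans (gG x)).
  have x0' : 0 <= x by lra.
  rewrite ger0_norm // /B'.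
  have x1 := pos x ax.
  rewrite (powR_pred a x1) (powR_pred (a - 1) x1).
  set p := (1 + x) `^ _; have p0 : 0 <= p by exact: powR_ge0.
  have -> : x * (4 * G * ((1 + x) * p)) - 4 * G * ((a - 1) * p) =
    G * ((4 * (x * (1 + x) - (a - 1))) * p) by ring.
  by rewrite ler_wpM2l // mulrA ler_wpM2r //; nra.
- exact: ax0.
Qed.

(** The solution gains a factor [1 / (1 + |x|)] over the data. Beyond [x0 = a + 1] this is the
    barrier bound; on [[0, x0]] the bound at [x0] is carried back by the mean value inequality for
    [u gw], whose derivative is [g gw]. *)
Lemma stein_growth a : 0 <= a -> exists C, 0 < C /\ forall u g G, 0 <= G ->
  stein u g -> (forall x, `|g x| <= G * (1 + `|x|) `^ a) ->
  forall x, `|u x| <= C * G * (1 + `|x|) `^ (a - 1).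
Proof.
move=> a0; pose x0 := a + 1.
pose K := 4 * (1 + x0) `^ (a - 1) + x0 * (1 + x0) `^ a.
have x00 : 0 <= x0 by rewrite /x0; lra.
have K0 : 0 <= K by rewrite /K addr_ge0 ?mulr_ge0 ?powR_ge0.
pose C := 4 + K * (1 + x0) / gw x0.
have gw0 := gauss_weight_gt0 x0.
have C0 : 0 <= K * (1 + x0) / gw x0.
  by rewrite mulr_ge0 ?invr_ge0 ?(ltW gw0) // mulr_ge0 //; lra.
exists C; split; first by rewrite /C; lra.
move=> u g G G0.
suff half u' g' : stein u' g' -> (forall x, `|g' x| <= G * (1 + `|x|) `^ a) ->
    forall x, 0 <= x -> `|u' x| <= C * G * (1 + `|x|) `^ (a - 1).
  move=> su gG x; have [xx|/ltW xx] := leP 0 x; first exact: half su gG _ xx.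
  have gG' y : `|g (- y)| <= G * (1 + `|y|) `^ a.
    by rewrite -[X in 1 + X]normrN; exact: gG.
  have xx' : 0 <= - x by rewrite oppr_ge0.
  by have := half _ _ (stein_reflect su) gG' _ xx'; rewrite opprK !normrN.
move=> su gG x xx.
have [x0x|/ltW xx0] := leP x0 x.
  apply: (le_trans (stein_growth_far a0 G0 su gG x0x)).
  by rewrite (ger0_norm xx) ler_wpM2r ?powR_ge0 // ler_wpM2r // /C; lra.
have far := stein_growth_far a0 G0 su gG (lexx x0).
have du y : isd (fun x => u' x * gw x) y (g' y * gw y).
  by case: su => du _; apply: (isd_eq (isdM (du y) (is_derive_gauss_weight y))); ring.
have gw_le1 y : gw y <= 1.
  by rewrite /gauss_weight -[leRHS]expR0 ler_expR oppr_le0 divr_ge0 // sqr_ge0.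
have mv : `|u' x * gw x - u' x0 * gw x0| <= G * (1 + x0) `^ a * `|x - x0|.
  apply: (mvt_bound du) => y; rewrite (min_r xx0) (max_l xx0) => /andP[xy yx0].
  have y0 : 0 <= y by exact: le_trans xy.
  rewrite normrM -[leRHS]mulr1 ler_pM // ?(le_trans (gG y)) //.
    rewrite ler_wpM2l // ger0_norm //; apply: ge0_ler_powR; rewrite ?nnegrE ?addr_ge0 //.
    by rewrite lerD2l.
  by rewrite ger0_norm // ltW // gauss_weight_gt0.
have x0x' : `|x - x0| <= x0 by rewrite distrC ger0_norm ?subr_ge0 // lerBlDr lerDl.
have uK : `|u' x| * gw x0 <= G * K.
  have gwx := gauss_weight_gt0 x.
  apply: (@le_trans _ _ `|u' x * gw x|).
    rewrite normrM (ger0_norm (ltW gwx)) ler_wpM2l // /gauss_weight ler_expR lerN2.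
    by rewrite ler_pM2r // ler_sqr ?nnegrE.
  rewrite -[X in `|X|](subrK (u' x0 * gw x0)) (le_trans (ler_normD _ _)) //.
  rewrite /K mulrDr addrC lerD //.
    rewrite normrM -[leRHS]mulr1 ler_pM //; first by rewrite mulrA [G * 4]mulrC.
    by rewrite (ger0_norm (ltW gw0)).
  apply: (le_trans mv); rewrite -mulrA ler_wpM2l // mulrC ler_wpM2r // powR_ge0 //.
have h1 : `|u' x| <= G * K / gw x0 by rewrite ler_pdivlMr.
apply: (le_trans h1); rewrite (ger0_norm xx) [C * G]mulrC -!mulrA ler_wpM2l //.
have xp : 0 < 1 + x by lra.
have low : (1 + x0)^-1 <= (1 + x) `^ (a - 1).
  apply: (@le_trans _ _ ((1 + x) `^ (-1))).
    by rewrite powR_inv1 ?(ltW xp) // lef_pV2 ?posrE //; lra.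
  by apply: ler_powR; lra.
have -> : K / gw x0 = (K * (1 + x0) / gw x0) * (1 + x0)^-1.
  have x0p : 0 < 1 + x0 by lra.
  by rewrite -!mulrA [(1 + x0) * _]mulrCA mulfV ?mulr1 // gt_eqF.
apply: ler_pM => //; first by rewrite invr_ge0; lra.
by rewrite /C lerDr.
Qed.

(** For data frozen at [g x], the function [- g x / y] nearly solves the equation. The corrected
    function [u y + g x / y] has data [g y - g x - g x / y^2], small by the Hölder condition, and is
    compared with an affine barrier; at [y = x], times [x], it is the quantity to be bounded. *)
Let frozen_bound w H u g x : 0 < w -> w <= 1 -> 0 <= H -> stein u g -> holder w H g ->
  1 <= x -> `|g x| <= H * (1 + `|x|) `^ w -> `|x * u x + g x| <= 8 * H * (1 + x) `^ (- w).
Proof.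
move=> w0 w1 H0 [du vu] hg x1 gx.
have x0 : 0 < x by lra.
have xn : x != 0 by rewrite gt_eqF.
pose r := x `^ (- w); have r0 : 0 <= r by exact: powR_ge0.
(* [(y - x)^w = r (x (y - x))^w <= r (1 + x (y - x))], which is affine in [y]. One copy of [H r] in
   [al] pays for the constant term, the other for the slope [be] of the barrier. *)
pose be := H * r; pose al := (2 * (H * r) + `|g x| / x ^+ 2) / x.
have be0 : 0 <= be by rewrite mulr_ge0.
have gx2 : 0 <= `|g x| / x ^+ 2 by rewrite divr_ge0 // sqr_ge0.
have al0 : 0 <= al by rewrite divr_ge0 ?(ltW x0) // addr_ge0 // mulr_ge0.
have yn y : x <= y -> y != 0 by move=> xy; rewrite gt_eqF //; lra.
have dz y : x <= y -> isd (fun y => u y + g x * y^-1) y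
    (y * (u y + g x * y^-1) + (g y - g x - g x / y ^+ 2)).
  move=> xy; have yy := yn y xy.
  have dV : is_derive y (1 : R) (fun y : R => y^-1) (- y ^- 2).
    by apply: (isd_eq (is_deriveV yy (isd_id y))); rewrite /GRing.scale /= mulr1.
  by apply: (isd_eq (isdD (du y) (isdZ (g x) dV))); field.
have dB y : x <= y -> isd (fun y => al + be * (y - x)) y be.
  move=> _; apply: (isd_eq (isdD (isd_cst al y) (isdZ be (isdB (isd_id y) (isd_cst x y))))).
  by rewrite subr0 mulr1 add0r.
have dec1 : decay (fun y => (u y + g x * y^-1) * gw y).
  move=> e e0; have e2 : 0 < e / 2 by rewrite divr_gt0.
  have [A hA] := vanishing_decay vu e2.
  have e3 : 0 < e / 2 / (`|g x| + 1) by rewrite divr_gt0 // ltr_wpDl.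
  have [A' hA'] := vanishing_decay (weight_nat_decay 0) e3.
  exists (Num.max 1 (Num.max A A')) => y; rewrite !ge_max => /andP[y1 /andP[yA yA']].
  rewrite mulrDl (le_trans (ler_normD _ _)) // [leRHS]splitr lerD ?hA //.
  have := hA' y yA'; rewrite expr0 mul1r ler_pdivlMr ?ltr_wpDl // => h.
  apply: le_trans h; rewrite !normrM.
  have gwn : 0 <= `|gw y| by exact: normr_ge0.
  have y0 : 0 < y by lra.
  have yV : `|y^-1| <= 1 by rewrite normfV (gtr0_norm y0) invf_le1.
  rewrite [leRHS]mulrC ler_wpM2r //.
  by rewrite (@le_trans _ _ (`|g x| * 1)) ?ler_wpM2l // mulr1 lerDl.
have dec2 : decay (fun y => (al + be * (y - x)) * gw y).
  apply: vanishing_decay; apply: poly_growth_vanishing.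
  apply: poly_growthD; first exact: poly_growth_cst.
  by apply: poly_growthZ; apply: poly_growthB; [exact: poly_growth_id|exact: poly_growth_cst].
have main y : x <= y -> `|g y - g x - g x / y ^+ 2| <= y * (al + be * (y - x)) - be.
  move=> xy; have t0 : 0 <= x * (y - x) by rewrite mulr_ge0 ?subr_ge0 // ltW.
  have h1 : `|g y - g x| <= H * r * (1 + x * (y - x)).
    apply: (le_trans (hg y x)); rewrite -mulrA ler_wpM2l //.
    rewrite ger0_norm ?subr_ge0 //.
    have -> : (y - x) `^ w = r * (x * (y - x)) `^ w.
      rewrite powRM ?subr_ge0 ?(ltW x0) // mulrA /r powRN mulVf ?mul1r //.
      by rewrite gt_eqF // powR_gt0.
    by rewrite ler_wpM2l // powR_le_id1 // ltW.
  have h2 : `|g x / y ^+ 2| <= `|g x| / x ^+ 2.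
    rewrite normrM ler_wpM2l // normfV lef_pV2 ?posrE ?normr_gt0 ?exprn_gt0 ?expf_neq0 ?yn //.
    by rewrite ger0_norm ?sqr_ge0 // ler_sqr ?nnegrE //; lra.
  apply: (le_trans (ler_normB _ _)); apply: (le_trans (lerD h1 h2)).
  have : x * al + x * (be * (y - x)) <= y * (al + be * (y - x)).
    by rewrite -mulrDr ler_wpM2r // addr_ge0 // mulr_ge0 // subr_ge0.
  have xal : x * al = 2 * (H * r) + `|g x| / x ^+ 2 by rewrite /al mulrC divfK.
  rewrite xal => h; rewrite lerBrDr; apply: le_trans h.
  by rewrite le_eqVlt; apply/orP; left; apply/eqP; rewrite /be; ring.
have zx := stein_compare dz dB dec1 dec2 main (lexx x).
rewrite subrr mulr0 addr0 in zx.
have -> : x * u x + g x = x * (u x + g x * x^-1).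
  by rewrite mulrDr mulrCA mulfV // mulr1.
rewrite normrM (gtr0_norm x0).
have xal : x * `|u x + g x * x^-1| <= 2 * (H * r) + `|g x| / x ^+ 2.
  have alx : x * al = 2 * (H * r) + `|g x| / x ^+ 2 by rewrite /al mulrC divfK.
  by rewrite -alx ler_wpM2l // ltW.
apply: (le_trans xal).
have rE : (1 + x) `^ w <= 2 * x `^ w.
  have : (1 + x) `^ w <= (2 * x) `^ w.
    by apply: ge0_ler_powR; rewrite ?nnegrE; lra.
  move=> h; apply: (le_trans h); rewrite powRM // ?(ltW x0) // ler_wpM2r ?powR_ge0 //.
  by rewrite ler1_powR //; lra.
have x2 : `|g x| / x ^+ 2 <= 2 * (H * r).
  rewrite ler_pdivrMr ?exprn_gt0 //; apply: (le_trans gx); rewrite (gtr0_norm x0).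
  have -> : 2 * (H * r) * x ^+ 2 = H * (2 * (r * x ^+ 2)) by ring.
  rewrite ler_wpM2l // (le_trans rE) // ler_wpM2l //.
  rewrite /r -powR_mulrn ?(ltW x0) // -powRD ?xn ?implybT //.
  by apply: ler_powR => //; lra.
have r2 : r <= 2 * (1 + x) `^ (- w).
  have xw : 0 < x `^ w by exact: powR_gt0.
  have x1w : 0 < (1 + x) `^ w by apply: powR_gt0; lra.
  by rewrite /r !powRN ler_pdivlMr // -ler_pdivlMl ?invr_gt0 // invrK mulrC.
have -> : 8 * H * (1 + x) `^ (- w) = 4 * (H * (2 * (1 + x) `^ (- w))) by ring.
have : H * r <= H * (2 * (1 + x) `^ (- w)) by rewrite ler_wpM2l.
by move: x2; lra.
Qed.

(** The growth bound with exponent [w - 1 <= 0] makes [u] bounded. The derivative is handled by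
    [frozen_bound] for [|x| >= 1]; on [[-1, 1]] the weight is at least 1/2 and crude bounds do. *)
Let deriv_bound w : 0 < w -> w <= 1 -> exists C, 0 < C /\ forall u g H, 0 <= H ->
  stein u g -> holder w H g -> (forall x, `|g x| <= H * (1 + `|x|) `^ w) ->
  (forall x, `|u x| <= C * H) /\
  forall x, `|x * u x + g x| <= C * H * (1 + `|x|) `^ (- w).
Proof.
move=> w0 w1; have [C1 [C10 hC1]] := stein_growth (ltW w0).
pose C := 2 * C1 + 8; exists C; split; first by rewrite /C; lra.
move=> u g H H0 su hg gH.
have uC x : `|u x| <= C1 * H.
  apply: (le_trans (hC1 u g H H0 su gH x)); rewrite -[leRHS]mulr1 ler_wpM2l ?mulr_ge0 ?(ltW C10) //.
  have y1 : 1 <= 1 + `|x| by rewrite lerDl.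
  have := @powR_anti R 1 (1 + `|x|) (w - 1) ltr01 y1; rewrite powR1; apply; lra.
split=> [x|].
  by apply: (le_trans (uC x)); rewrite ler_wpM2r // /C; lra.
suff half u' g' : stein u' g' -> holder w H g' ->
   (forall x, `|g' x| <= H * (1 + `|x|) `^ w) -> (forall x, `|u' x| <= C1 * H) ->
   forall x, 0 <= x -> `|x * u' x + g' x| <= C * H * (1 + `|x|) `^ (- w).
  move=> x; have [xx|/ltW xx] := leP 0 x; first exact: half.
  have hg' : holder w H (fun x => g (- x)).
    by move=> y z; have := hg (- y) (- z); rewrite -opprD normrN.
  have gH' y : `|g (- y)| <= H * (1 + `|y|) `^ w.
    by rewrite -[X in 1 + X]normrN; exact: gH.
  have uC' y : `| - u (- y)| <= C1 * H by rewrite normrN.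
  have xx' : 0 <= - x by rewrite oppr_ge0.
  by have := half _ _ (stein_reflect su) hg' gH' uC' _ xx'; rewrite !opprK mulrNN normrN.
move=> su' hg' gH' uC' x x0; rewrite (ger0_norm x0).
have [x1|/ltW x1] := leP 1 x.
  apply: (le_trans (frozen_bound w0 w1 H0 su' hg' x1 (gH' x))).
  by rewrite ler_wpM2r ?powR_ge0 // ler_wpM2r // /C; lra.
have low : 2^-1 <= (1 + x) `^ (- w).
  apply: (@le_trans _ _ ((1 + x) `^ (-1))).
    by rewrite powR_inv1 ?lef_pV2 ?posrE; lra.
  by apply: ler_powR; lra.
have gx : `|g' x| <= H * 2.
  apply: (le_trans (gH' x)); rewrite ler_wpM2l // (ger0_norm x0).
  have y1 : 1 <= 1 + x by lra.
  by apply: (le_trans (ler1_powR y1 w1)); lra.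
have h1 : `|x * u' x + g' x| <= C1 * H + H * 2.
  rewrite (le_trans (ler_normD _ _)) // lerD // normrM (ger0_norm x0).
  by rewrite -[leRHS]mul1r ler_pM.
apply: (le_trans h1); have -> : C1 * H + H * 2 = (2 * C1 + 4) * H * 2^-1 by field.
apply: ler_pM => //; first by rewrite mulr_ge0 //; lra.
by rewrite ler_wpM2r // /C; lra.
Qed.

(** Three regimes of [de = |x - y|]. For [de >= 1] boundedness of [u'] is enough; for [|x| de >= 1]
    the decay of [u'] makes both values at most of order [de^w]; otherwise the difference of
    [x u + g] is split by the product rule. *)
Lemma stein_holder w : 0 < w -> w <= 1 -> exists C, 0 < C /\ forall u g H, 0 <= H ->
  stein u g -> holder w H g -> (forall x, `|g x| <= H * (1 + `|x|) `^ w) ->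
  holder w (C * H) (fun x => x * u x + g x).
Proof.
move=> w0 w1; have [C1 [C10 hC1]] := deriv_bound w0 w1.
exists (2 * C1 + 1); split; first by lra.
move=> u g H H0 su hg gH; have [uC duC] := hC1 u g H H0 su hg gH.
have CH : 0 <= C1 * H by rewrite mulr_ge0 // ltW.
have duC' x : `|x * u x + g x| <= C1 * H.
  apply: (le_trans (duC x)); rewrite -[leRHS]mulr1 ler_wpM2l //.
  have y1 : 1 <= 1 + `|x| by rewrite lerDl.
  by have := @powR_anti R 1 (1 + `|x|) (- w) ltr01 y1; rewrite powR1; apply; lra.
move=> x y; set de := `|x - y|.
have de0 : 0 <= de by exact: normr_ge0.
have tri : `|x * u x + g x - (y * u y + g y)| <= `|x * u x + g x| + `|y * u y + g y|.
  exact: ler_normB.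
have [de1|/ltW de1] := leP 1 de.
  apply: (le_trans tri); apply: (le_trans (lerD (duC' x) (duC' y))).
  have p1 := powR_ge1 de1 (ltW w0).
  apply: (@le_trans _ _ ((2 * C1 + 1) * H * 1)); first by rewrite mulr1; lra.
  by rewrite ler_wpM2l // mulr_ge0 //; lra.
have [de00|den] := eqVneq de 0.
  have -> : x = y by apply/eqP; rewrite -subr_eq0 -normr_eq0 -/de de00.
  by rewrite subrr normr0 mulr_ge0 ?powR_ge0 // mulr_ge0 //; lra.
have dep : 0 < de by rewrite lt0r den.
have [xde|/ltW xde] := leP 1 (`|x| * de).
  have xde' : de^-1 <= `|x| by rewrite -[de^-1]mul1r ler_pdivrMr.
  have small (z : R) : de^-1 <= 1 + `|z| -> (1 + `|z|) `^ (- w) <= de `^ w.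
    move=> dz; rewrite -[de]invrK -(powR_inv1 (_ : 0 <= de^-1)) ?invr_ge0 // -powRrM mulN1r.
    by apply: powR_anti => //; rewrite ?invr_gt0 //; lra.
  have xz : de^-1 <= 1 + `|x| by lra.
  have yz : de^-1 <= 1 + `|y|.
    have : `|x| <= `|x - y| + `|y| by rewrite -{1}[x](subrK y) ler_normD.
    by rewrite -/de; lra.
  apply: (le_trans tri); apply: (le_trans (lerD (duC x) (duC y))).
  rewrite -mulrDr; have := small x xz; have := small y yz => hy hx.
  apply: (@le_trans _ _ (C1 * H * (2 * de `^ w))); first by rewrite ler_wpM2l //; lra.
  have p0 : 0 <= de `^ w by exact: powR_ge0.
  by rewrite mulrA ler_wpM2r //; lra.
have dele : de <= de `^ w by apply: ger1_powR => //; rewrite dep.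
have decomp : x * u x + g x - (y * u y + g y) =
    x * (u x - u y) + (x - y) * u y + (g x - g y) by ring.
have p0 : 0 <= de `^ w by exact: powR_ge0.
have t1 : `|x * (u x - u y)| <= C1 * H * de `^ w.
  rewrite normrM.
  have [x1|/ltW x1] := leP 1 `|x|.
    have m : `|u x - u y| <= C1 * H * `|x| `^ (- w) * de.
      rewrite /de distrC -(distrC y x); apply: (mvt_bound (f' := fun x => x * u x + g x)).
        by case: su.
      move=> z zxy; apply: (le_trans (duC z)); rewrite ler_wpM2l //.
      apply: powR_anti; [by lra| |by lra].
      have zx : `|x - z| <= de.
        rewrite /de; have [xy|yx] := leP x y.
          rewrite min_l // max_r // in zxy; case/andP: zxy => a b.
          by rewrite distrC [leRHS]distrC !ger0_norm; lra.
        rewrite (min_r (ltW yx)) (max_l (ltW yx)) in zxy; case/andP: zxy => a b.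
        by rewrite !ger0_norm; lra.
      have : `|x| <= `|x - z| + `|z| by rewrite -{1}[x](subrK z) ler_normD.
      by lra.
    apply: (le_trans (ler_wpM2l (normr_ge0 _) m)).
    have -> : `|x| * (C1 * H * `|x| `^ (- w) * de) = C1 * H * (`|x| * de * `|x| `^ (- w)) by ring.
    rewrite ler_wpM2l //.
    have xp : 0 < `|x| by lra.
    (* The decay of [u'] compensates the factor [x], since [|x| de <= 1] in this regime. *)
    have -> : `|x| * de * `|x| `^ (- w) = (`|x| * de) `^ (1 - w) * de `^ w.
      rewrite powRM // (powR_pred (1 - w) xp).
      have -> : 1 - w - 1 = - w by ring.
      have {1}-> : de = de `^ (1 - w) * de `^ w.
        by rewrite -powRD ?(gt_eqF dep) ?implybT // subrK powRr1.
      ring.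
    rewrite -[leRHS]mul1r ler_wpM2r // powR_le1 ?mulr_ge0 //; lra.
  have m : `|u x - u y| <= C1 * H * de.
    rewrite /de distrC -(distrC y x); apply: (mvt_bound (f' := fun x => x * u x + g x)).
      by case: su.
    by move=> z _; exact: duC'.
  apply: (@le_trans _ _ (1 * (C1 * H * de))); first exact: ler_pM.
  by rewrite mul1r ler_wpM2l.
have t2 : `|(x - y) * u y| <= C1 * H * de `^ w.
  by rewrite normrM mulrC ler_pM //; exact: uC.
rewrite decomp (le_trans (ler_normD _ _)) //.
apply: (@le_trans _ _ (C1 * H * de `^ w + C1 * H * de `^ w + H * de `^ w)).
  by rewrite lerD // (le_trans (ler_normD _ _)) // lerD.
by rewrite le_eqVlt; apply/orP; left; apply/eqP; ring.
Qed.

Lemma second_derivative_max (f f1 f2 : R -> R) c : (forall x, isd f x (f1 x)) ->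
  (forall x, isd f1 x (f2 x)) -> {for c, continuous f2} -> (forall x, f x <= f c) ->
  f1 c = 0 /\ f2 c <= 0.
Proof.
move=> df df1 cf2 fmax.
have f1c : f1 c = 0.
  have cI : c \in `]c - 1, c + 1[ by rewrite in_itv /=; apply/andP; split; lra.
  have ab : c - 1 <= c + 1 by lra.
  have dd x : x \in `]c - 1, c + 1[ -> derivable f x 1 by move=> _; case: (df x).
  have [_ e1] := derive1_at_max ab dd cI (fun x _ => fmax x).
  by have [_ e2] := df c; rewrite -e2.
split=> //; rewrite leNgt; apply/negP => f2c.
have /cvgrPdist_lt/(_ _ f2c) [d /= d0 hd] := cf2.
have pos x : c <= x -> x < c + d -> 0 < f2 x.
  move=> cx xd; have : ball c d x by rewrite /ball /= distrC ger0_norm; lra.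
  by move=> /hd; rewrite ltr_norml; lra.
pose x := c + d / 2.
have cx : c < x by rewrite /x ltrDl divr_gt0.
have cf : {within `[c, x], continuous f}.
  by apply: continuous_subspaceT => z; exact: is_derive_cont (df z).
have [y + E] := MVT cx (fun z _ => df z) cf.
rewrite in_itv /= => /andP[cy yx].
have cf1 : {within `[c, y], continuous f1}.
  by apply: continuous_subspaceT => z; exact: is_derive_cont (df1 z).
have [z + E1] := MVT cy (fun z _ => df1 z) cf1.
rewrite in_itv /= => /andP[cz zy].
have := fmax x; rewrite -subr_le0 E pmulr_lle0 ?subr_gt0 // leNgt => /negP; apply.
rewrite f1c subr0 in E1; rewrite E1 mulr_gt0 ?subr_gt0 //; apply: pos; first exact: ltW.
by move: yx; rewrite /x; lra.
Qed.

(* Maximum principle for v'' - x v' - m v = g, with barrier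
   [al + be x^2 + eta / gw]; note that (1/gw)'' - x (1/gw)' = 1/gw. *)
Lemma resolvent_growth w m H (v v1 v2 : R -> R) : 0 <= w -> w <= 2 -> 1 <= m -> 0 <= H ->
  (forall x, isd v x (v1 x)) -> (forall x, isd v1 x (v2 x)) -> continuous v2 ->
  poly_growth v -> (forall x, `|v2 x - x * v1 x - m * v x| <= H * `|x| `^ w) ->
  forall x, `|v x| <= 4 * H * (1 + `|x|) `^ w.
Proof.
move=> w0 w2 m1 H0 dv dv1 cv2 pv gH x0.
pose la := 1 + `|x0|.
have la1 : 1 <= la by rewrite /la lerDl.
have la0 : 0 < la by lra.
(* The barrier is tuned to the point [x0]: [H |x|^w <= H la^w + be x^2] holds for all [x], while at
   [x0] the right-hand side is still of order [H la^w]. The summand [2 be] in [al] pays for the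
   second derivative of [be x^2]. *)
pose be := H * la `^ w / la ^+ 2; pose al := H * la `^ w + 2 * be.
have law : 0 <= H * la `^ w by rewrite mulr_ge0 ?powR_ge0.
have be0 : 0 <= be by rewrite divr_ge0 // sqr_ge0.
have gb x : H * `|x| `^ w <= H * la `^ w + be * x ^+ 2.
  pose t := `|x| / la.
  have t0 : 0 <= t by rewrite divr_ge0 // ltW.
  have -> : `|x| = la * t by rewrite /t mulrC divfK // gt_eqF.
  have -> : be * x ^+ 2 = H * la `^ w * t ^+ 2.
    rewrite /be /t -(real_normK (num_real x)) expr_div_n; field.
    by rewrite gt_eqF.
  rewrite powRM ?(ltW la0) // mulrA -[X in _ <= X + _]mulr1 -mulrDr ler_wpM2l //.
  have [t1|/ltW t1] := leP 1 t.
    by rewrite -powR_mulrn // (le_trans (ler_powR t1 w2)) // lerDr.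
  by rewrite (le_trans (powR_le1 t0 t1 w0)) // lerDl sqr_ge0.
have gwn x : gw x != 0 by rewrite gt_eqF // gauss_weight_gt0.
pose ig x := expR (x ^+ 2 / 2).
have igE x : ig x * gw x = 1 by rewrite /ig /gauss_weight -expRD subrr expR0.
have ig0 x : 0 < ig x by exact: expR_gt0.
have dig x : isd ig x (x * ig x).
  have d1 := isdM (isd_exp 2 x) (isd_cst (2 : R)^-1 x).
  have d2 := @isd_comp _ expR (fun y => y ^+ 2 / 2) x _ _ (is_derive_expR _) d1.
  by apply: (isd_eq d2); rewrite /ig /= expr1; field.
have dig1 x : isd (fun x => x * ig x) x (ig x + x * (x * ig x)).
  by apply: (isd_eq (isdM (isd_id x) (dig x))); rewrite mul1r.
have key (s eta : R) : `|s| = 1 -> 0 < eta -> s * v x0 <= al + be * x0 ^+ 2 + eta * ig x0.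
  move=> s1 eta0; rewrite leNgt; apply/negP => bad.
  (* The [eta] term beats polynomial growth and makes [f] negative far out, so that a positive value
     forces a global maximum; [eta] tends to 0 at the end. *)
  pose f x := s * v x - (al + be * x ^+ 2) - eta * ig x.
  pose f1 x := s * v1 x - be * (2 * x) - eta * (x * ig x).
  pose f2 x := s * v2 x - be * 2 - eta * (ig x + x * (x * ig x)).
  have df x : isd f x (f1 x).
    apply: (isd_eq (isdB (isdB (isdZ s (dv x)) (isdD (isd_cst al x) (isdZ be (isd_exp 2 x))))
      (isdZ eta (dig x)))).
    by rewrite add0r /= expr1.
  have df1 x : isd f1 x (f2 x).
    apply: (isd_eq (isdB (isdB (isdZ s (dv1 x)) (isdZ be (isdZ 2 (isd_id x))))
      (isdZ eta (dig1 x)))).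
    by rewrite mulr1.
  have cf2 : continuous f2.
    have cig : continuous ig by move=> x; exact: is_derive_cont (dig x).
    move=> x; apply: cvgB; first apply: cvgB.
    - by apply: cvgM; [exact: cvg_cst|exact: cv2].
    - exact: cvg_cst.
    - apply: cvgM; first exact: cvg_cst.
      apply: cvgD; first exact: cig.
      apply: cvgM; first exact: cvg_id.
      by apply: cvgM; [exact: cvg_id|exact: cig].
  have fx0 : 0 < f x0 by rewrite /f; move: bad; lra.
  have pw : poly_growth (fun x => s * v x - (al + be * x ^+ 2)).
    apply: poly_growthB; first exact: poly_growthZ.
    apply: poly_growthD; first exact: poly_growth_cst.
    by apply: poly_growthZ; have := poly_growthM poly_growth_id poly_growth_id.
  have e2 : 0 < eta / 2 by rewrite divr_gt0.
  have [A hA] := poly_growth_vanishing pw e2.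
  have far x : A <= `|x| -> f x < 0.
    move=> Ax; have gx := gauss_weight_gt0 x.
    rewrite -(pmulr_llt0 _ gx) /f mulrBl -[eta * _ * _]mulrA igE mulr1 subr_lt0.
    by have := le_trans (ler_norm _) (hA x Ax); lra.
  pose M := Num.max A `|x0| + 1.
  have M0 : 0 <= M by rewrite /M addr_ge0 // le_max normr_ge0 orbT.
  have cf : {within `[- M, M], continuous f}.
    by apply: continuous_subspaceT => z; exact: is_derive_cont (df z).
  have NM : - M <= M by lra.
  have [c cM cmax] := EVT_max NM cf.
  have x0M : x0 \in `[- M, M].
    rewrite in_itv /= -ler_norml /M.
    have : `|x0| <= Num.max A `|x0| by rewrite le_max lexx orbT.
    by lra.
  have fc : 0 < f c by exact: lt_le_trans fx0 (cmax _ x0M).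
  have gmax x : f x <= f c.
    have [xM|xM] := boolP (x \in `[- M, M]); first exact: cmax.
    apply: ltW; apply: lt_trans fc; apply: far.
    move: xM; rewrite in_itv /= -ler_norml -ltNge /M => h.
    have : A <= Num.max A `|x0| by rewrite le_max lexx.
    by lra.
  have [f1c f2c] := second_derivative_max df df1 (cf2 c) gmax.
  have : f2 c - c * f1 c - m * f c < 0.
    have : 0 < m * f c by rewrite mulr_gt0 //; lra.
    by rewrite f1c mulr0; lra.
  have -> : f2 c - c * f1 c - m * f c = s * (v2 c - c * v1 c - m * v c) +
     (m * al - 2 * be + (2 + m) * be * c ^+ 2) + eta * (m - 1) * ig c.
    by rewrite /f /f1 /f2; ring.
  apply/negP; rewrite -leNgt.
  have h1 : - (H * `|c| `^ w) <= s * (v2 c - c * v1 c - m * v c).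
    have : `|s * (v2 c - c * v1 c - m * v c)| <= H * `|c| `^ w by rewrite normrM s1 mul1r.
    by rewrite ler_norml => /andP[].
  have h2 : 0 <= eta * (m - 1) * ig c.
    by rewrite !mulr_ge0 ?(ltW eta0) ?(ltW (ig0 c)) //; lra.
  have h3 : H * la `^ w <= m * al - 2 * be.
    have : al <= m * al by rewrite ler_peMl // /al; lra.
    by rewrite /al; lra.
  have h4 : be * c ^+ 2 <= (2 + m) * be * c ^+ 2.
    by rewrite ler_wpM2r ?sqr_ge0 // ler_peMl //; lra.
  by have := gb c; lra.
have bound (s : R) : `|s| = 1 -> s * v x0 <= 4 * H * la `^ w.
  move=> s1; apply: (@le_trans _ _ (al + be * x0 ^+ 2)).
    apply/ler_addgt0Pl => e e0; rewrite addrC.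
    have ee : 0 < e / ig x0 by rewrite divr_gt0.
    by have := key s _ s1 ee; rewrite divfK // gt_eqF.
  have b1 : be <= H * la `^ w.
    by rewrite /be ler_pdivrMr ?exprn_gt0 // ler_peMr // exprn_ege1.
  have b2 : be * x0 ^+ 2 <= H * la `^ w.
    rewrite /be mulrAC ler_pdivrMr ?exprn_gt0 // ler_wpM2l //.
    by rewrite -(real_normK (num_real x0)) ler_sqr ?nnegrE ?(ltW la0) // /la; lra.
  by rewrite /al; lra.
have := bound 1 (normr1 _); have := bound (-1); rewrite normrN1 => /(_ erefl).
by rewrite mul1r mulN1r ler_norml lerNl => -> ->.
Qed.

(** With [|x|] the larger modulus: if [1 + |x| <= 4 de], the size of [v] is enough; otherwise every
    [z] between the points satisfies [1 + |z| >= de] and the mean value inequality applies. *)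
Lemma holder_of_growth w K (v v1 : R -> R) : 0 < w -> w <= 1 -> 0 <= K ->
  (forall x, isd v x (v1 x)) -> (forall x, `|v x| <= K * (1 + `|x|) `^ w) ->
  (forall x, `|v1 x| <= K * (1 + `|x|) `^ (w - 1)) -> holder w (8 * K) v.
Proof.
move=> w0 w1 K0 dv vK v1K x y.
wlog xy : x y / `|y| <= `|x|.
  move=> wl; have [/wl //|/ltW /wl] := leP `|y| `|x|.
  by rewrite (distrC (v x)) (distrC x).
pose M := 1 + `|x|; set de := `|x - y|.
have de0 : 0 <= de by exact: normr_ge0.
have M0 : 0 <= M by rewrite addr_ge0.
have p0 : 0 <= de `^ w by exact: powR_ge0.
have [deM|deM] := leP M (4 * de).
  have hx : `|v x| <= K * M `^ w by exact: vK.
  have hy : `|v y| <= K * M `^ w.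
    apply: (le_trans (vK y)); rewrite ler_wpM2l //.
    by apply: ge0_ler_powR; rewrite ?nnegrE ?addr_ge0 ?(ltW w0) // lerD2l.
  have hM : M `^ w <= 4 * de `^ w.
    apply: (@le_trans _ _ ((4 * de) `^ w)).
      by apply: ge0_ler_powR; rewrite ?nnegrE ?mulr_ge0 ?(ltW w0).
    rewrite powRM // ler_wpM2r // ler1_powR //; lra.
  apply: (le_trans (ler_normB _ _)); apply: (le_trans (lerD hx hy)).
  rewrite -mulrDr [8 * K]mulrC -mulrA ler_wpM2l //; lra.
have [de00|den] := eqVneq de 0.
  have -> : x = y by apply/eqP; rewrite -subr_eq0 -normr_eq0 -/de de00.
  by rewrite subrr normr0 mulr_ge0 ?powR_ge0 // mulr_ge0.
have dep : 0 < de by rewrite lt0r den.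
have m : `|v x - v y| <= K * de `^ (w - 1) * de.
  rewrite /de distrC -(distrC y x); apply: (mvt_bound dv) => z zxy.
  apply: (le_trans (v1K z)); rewrite ler_wpM2l //; apply: powR_anti; [by rewrite -(distrC x)| |by lra].
  have zx : `|x - z| <= de.
    rewrite /de; have [xy'|yx] := leP x y.
      rewrite min_l // max_r // in zxy; case/andP: zxy => a b.
      by rewrite distrC [leRHS]distrC !ger0_norm ?subr_ge0 ?lerB.
    rewrite (min_r (ltW yx)) (max_l (ltW yx)) in zxy; case/andP: zxy => a b.
    by rewrite !ger0_norm ?subr_ge0 ?lerB // ltW.
  have : `|x| <= `|x - z| + `|z| by rewrite -{1}[x](subrK z) ler_normD.
  by move: deM; rewrite -(distrC x y) -/de /M; lra.
apply: (le_trans m); have -> : K * de `^ (w - 1) * de = K * de `^ w.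
  by rewrite [in RHS](powR_pred w dep); ring.
by rewrite ler_wpM2r //; lra.
Qed.

Lemma holder_poly_growth w H f : 0 < w -> w <= 1 -> holder w H f -> poly_growth f.
Proof.
move=> w0 w1 hf; have H0 := holder_ge0 hf.
apply: (@poly_growth_le _ _ (`|f 0| + H) 1%N); first exact: (holder_continuous w0 hf).
move=> x; rewrite expr1 -[f x](subrK (f 0)) addrC.
apply: (le_trans (ler_normD _ _)); rewrite mulrDl lerD //.
  by rewrite ler_peMr // lerDl.
by apply: (le_trans (hf x 0)); rewrite subr0 ler_wpM2l // powR_le_id1 // ltW.
Qed.

Lemma chain_poly_growth w H L F j : 0 < w -> deriv_chain L F -> holder w H (F L) ->
  (j <= L)%N -> poly_growth (F j).
Proof.
move=> w0 dF hF jL; have [c Fc] := chain_growth (ltW w0) dF hF jL.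
have [n hn] := powR_le_nat ((L - j)%:R + w).
have c0 : 0 <= c.
  by have := Fc 0; rewrite normr0 addr0 powR1 mulr1; exact: le_trans.
apply: (@poly_growth_le _ _ c n); first exact: (chain_continuous w0 dF hF).
by move=> x; rewrite (le_trans (Fc x)) // ler_wpM2l // hn // lerDl.
Qed.

Lemma stein_poly_growth u g : stein u g -> poly_growth g -> poly_growth u.
Proof.
move=> su [cg [C [n gC]]].
have C0 : 0 <= C.
  by have := gC 0; rewrite normr0 addr0 expr1n mulr1; exact: le_trans.
have [K [K0 hK]] := stein_growth (ler0n R n).
have gC' x : `|g x| <= C * (1 + `|x|) `^ n%:R by rewrite powR_mulrn // addr_ge0.
apply: (@poly_growth_le _ _ (K * C) n).
  by move=> x; case: su => du _; exact: is_derive_cont (du x).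
move=> x; apply: (le_trans (hK u g C C0 su gC' x)).
rewrite ler_wpM2l ?mulr_ge0 ?(ltW K0) // -powR_mulrn ?addr_ge0 //.
by apply: ler_powR; rewrite ?lerDl //; lra.
Qed.

(** [f x - N f] is the Gaussian mean of [f x - f z], so centring removes the dependence on the size
    of [f] and leaves its Hölder constant. *)
Let mean_holder w : 0 < w -> w <= 1 -> exists C, 0 < C /\ forall H f, holder w H f ->
  forall x, `|f x - gauss_mean f| <= C * H * (1 + `|x|) `^ w.
Proof.
move=> w0 w1; have p1 : poly_growth (fun z : R => 1 + `|z|).
  apply: poly_growthD; first exact: poly_growth_cst.
  by apply: poly_growth_norm; exact: poly_growth_id.
exists (mean N (fun z => 1 + `|z|)); split.
  apply: (@lt_le_trans _ _ (mean N (fun=> 1))); first by rewrite mean_cst.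
  apply: mean_le; [exact: Itg_cst|exact: poly_growth_Itg|].
  by move=> z; rewrite lerDl.
move=> H f hf x; have H0 := holder_ge0 hf.
have If : Itg N f by apply: poly_growth_Itg; exact: holder_poly_growth hf.
have -> : f x - gauss_mean f = mean N (fun z => f x - f z).
  by rewrite meanB ?mean_cst //; exact: Itg_cst.
have -> : mean N (fun z => 1 + `|z|) * H * (1 + `|x|) `^ w =
    mean N (fun z => H * (1 + `|x|) `^ w * (1 + `|z|)).
  by rewrite meanZ; [ring|exact: poly_growth_Itg].
apply: mean_bound; [by apply: ItgB => //; exact: Itg_cst|by apply: ItgZ; exact: poly_growth_Itg|].
move=> z; apply: (le_trans (hf x z)); rewrite -mulrA ler_wpM2l //.
apply: (@le_trans _ _ (((1 + `|x|) * (1 + `|z|)) `^ w)).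
  apply: ge0_ler_powR; rewrite ?nnegrE ?mulr_ge0 ?addr_ge0 ?(ltW w0) //.
  have := ler_normB x z; have : 0 <= `|x| * `|z| by rewrite mulr_ge0.
  by lra.
by rewrite powRM ?addr_ge0 // ler_wpM2l ?powR_ge0 // ler1_powR // lerDl.
Qed.

(** The derivatives of [Theta h] as given by repeatedly differentiating Stein's equation, [F] being
    the chain of [h]; the centring constant survives only for [j = 1]. *)
Fixpoint Theta_derivs (h : R -> R) (F : nat -> R -> R) (j : nat) : R -> R :=
  match j with
  | 0 => Theta h
  | 1 => fun x => x * Theta h x + (F 0%N x - gauss_mean h)
  | (j''.+1 as j').+1 => fun x => x * Theta_derivs h F j' x +
      j'%:R * Theta_derivs h F j'' x + F j' x
  end.

Lemma Theta_derivs_chain L F : deriv_chain L F -> (forall j, (j <= L)%N -> poly_growth (F j)) ->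
  deriv_chain L.+1 (Theta_derivs (F 0%N) F) /\
  forall j, (j <= L.+1)%N -> poly_growth (Theta_derivs (F 0%N) F j).
Proof.
move=> dF pF; set G := Theta_derivs _ _.
have [dT vT] := Theta_ode (pF 0%N (leq0n L)).
have dG : deriv_chain L.+1 G.
  case=> [|j] x jL; first exact: dT.
  (* The recursion has two predecessors, hence the strong form of induction. *)
  elim: j {-2}j (leqnn j) x jL => [|m IH] [|j] jm x jL //.
  - by apply: (isd_eq (isdD (isdM (isd_id x) (dT x)) (isdB (dF 0%N x jL) (isd_cst _ x))));
      rewrite /G /=; ring.
  - by apply: (isd_eq (isdD (isdM (isd_id x) (dT x)) (isdB (dF 0%N x jL) (isd_cst _ x))));
      rewrite /G /=; ring.
  - have j1 : isd (G j.+1) x (G j.+2 x).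
      by apply: IH => //; exact: ltnW.
    have j0 : isd (G j) x (G j.+1 x).
      case: j jm jL j1 => [|j] jm jL j1; first exact: dT.
      by apply: IH; [exact: ltnW|exact: ltnW (ltnW jL)].
    apply: (isd_eq (isdD (isdD (isdM (isd_id x) j1) (isdZ j.+1%:R j0)) (dF j.+1 x jL))).
    rewrite -[G j.+3]/(fun x => x * G j.+2 x + j.+2%:R * G j.+1 x + F j.+2 x).
    by rewrite -[j.+2%:R]natr1; ring.
split=> // j.
have pT : poly_growth (G 0%N).
  apply: (@stein_poly_growth _ (fun x => F 0%N x - gauss_mean (F 0%N))); first by split.
  by apply: poly_growthB; [exact: pF|exact: poly_growth_cst].
elim: j {-2}j (leqnn j) => [|m IH] [|[|j]] jm jL //.
  apply: poly_growthD; first by apply: poly_growthM => //; exact: poly_growth_id.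
  by apply: poly_growthB; [exact: pF|exact: poly_growth_cst].
have -> : G j.+2 = (fun x => x * G j.+1 x + j.+1%:R * G j x + F j.+1 x) by [].
apply: poly_growthD; first apply: poly_growthD.
- by apply: poly_growthM; [exact: poly_growth_id|apply: IH => //; exact: ltnW].
- by apply: poly_growthZ; apply: IH; [exact: ltnW|exact: ltnW (ltnW jL)].
- exact: pF.
Qed.

(* For [L > 0], [v = (Theta (F 0))^(L-1)] solves [v'' - x v' - L v = F L], so
   that [resolvent_growth] applies. *)
Lemma Theta_holder L w : 0 < w -> w <= 1 -> exists C, 0 < C /\ forall F H,
  deriv_chain L F -> holder w H (F L) ->
  holder w (C * H) (Theta_derivs (F 0%N) F L.+1).
Proof.
move=> w0 w1; have [Cs [Cs0 hCs]] := stein_holder w0 w1.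
have [Cg [Cg0 hCg]] := stein_growth (ltW w0).
case: L => [|m].
  have [Cm [Cm0 hCm]] := mean_holder w0 w1.
  exists (Cs * (Cm + 1)); split; first by rewrite mulr_gt0 //; lra.
  move=> F H dF hF; have H0 := holder_ge0 hF.
  have pF : poly_growth (F 0%N) by exact: holder_poly_growth hF.
  rewrite -mulrA; apply: hCs; first by rewrite mulr_ge0 //; lra.
  - exact: Theta_ode.
  - move=> x y; rewrite opprB addrA subrK (le_trans (hF x y)) //.
    by rewrite ler_wpM2r ?powR_ge0 // ler_peMl //; lra.
  - move=> x; apply: (le_trans (hCm _ _ hF x)).
    by rewrite ler_wpM2r ?powR_ge0 // ler_wpM2r //; lra.
pose M : R := m.+1%:R.
have M1 : 1 <= M by rewrite ler1n.
pose A := 4 * M + 1; pose K := Cg * A + 4; pose D := A + M * (8 * K) + 1.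
have A0 : 0 < A by rewrite /A; lra.
have CA : 0 < Cg * A by rewrite mulr_gt0.
have K0 : 0 < K by rewrite /K; lra.
have M0 : 0 < M by lra.
have MK0 : 0 < M * (8 * K) by rewrite !mulr_gt0.
have D0 : 0 < D by rewrite /D; lra.
exists (Cs * D); split; first by rewrite mulr_gt0.
move=> F H dF hF; have H0 := holder_ge0 hF.
have pF j : (j <= m.+1)%N -> poly_growth (F j) by exact: chain_poly_growth hF.
have [dG pG] := Theta_derivs_chain dF pF.
set G := Theta_derivs _ _ in dG pG *.
(* Adding [c] to [G m] replaces [F m.+1] by [F m.+1 - F m.+1 0], which is at most [H |x|^w]; no
   bound then depends on the value at 0. *)
pose c := F m.+1 0 / M.
pose v x := G m x + c.
have Gm2 x : G m.+2 x = x * G m.+1 x + (M * v x + (F m.+1 x - F m.+1 0)).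
  rewrite -[G m.+2 x]/(x * G m.+1 x + M * G m x + F m.+1 x) /v /c.
  by field; rewrite gt_eqF //; lra.
have dv x : isd v x (G m.+1 x).
  apply: (isd_eq (isdD (dG m x _) (isd_cst c x))); first by rewrite ltnS leqW.
  by rewrite addr0.
have dv1 x : isd (G m.+1) x (G m.+2 x) by apply: dG.
have pv : poly_growth v.
  by apply: poly_growthD; [apply: pG; exact: leqW|exact: poly_growth_cst].
have vH x : `|v x| <= 4 * H * (1 + `|x|) `^ w.
  apply: (@resolvent_growth w M H v _ _ _ _ M1 H0 dv dv1 _ pv); [exact: ltW|by lra| |].
    by case: (pG m.+2 (leqnn _)).
  move=> y; rewrite Gm2.
  have -> : y * G m.+1 y + (M * v y + (F m.+1 y - F m.+1 0)) - y * G m.+1 y - M * v y =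
    F m.+1 y - F m.+1 0 by ring.
  by have := hF y 0; rewrite subr0.
pose g x := M * v x + (F m.+1 x - F m.+1 0).
have gA x : `|g x| <= A * H * (1 + `|x|) `^ w.
  have h1 : `|F m.+1 x - F m.+1 0| <= H * (1 + `|x|) `^ w.
    apply: (le_trans (hF x 0)); rewrite subr0 ler_wpM2l //.
    by apply: ge0_ler_powR; rewrite ?nnegrE ?addr_ge0 ?(ltW w0) // lerDr.
  rewrite /g; apply: (le_trans (ler_normD _ _)); rewrite normrM (gtr0_norm M0).
  have h2 := ler_wpM2l (ltW M0) (vH x).
  by apply: (le_trans (lerD h2 h1)); rewrite le_eqVlt; apply/orP; left; apply/eqP; rewrite /A; ring.
(* The same equation is now read as Stein's equation for [G m.+1] with data [g]. By [stein_holder]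
   it remains to see that [g], that is [v], is Hölder. *)
have su : stein (G m.+1) g.
  split; first by move=> x; rewrite -Gm2.
  by apply: poly_growth_vanishing; apply: pG.
have AH0 : 0 <= A * H by rewrite mulr_ge0 // ltW.
have KH0 : 0 <= K * H by rewrite mulr_ge0 // ltW.
have hv : holder w (8 * (K * H)) v.
  apply: (holder_of_growth w0 w1 KH0 dv) => x.
    apply: (le_trans (vH x)); rewrite ler_wpM2r ?powR_ge0 // ler_wpM2r //.
    by rewrite /K lerDr mulr_ge0 ?ltW.
  apply: (le_trans (hCg _ _ _ AH0 su gA x)); rewrite ler_wpM2r ?powR_ge0 // mulrA ler_wpM2r //.
  by rewrite /K lerDl.
have DH0 : 0 <= D * H by rewrite mulr_ge0 // ltW.
have MK : 0 <= M * (8 * K) by rewrite !mulr_ge0 ?(ltW K0) //; lra.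
have -> : G m.+2 = (fun x => x * G m.+1 x + g x) by apply/funext => x; exact: Gm2.
rewrite -mulrA; apply: hCs => //.
  move=> x y; have -> : g x - g y = M * (v x - v y) + (F m.+1 x - F m.+1 y) by rewrite /g; ring.
  have h2 : `|M * (v x - v y)| <= M * (8 * K) * H * `|x - y| `^ w.
    by rewrite normrM (gtr0_norm M0) -!mulrA (ler_wpM2l (ltW M0)) //; have := hv x y; rewrite -!mulrA.
  apply: (le_trans (ler_normD _ _)); apply: (le_trans (lerD h2 (hF x y))).
  rewrite -mulrDl ler_wpM2r ?powR_ge0 // -[X in _ + X]mul1r -mulrDl ler_wpM2r //.
  by rewrite /D; lra.
move=> x; apply: (le_trans (gA x)); rewrite ler_wpM2r ?powR_ge0 // ler_wpM2r // /D; lra.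
Qed.

End SteinEquation.

(** * Smooth substitutes for powers of a Lipschitz function *)

Section RegularizedPower.
Context {R : realType}.
Local Notation isd f x d := (is_derive (x : R) (1 : R) (f : R -> R) (d : R)).
Local Notation mu := (@lebesgue_measure R).
Implicit Types (x y u v : R).

Lemma isd_near (f g : R -> R) x d : (\forall y \near x, f y = g y) ->
  isd f x d -> isd g x d.
Proof. by move=> fg df; exact: near_eq_is_derive fg df. Qed.

Definition ramp (n : nat) (v : R) : R := Num.max 0 v ^+ n.

Lemma ramp_gt0E n v : 0 < v -> ramp n v = v ^+ n.
Proof. by move=> v0; rewrite /ramp max_r // ltW. Qed.

Lemma ramp_le0E n v : v <= 0 -> ramp n.+1 v = 0.
Proof. by move=> v0; rewrite /ramp max_l // expr0n. Qed.

Lemma ramp_ge0 n v : 0 <= ramp n v.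
Proof. by rewrite /ramp exprn_ge0 // le_max lexx. Qed.

Lemma rampS n v : ramp n.+2 v = ramp n.+1 v * v.
Proof.
have [v0|v0] := leP v 0; first by rewrite !ramp_le0E // mul0r.
by rewrite !ramp_gt0E // exprSr.
Qed.

Lemma continuous_ramp n : continuous (ramp n).
Proof.
move=> x; rewrite /ramp.
apply: (@continuous_comp _ _ _ (fun v => Num.max 0 v) (fun y => y ^+ n)).
  by apply: continuous_max; [exact: cvg_cst|exact: cvg_id].
exact: exprn_continuous.
Qed.

Lemma is_derive_ramp n v : isd (ramp n.+2) v (n.+2%:R * ramp n.+1 v).
Proof.
have [v0|v0|->] := ltgtP v 0.
- rewrite ramp_le0E ?(ltW v0) // mulr0.
  apply: (isd_near _ (isd_cst 0 v)).
  by near=> z; rewrite ramp_le0E // ltW //; near: z; exact: lt_nbhsl.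
- rewrite ramp_gt0E //.
  apply: (isd_near _ (isd_exp n.+2 v)).
  by near=> z; rewrite ramp_gt0E //; near: z; exact: lt_nbhsr.
- rewrite ramp_le0E // mulr0; apply/is_derive1_caratheodory.
  exists (ramp n.+1); split; last by rewrite ramp_le0E.
    by move=> z; rewrite (ramp_le0E _ (lexx _)) !subr0 rampS.
  exact: continuous_ramp.
Unshelve. all: end_near. Qed.

Variable m : nat.

(** The bump is the power [m + 2] of the positive part of [1/4 - u^2], supported in [|u| <= 1/2].
    Its [j]-th derivative is a polynomial times the power [m + 2 - j]; this is the recursion for the
    polynomial. *)
Fixpoint bump_poly (j : nat) : {poly R} :=
  if j is j'.+1 then
    (bump_poly j')^`()%R * ((4^-1)%:P - 'X ^+ 2) - ((m.+2 - j')%:R *+ 2) *: ('X * bump_poly j')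
  else 1.

Definition bump_fun (j : nat) u : R := (bump_poly j).[u] * ramp (m.+2 - j) (4^-1 - u ^+ 2).

Lemma is_derive_horner (q : {poly R}) x : isd (fun x => q.[x]) x (q^`()).[x].
Proof. by apply: isd_of; [exact: derivable_horner|rewrite derivE]. Qed.

Lemma bump_chain : deriv_chain m bump_fun.
Proof.
move=> j u jm.
have [i iE] : exists i, (m.+2 - j = i.+2)%N by exists (m - j)%N; lia.
have iE' : (m.+2 - j.+1 = i.+1)%N by lia.
have d1 : isd (fun u => 4^-1 - u ^+ 2) u (- (2 * u)).
  by apply: (isd_eq (isdB (isd_cst 4^-1 u) (isd_exp 2 u))); rewrite sub0r /= expr1.
have := @isd_comp _ (ramp i.+2) _ u _ _ (is_derive_ramp i _) d1 => d2.
have := isdM (is_derive_horner (bump_poly j) u) d2.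
rewrite /bump_fun iE iE' => d3; apply: (isd_eq d3).
rewrite rampS /= iE !(hornerE, hornerXn) /=; ring.
Qed.

Lemma continuous_bump j : continuous (bump_fun j).
Proof.
move=> u; apply: cvgM; first exact: continuous_horner.
apply: (@continuous_comp _ _ _ (fun u => 4^-1 - u ^+ 2) (ramp _)).
  apply: cvgB; [exact: cvg_cst|exact: exprn_continuous].
exact: continuous_ramp.
Qed.

Lemma bump_out j u : (j <= m)%N -> 2^-1 <= `|u| -> bump_fun j u = 0.
Proof.
move=> jm hu; rewrite /bump_fun; have -> : (m.+2 - j = (m - j).+2)%N by lia.
rewrite ramp_le0E ?mulr0 // subr_le0 -(real_normK (num_real u)) expr2.
have -> : 4^-1 = 2^-1 * 2^-1 :> R by field.
by rewrite ler_pM // invr_ge0.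
Qed.

Lemma bump_bounded j : (j <= m)%N -> exists K, 0 < K /\ forall u, `|bump_fun j u| <= K.
Proof.
move=> jm; have ab : - 1 <= (1 : R) by lra.
have cb : {within `[-1, 1], continuous (fun u => `|bump_fun j u|)}.
  apply: continuous_subspaceT => u; apply: (@continuous_comp _ _ _ (bump_fun j) (fun x => `|x|)).
    exact: continuous_bump.
  exact: norm_continuous.
have [c _ cmax] := EVT_max ab cb.
exists (`|bump_fun j c| + 1); split; first by rewrite ltr_wpDl.
move=> u; have [u1|u1] := boolP (u \in `[-1, 1]).
  by rewrite (le_trans (cmax u u1)) // lerDl.
rewrite bump_out // ?normr0 ?addr_ge0 //.
move: u1; rewrite in_itv /= -ler_norml -ltNge => u1; lra.
Qed.

(** A bound fixed by [m] and [j] alone, so that the constants of the test function depend neither on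
    [Q] nor on [e]. *)
Definition bump_cst (j : nat) : R :=
  xget 1 [set K | 0 < K /\ forall u, `|bump_fun j u| <= K].

Lemma bump_cstP j : (j <= m)%N ->
  0 < bump_cst j /\ forall u, `|bump_fun j u| <= bump_cst j.
Proof. by move=> /bump_bounded ex; exact: (xgetPex 1 ex). Qed.

Lemma bump0_ge0 u : 0 <= bump_fun 0 u.
Proof. by rewrite /bump_fun hornerC mul1r ramp_ge0. Qed.

Lemma bump0_low u : `|u| <= 4^-1 -> (3 / 16) ^+ m.+2 <= bump_fun 0 u.
Proof.
move=> u4; rewrite /bump_fun hornerC mul1r subn0 /ramp.
have h : 3 / 16 <= 4^-1 - u ^+ 2.
  have : u ^+ 2 <= 4^-1 ^+ 2 by rewrite -(real_normK (num_real u)) ler_sqr ?nnegrE // invr_ge0.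
  by rewrite expr2; lra.
have h2 : 3 / 16 <= Num.max 0 (4^-1 - u ^+ 2) by rewrite le_max h orbT.
have h0 : 0 <= 3 / 16 :> R by rewrite divr_ge0.
by apply: lerXn2r; rewrite ?nnegrE // (le_trans h0).
Qed.

(** On the support of the kernel [r x] and [r y] differ by a factor of at most 2; the power of 2
    exchanges them. *)
Definition regularization_cst (a : R) j : R := 2 `^ `|a - 1 - j%:R| * bump_cst j.

(** [3/16 = 1/4 - 1/16] is the base of the bump at [|u| = 1/4], and [r x / 4] is the length of the
    interval [|x - y| <= r x / 8] used for the lower bound. *)
Definition regularization_low_cst (a : R) : R := (3 / 16) ^+ m.+2 / 2 `^ `|a - 1| / 4.

Lemma regularization_cst_gt0 a j : (j <= m)%N -> 0 < regularization_cst a j.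
Proof. by move=> /bump_cstP[B0 _]; rewrite mulr_gt0 ?powR_gt0. Qed.

Lemma regularization_low_cst_gt0 a : 0 < regularization_low_cst a.
Proof. by rewrite /regularization_low_cst !divr_gt0 ?powR_gt0 ?exprn_gt0 ?divr_gt0. Qed.

Section Kernel.
Variables (a : R) (r : R -> R).
Hypothesis r_gt0 : forall x, 0 < r x.
Hypothesis r_lip : forall x y, `|r x - r y| <= `|x - y|.

(* The bump centred at [y] has width of order [r y], so that each derivative
   costs a factor [1 / r]. *)
Definition smoothing_kernel j x y : R :=
  r y `^ (a - 1 - j%:R) * bump_fun j ((x - y) * r y `^ (- 1)).

(** A smooth substitute for [r^a]. As [r] is taken at the integration variable, derivatives in [x]
    fall on the bump only, and [r] need not be more than Lipschitz. *)
Definition regularization j x : R := (\int[mu]_y smoothing_kernel j x y)%R.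

Local Notation K := smoothing_kernel.

Let rV y : r y `^ (-1) = (r y)^-1.
Proof. by rewrite powR_inv1 // ltW. Qed.

Let K_support j x y : (j <= m)%N -> K j x y != 0 ->
  [/\ r y <= 2 * r x, r x <= 2 * r y & `|x - y| <= r x].
Proof.
move=> jm; rewrite /K mulf_eq0 negb_or => /andP[_ Kn].
have : `|(x - y) * r y `^ (-1)| < 2^-1.
  by rewrite ltNge; apply: contra Kn => h; rewrite bump_out.
rewrite rV normrM normfV (gtr0_norm (r_gt0 y)) ltr_pdivrMr // => h.
have := r_lip x y; rewrite ler_norml => /andP[h1 h2].
by have := r_gt0 y; have := r_gt0 x; split; lra.
Qed.

Let powR_cmp b x y : 0 < x -> 0 < y -> y <= 2 * x -> x <= 2 * y ->
  y `^ b <= 2 `^ `|b| * x `^ b.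
Proof.
move=> x0 y0 yx xy; have [b0|b0] := leP 0 b.
  rewrite (ger0_norm b0) -powRM ?(ltW x0) //.
  by apply: ge0_ler_powR; rewrite ?nnegrE ?mulr_ge0 ?(ltW x0) ?(ltW y0).
rewrite (ltr0_norm b0) powRN -powR_inv1 ?powR_ge0 //.
have -> : (2 `^ b) `^ (-1) * x `^ b = (2^-1 * x) `^ b.
  have e2 : (2 : R)^-1 = 2 `^ (-1) by rewrite powR_inv1.
  by rewrite powRM ?invr_ge0 ?(ltW x0) // e2 -!powRrM mulN1r mulrN1.
apply: powR_anti; [by rewrite mulr_gt0 ?invr_gt0| |exact: ltW].
by rewrite ler_pdivrMl.
Qed.

Let K_bound j x y : (j <= m)%N ->
  `|K j x y| <= regularization_cst a j * r x `^ (a - 1 - j%:R).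
Proof.
move=> jm; have [B0 hB] := bump_cstP jm.
have [->|Kn] := eqVneq (K j x y) 0.
  by rewrite normr0 mulr_ge0 ?powR_ge0 // ltW // regularization_cst_gt0.
have [h1 h2 _] := K_support jm Kn.
rewrite normrM (ger0_norm (powR_ge0 _ _)) mulrAC ler_pM ?powR_ge0 //.
exact: powR_cmp.
Qed.

Let cr : continuous r.
Proof.
apply: (@holder_continuous _ 1 1); rewrite ?ltr01 // => x y.
by rewrite mul1r powRr1.
Qed.

Let mK j x : measurable_fun (setT : set (measurableTypeR R)) (K j x).
Proof.
have mr : measurable_fun (setT : set (measurableTypeR R)) r by exact: continuous_measurable.
have mp b : measurable_fun (setT : set (measurableTypeR R)) (fun y => r y `^ b).
  exact: measurableT_comp (measurable_powR b) mr.
apply: measurable_funM; first exact: mp.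
apply: (@measurableT_comp _ _ _ _ _ _ (bump_fun j)).
  by apply: continuous_measurable_fun; exact: continuous_bump.
apply: measurable_funM; last exact: mp.
by apply: measurable_funB.
Qed.

Let box_int (c x0 d : R) : mu.-integrable setT (EFin \o (fun y => c * \1_`[x0 - d, x0 + d] y)).
Proof.
apply: (@integrableZl _ _ _ mu setT measurableT c (EFin \o \1_(`[x0 - d, x0 + d]%classic))).
exact: (@integrable_indic_itv R (x0 - d) (x0 + d) true false).
Qed.

Let box_mass x (d : R) : 0 < d -> (\int[mu]_y \1_`[x - d, x + d] y)%R = 2 * d.
Proof.
move=> d0; rewrite /Rintegral integral_indic //.
have E : lebesgue_measure (`[x - d, x + d]%classic : set R) = (2 * d)%:E.
  rewrite lebesgue_measure_itv /= lte_fin ifT; last by lra.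
  by rewrite -EFinB; congr EFin; ring.
by rewrite [X in fine X](_ : _ = (2 * d)%:E) // -E; congr lebesgue_measure; exact: setIT.
Qed.

Let K_box j z y d : (j <= m)%N -> r z <= d ->
  `|K j z y| <= regularization_cst a j * r z `^ (a - 1 - j%:R) * \1_`[z - d, z + d] y.
Proof.
move=> jm rd; have C0 := regularization_cst_gt0 a jm.
have [->|Kn] := eqVneq (K j z y) 0.
  by rewrite normr0 mulr_ge0 // mulr_ge0 ?powR_ge0 ?(ltW C0).
have [_ _ zy] := K_support jm Kn.
rewrite indicE mem_set /= ?mulr1 ?K_bound // in_itv /=.
by move: zy; rewrite ler_norml; lra.
Qed.

Lemma kernel_integrable j x : (j <= m)%N -> mu.-integrable setT (EFin \o K j x).
Proof.
move=> jm; set C := regularization_cst a j.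
apply: (@le_integrable _ _ _ mu setT _ _ _ _ _
  (box_int (C * r x `^ (a - 1 - j%:R)) x (r x))) => //.
  by apply/measurable_EFinP; exact: mK.
by move=> y _ /=; rewrite lee_fin (le_trans (K_box y jm (lexx _))) // ler_norm.
Qed.

Lemma regularization_bound j x : (j <= m)%N ->
  `|regularization j x| <= 2 * regularization_cst a j * r x `^ (a - j%:R).
Proof.
move=> jm; set C := regularization_cst a j.
apply: (le_trans (le_normr_Rintegral _ (kernel_integrable x jm))) => //.
set p := C * r x `^ (a - 1 - j%:R).
have ib := box_int p x (r x).
apply: (@le_trans _ _ (\int[mu]_y (p * \1_`[x - r x, x + r x] y))%R).
  apply: le_Rintegral => //.
    exact: (@integrable_norm _ _ _ mu setT _ (kernel_integrable x jm)).
  by move=> y _; exact: K_box.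
rewrite RintegralZl //; last first.
  by have := box_int 1 x (r x); under eq_fun do rewrite mul1r.
have r0 := r_gt0 x.
rewrite box_mass // /p.
have -> : r x `^ (a - j%:R) = r x * r x `^ (a - 1 - j%:R).
  rewrite (powR_pred _ r0); congr (_ * _ `^ _); ring.
by rewrite le_eqVlt; apply/orP; left; apply/eqP; ring.
Qed.

Lemma regularization_chain : deriv_chain m regularization.
Proof.
move=> j x jm; have jm' := ltnW jm.
have r0 := r_gt0 x; pose d := r x / 2.
have d0 : 0 < d by rewrite divr_gt0.
pose C := regularization_cst a j.+1; have C0 : 0 < C := regularization_cst_gt0 a jm.
have dK (z y : R) : isd (fun z => K j z y) z (K j.+1 z y).
  have d1 : isd (fun z => (z - y) * r y `^ (- 1)) z (r y `^ (-1)).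
    by apply: (isd_eq (isdM (isdB (isd_id z) (isd_cst y z)) (isd_cst (r y `^ (-1)) z))); ring.
  have d2 := @isd_comp _ (bump_fun j) (fun z => (z - y) * r y `^ (- 1)) z _ _
     (bump_chain _ jm) d1.
  apply: (isd_eq (isdZ (r y `^ (a - 1 - j%:R)) d2)).
  rewrite /K [_ * r y `^ (-1)]mulrC mulrA -powRD; last by rewrite (gt_eqF (r_gt0 y)) implybT.
  by congr (_ `^ _ * _); rewrite -natr1; ring.
pose p := C * (2 `^ `|a - 1 - j.+1%:R| * r x `^ (a - 1 - j.+1%:R)).
(* For [z] within [r x / 2] of [x], the kernel at [z] lives on [|z - y| <= 2 r x], inside this box,
   and [r z] is comparable to [r x]: an integrable majorant uniform in [z]. *)
pose G y := p * \1_`[x - 3 * r x, x + 3 * r x] y.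
have near_x z : z \in `]x - d, x + d[ -> r z <= 2 * r x /\ r x <= 2 * r z /\ `|z - x| <= d.
  rewrite in_itv /= => /andP[z1 z2].
  have zx : `|z - x| <= d by rewrite ler_norml; apply/andP; split; lra.
  have := le_trans (r_lip z x) zx; rewrite ler_norml /d => /andP[h1 h2].
  by split; [|split => //]; lra.
have G_ub z y : `](x - d), (x + d)[%classic z -> setT y ->
    `|partial1of2 (fun z y => K j z y) z y| <= G y.
  move=> /near_x [rz [rx zx]] _.
  rewrite partial1of2E; have [_ ->] := dK z y.
  apply: (le_trans (K_box y jm rz)).
  rewrite /G /p; apply: ler_pM => //.
  - by rewrite mulr_ge0 ?powR_ge0 ?(ltW C0).
  - by rewrite ler_wpM2l ?(ltW C0) //; apply: powR_cmp => //.
  - rewrite !indicE ler_nat; case: (boolP (y \in `[z - 2 * r x, z + 2 * r x]%classic)) => // yz.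
    rewrite mem_set //= in_itv /=; move: yz; rewrite inE /= in_itv /=.
    by move: zx; rewrite ler_norml /d; lra.
have Ix : `](x - d), (x + d)[%classic x by rewrite /= in_itv /=; apply/andP; split; lra.
have intf z : `](x - d), (x + d)[%classic z -> mu.-integrable setT (EFin \o K j z).
  by move=> _; exact: kernel_integrable.
have derf z y : `](x - d), (x + d)[%classic z -> setT y -> derivable (fun z => K j z y) z 1.
  by move=> _ _; case: (dK z y).
have p0 : 0 <= p by apply: mulr_ge0 (ltW C0) _; apply: mulr_ge0; exact: powR_ge0.
have G0 y : 0 <= G y by rewrite /G mulr_ge0.
have iG := box_int p x (3 * r x).
have D1 := derivable_under_integral measurableT Ix intf derf G0 iG G_ub.
have D2 := differentiation_under_integral measurableT Ix intf derf G0 iG G_ub.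
apply: (isd_of D1); rewrite D2; apply: eq_Rintegral => y _.
by rewrite partial1of2E; have [_ ->] := dK x y.
Qed.

Lemma regularization_low x : regularization_low_cst a * r x `^ a <= regularization 0 x.
Proof.
pose c0 := (3 / 16 : R) ^+ m.+2 / 2 `^ `|a - 1|.
have c00 : 0 < c0 by rewrite divr_gt0 ?powR_gt0 // exprn_gt0 // divr_gt0.
have -> : regularization_low_cst a = c0 / 4 by [].
have r0 := r_gt0 x.
set p := c0 * r x `^ (a - 1).
have ib := box_int p x (r x / 8).
apply: (@le_trans _ _ (\int[mu]_y (p * \1_`[x - r x / 8, x + r x / 8] y))%R); last first.
  apply: le_Rintegral => //; first exact: kernel_integrable.
  move=> y _; rewrite indicE; case: (boolP (y \in _)) => [|_]; last first.
    by rewrite mulr0 /K mulr_ge0 ?powR_ge0 // bump0_ge0.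
  rewrite inE /= in_itv /= mulr1 => yx.
  have xy : `|x - y| <= r x / 8 by rewrite ler_norml; lra.
  have := le_trans (r_lip x y) xy; rewrite ler_norml => /andP[h1 h2].
  have ry := r_gt0 y.
  have hb : (3 / 16) ^+ m.+2 <= bump_fun 0 ((x - y) * r y `^ (-1)).
    apply: bump0_low; rewrite rV normrM normfV (gtr0_norm ry) ler_pdivrMr //; lra.
  have hp : r x `^ (a - 1) / 2 `^ `|a - 1| <= r y `^ (a - 1 - 0).
    rewrite subr0 ler_pdivrMr ?powR_gt0 // mulrC; apply: powR_cmp => //; lra.
  have -> : p = r x `^ (a - 1) / 2 `^ `|a - 1| * (3 / 16) ^+ m.+2 by rewrite /p /c0; ring.
  by rewrite /K; apply: ler_pM => //; rewrite ?exprn_ge0 ?divr_ge0 ?powR_ge0.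
rewrite RintegralZl //; last first.
  by have := box_int 1 x (r x / 8); under eq_fun do rewrite mul1r.
rewrite box_mass ?divr_gt0 // /p (powR_pred a r0).
by rewrite le_eqVlt; apply/orP; left; apply/eqP; field.
Qed.

End Kernel.

End RegularizedPower.

(** * Cumulants and moments *)

Section SmoothGerms.
Context {R : realType}.
Local Notation isd f x d := (is_derive (x : R) (1 : R) (f : R -> R) (d : R)).
Implicit Types (f g : R -> R).
Local Notation D := (@derive1 R R).

(** Differentiability is required near 0 only, since a characteristic function may vanish elsewhere
    and its logarithm is controlled only near 0. *)
Fixpoint smooth_germ (n : nat) f : Prop :=
  if n is m.+1 then (\forall x \near 0, derivable f x 1) /\ smooth_germ m (D f)
  else True.

Lemma derivable_is_derive1 f x : derivable f x 1 -> isd f x (D f x).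
Proof. by move=> df; exact: isd_of. Qed.

Lemma is_derive1E f x d : isd f x d -> D f x = d.
Proof. by move=> [_ <-]; rewrite derive1E. Qed.

Lemma near_derive1 f g : (\forall x \near 0, f x = g x) -> \forall x \near 0, D f x = D g x.
Proof.
move=> /near_join; apply: filterS => x fg; rewrite !derive1E.
exact: near_eq_derive.
Qed.

Lemma near_derive1n n f g : (\forall x \near 0, f x = g x) ->
  derive1n n f 0 = derive1n n g 0.
Proof.
move=> fg; suff /nbhs_singleton : \forall x \near 0, derive1n n f x = derive1n n g x by [].
by elim: n => // n IH; exact: near_derive1.
Qed.

Lemma near_smooth_germ n f g : (\forall x \near 0, f x = g x) ->
  smooth_germ n f -> smooth_germ n g.
Proof.
elim: n f g => // n IH f g fg [df sf]; split; last exact: IH (near_derive1 fg) sf.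
move: (near_join fg) df; apply: filterS2 => x fgx dfx.
exact: near_eq_derivable fgx dfx.
Qed.

Lemma smooth_germW n f : smooth_germ n.+1 f -> smooth_germ n f.
Proof. by elim: n f => // n IH f [df /IH sf]. Qed.

Lemma smooth_germ_le n m f : (n <= m)%N -> smooth_germ m f -> smooth_germ n f.
Proof.
by move=> /subnK <-; elim: (m - n)%N => // i IH /smooth_germW.
Qed.

Lemma smooth_germS n f g : (\forall x \near 0, isd f x (g x)) ->
  smooth_germ n g -> smooth_germ n.+1 f.
Proof.
move=> fg sg; split; first by apply: filterS fg => x [].
by apply: near_smooth_germ sg; apply: filterS fg => x /is_derive1E.
Qed.

Lemma smooth_germ_derive n f : smooth_germ n.+1 f ->
  \forall x \near 0, isd f x (D f x).
Proof. by move=> [df _]; apply: filterS df => x; exact: derivable_is_derive1. Qed.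

Lemma smooth_germD n f g : smooth_germ n f -> smooth_germ n g ->
  smooth_germ n (fun x => f x + g x).
Proof.
elim: n f g => // n IH f g sf sg.
apply: (@smooth_germS _ _ (fun x => D f x + D g x)); last by apply: IH; [case: sf|case: sg].
by move: (smooth_germ_derive sf) (smooth_germ_derive sg); apply: filterS2 => x; exact: isdD.
Qed.

Lemma smooth_germN n f : smooth_germ n f -> smooth_germ n (fun x => - f x).
Proof.
elim: n f => // n IH f sf.
apply: (@smooth_germS _ _ (fun x => - D f x)); last by apply: IH; case: sf.
by move: (smooth_germ_derive sf); apply: filterS => x; exact: isdN.
Qed.

Lemma smooth_germM n f g : smooth_germ n f -> smooth_germ n g ->
  smooth_germ n (fun x => f x * g x).
Proof.
elim: n f g => // n IH f g sf sg.
apply: (@smooth_germS _ _ (fun x => f x * D g x + g x * D f x)).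
  move: (smooth_germ_derive sf) (smooth_germ_derive sg); apply: filterS2 => x df dg.
  by apply: (isd_eq (isdM df dg)); ring.
by apply: smooth_germD; apply: IH; [exact: smooth_germW sf|case: sg|exact: smooth_germW sg|case: sf].
Qed.

Lemma smooth_germV n f : (\forall x \near 0, f x != 0) -> smooth_germ n f ->
  smooth_germ n (fun x => (f x)^-1).
Proof.
move=> f0; elim: n => // n IH sf.
apply: (@smooth_germS _ _ (fun x => - (D f x * ((f x)^-1 * (f x)^-1)))).
  move: f0 (smooth_germ_derive sf); apply: filterS2 => x fx df.
  apply: (isd_eq (is_deriveV fx df)).
  by rewrite /GRing.scale /= expr2 invfM; ring.
apply: smooth_germN; apply: smooth_germM; first by case: sf.
by apply: smooth_germM; apply: IH; exact: smooth_germW.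
Qed.

Lemma derive1n_germD n f g : smooth_germ n f -> smooth_germ n g ->
  derive1n n (fun x => f x + g x) 0 = derive1n n f 0 + derive1n n g 0.
Proof.
elim: n f g => // n IH f g sf sg.
rewrite /derive1n !iterSr -!/(derive1n n _).
rewrite (@near_derive1n n _ (fun x => D f x + D g x)) ?IH //; [by case: sf|by case: sg|].
move: (smooth_germ_derive sf) (smooth_germ_derive sg); apply: filterS2 => x df dg.
exact: is_derive1E (isdD df dg).
Qed.

Lemma derive1n_germN n f : smooth_germ n f ->
  derive1n n (fun x => - f x) 0 = - derive1n n f 0.
Proof.
elim: n f => // n IH f sf.
rewrite /derive1n !iterSr -!/(derive1n n _).
rewrite (@near_derive1n n _ (fun x => - D f x)) ?IH //; [by case: sf|].
move: (smooth_germ_derive sf); apply: filterS => x df.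
exact: is_derive1E (isdN df).
Qed.

Lemma derive1n_germM n f g : smooth_germ n f -> smooth_germ n g ->
  derive1n n (fun x => f x * g x) 0 =
  \sum_(i < n.+1) 'C(n, i)%:R * (derive1n (n - i) f 0 * derive1n i g 0).
Proof.
elim: n f g => [|n IH] f g sf sg; first by rewrite big_ord1 mul1r.
pose a i := derive1n i f 0; pose b i := derive1n i g 0.
rewrite /derive1n iterSr -/(derive1n n _).
rewrite (@near_derive1n n _ (fun x => f x * D g x + D f x * g x)); last first.
  move: (smooth_germ_derive sf) (smooth_germ_derive sg); apply: filterS2 => x df dg.
  by apply: is_derive1E; apply: (isd_eq (isdM df dg)); ring.
have [sf1 sg1] := (smooth_germW sf, smooth_germW sg); case: (sf) => _ sDf; case: (sg) => _ sDg.
rewrite derive1n_germD; [|exact: smooth_germM..].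
rewrite !IH //.
have aD i : derive1n i (D f) 0 = a i.+1 by rewrite /a /derive1n iterSr.
have bD i : derive1n i (D g) 0 = b i.+1 by rewrite /b /derive1n iterSr.
transitivity (\sum_(i < n.+1) 'C(n, i)%:R * (a (n - i)%N * b i.+1) +
  \sum_(i < n.+1) 'C(n, i)%:R * (a (n - i).+1 * b i)).
  by congr (_ + _); apply: eq_bigr => i _; rewrite ?aD ?bD.
transitivity (\sum_(i < n.+2) 'C(n.+1, i)%:R * (a (n.+1 - i)%N * b i)); last by [].
rewrite [RHS]big_ord_recl bin0.
under [X in _ = _ + X]eq_bigr do rewrite lift0 binS natrD mulrDl subSS.
rewrite big_split /= addrA addrC; congr (_ + _).
rewrite big_ord_recl bin0 [in RHS]big_ord_recr /= bin_small // mul0r addr0.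
rewrite !subn0; congr (_ + _); apply: eq_bigr => i _; rewrite /bump /= add1n.
by rewrite -subSn // subSS.
Qed.

Lemma deriv_chain_derive1n L (F : nat -> R -> R) j : deriv_chain L F -> (j <= L)%N ->
  derive1n j (F 0%N) = F j.
Proof.
move=> dF; elim: j => // j IH jL; rewrite derive1nS IH ?(ltnW jL) //.
by apply/funext => x; apply: is_derive1E; exact: dF.
Qed.

Lemma deriv_chain_smooth_germ L (F : nat -> R -> R) : deriv_chain L F -> smooth_germ L (F 0%N).
Proof.
elim: L F => // L IH F dF; apply: (@smooth_germS _ _ (F 1%N)).
  by apply: filterE => x; exact: dF.
by apply: (IH (fun j => F j.+1)) => j x jL; exact: dF.
Qed.

End SmoothGerms.

Section CharacteristicFunction.
Context {R : realType} {disp : measure_display} {Om : measurableType disp}.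
Variables (P : probability Om R) (X : Om -> R).
Local Notation isd f x d := (is_derive (x : R) (1 : R) (f : R -> R) (d : R)).
Local Notation D := (@derive1 R R).

(* [(Re i^n, Im i^n)] *)
Fixpoint ipow (n : nat) : R * R :=
  if n is m.+1 then (- (ipow m).2, (ipow m).1) else (1, 0).

(** Real and imaginary parts of the [n]-th derivative of [exp (i x)]. *)
Fixpoint trig (n : nat) : (R -> R) * (R -> R) :=
  if n is m.+1 then ((fun x => - (trig m).2 x), (trig m).1) else (cos, sin).

Lemma trig0 n : ((trig n).1 0, (trig n).2 0) = ipow n.
Proof.
elim: n => [|n IH]; first by rewrite /= cos0 sin0.
by rewrite /= -IH.
Qed.

Lemma trig_le1 n x : `|(trig n).1 x| <= 1 /\ `|(trig n).2 x| <= 1.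
Proof.
elim: n => [|n [IH1 IH2]] /=; last by rewrite normrN.
by rewrite !ler_norml cos_le1 cos_geN1 sin_le1 sin_geN1.
Qed.

Lemma is_derive_trig n x : isd (trig n).1 x ((trig n.+1).1 x) /\ isd (trig n).2 x ((trig n.+1).2 x).
Proof.
elim: n => [|n [IH1 IH2]] /=; first by split; [exact: is_derive_cos|exact: is_derive_sin].
by split=> //; exact: isdN.
Qed.

Lemma ipowD m n : ipow (m + n) = ((ipow m).1 * (ipow n).1 - (ipow m).2 * (ipow n).2,
   (ipow m).1 * (ipow n).2 + (ipow m).2 * (ipow n).1).
Proof.
elim: m => [|m IH] /=; first by rewrite !mul1r !mul0r subr0 addr0 -surjective_pairing.
by rewrite IH /=; congr (_, _); ring.
Qed.

(** The sign and the choice of component in [cumulant] undo the factor [i^n]. *)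
Lemma ipow_cumulant_sign n :
  (-1) ^+ n./2 * (if odd n then (ipow n).2 else (ipow n).1) = 1 :> R.
Proof.
have [j [->|->]] : exists j, n = (2 * j)%N \/ n = (2 * j + 1)%N by exists n./2; lia.
- have -> : odd (2 * j) = false by rewrite oddM.
  rewrite mul2n doubleK; elim: j => [|j IH]; first by rewrite mul1r.
  by rewrite doubleS /= exprS mulN1r mulNr mulrN opprK.
- have -> : odd (2 * j + 1) by lia.
  have -> : (2 * j + 1)./2 = j by lia.
  rewrite addn1 mul2n.
  elim: j => [|j IH]; first by rewrite mul1r.
  by move: IH; rewrite doubleS /= exprS mulN1r mulNr mulrN opprK.
Qed.

Variable N : nat.
Hypothesis mX : measurable_fun setT X.
Hypothesis X_int : Itg P (fun w => `|X w| ^+ N).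

Let pow_le n (x : R) : (n <= N)%N -> `|x| ^+ n <= 1 + `|x| ^+ N.
Proof.
move=> nN; have [x1|x1] := leP 1 `|x|.
  by rewrite (le_trans (ler_weXn2l x1 nN)) // lerDr.
by rewrite (@le_trans _ _ 1) ?lerDl ?exprn_ge0 // exprn_ile1 // ltW.
Qed.

Let pow_Itg : Itg P (fun w => 1 + `|X w| ^+ N).
Proof. by apply: ItgD => //; exact: Itg_cst. Qed.

Let c n (t : R) := mean P (fun w => X w ^+ n * (trig n).1 (t * X w)).
Let s n (t : R) := mean P (fun w => X w ^+ n * (trig n).2 (t * X w)).


Let moment_chain (tr : nat -> R -> R) :
  (forall n x, `|tr n x| <= 1) -> (forall n x, isd (tr n) x (tr n.+1 x)) ->
  deriv_chain N (fun n t => mean P (fun w => X w ^+ n * tr n (t * X w))).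
Proof.
move=> tr1 dtr n t nN.
have mtr j z : measurable_fun setT (fun w => X w ^+ j * tr j (z * X w)).
  apply: measurable_funM; first exact: measurable_funX.
  apply: (@measurableT_comp _ _ _ _ _ _ (tr j)); last by apply: measurable_funM.
  by apply: continuous_measurable_fun => x; exact: is_derive_cont (dtr j x).
have bd j z w : (j <= N)%N -> `|X w ^+ j * tr j (z * X w)| <= 1 + `|X w| ^+ N.
  move=> jN; rewrite normrM normrX; apply: le_trans (pow_le (X w) jN).
  by rewrite ler_piMr ?exprn_ge0.
have dtr' z w : isd (fun z => X w ^+ n * tr n (z * X w)) z (X w ^+ n.+1 * tr n.+1 (z * X w)).
  have d1 : isd (fun z => z * X w) z (X w).
    by apply: (isd_eq (isdM (isd_id z) (isd_cst (X w) z))); ring.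
  have d2 := @isd_comp _ (tr n) (fun z => z * X w) z _ _ (dtr n _) d1.
  by apply: (isd_eq (isdZ (X w ^+ n) d2)); rewrite exprSr; ring.
have It : `](t - 1), (t + 1)[%classic t by rewrite /= in_itv /=; apply/andP; split; lra.
have intf (z : R) : `](t - 1), (t + 1)[%classic z -> P.-integrable setT (EFin \o (fun w => X w ^+ n * tr n (z * X w))).
  by move=> _; apply: (Itg_le (mtr n z) _ pow_Itg) => w; exact: bd (ltnW nN).
have derf (z : R) w : `](t - 1), (t + 1)[%classic z -> setT w -> derivable (fun z : R => X w ^+ n * tr n (z * X w)) z 1.
  by move=> _ _; case: (dtr' z w).
have G0 w : 0 <= 1 + `|X w| ^+ N by rewrite addr_ge0.
have G_ub (z : R) w : `](t - 1), (t + 1)[%classic z -> setT w ->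
    `|partial1of2 (fun (z : R) w => X w ^+ n * tr n (z * X w)) z w| <= 1 + `|X w| ^+ N.
  by move=> _ _; rewrite partial1of2E; have [_ ->] := dtr' z w; exact: bd.
have D1 := derivable_under_integral measurableT It intf derf G0 pow_Itg G_ub.
have D2 := differentiation_under_integral measurableT It intf derf G0 pow_Itg G_ub.
apply: (isd_of D1); rewrite D2; apply: eq_Rintegral => w _.
by rewrite partial1of2E; have [_ ->] := dtr' t w.
Qed.

Let c_chain : deriv_chain N c.
Proof. by apply: (@moment_chain (fun n => (trig n).1)) => n x; [case: (trig_le1 n x)|case: (is_derive_trig n x)]. Qed.

Let s_chain : deriv_chain N s.
Proof. by apply: (@moment_chain (fun n => (trig n).2)) => n x; [case: (trig_le1 n x)|case: (is_derive_trig n x)]. Qed.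

Let c0E : charfun_re P X = c 0.
Proof.
apply/funext => t; rewrite /charfun_re /c /mean /Rintegral unlock; congr fine.
by apply: eq_integral => w _; rewrite expr0 mul1r.
Qed.

Let s0E : charfun_im P X = s 0.
Proof.
apply/funext => t; rewrite /charfun_im /s /mean /Rintegral unlock; congr fine.
by apply: eq_integral => w _; rewrite expr0 mul1r.
Qed.

Local Notation M n := (mean P (fun w => X w ^+ n)).

Let cs_at0 n : (n <= N)%N -> c n 0 = (ipow n).1 * M n /\ s n 0 = (ipow n).2 * M n.
Proof.
move=> nN; have IM : Itg P (fun w => X w ^+ n).
  apply: (Itg_le _ _ pow_Itg); first exact: measurable_funX.
  by move=> w; rewrite normrX; exact: pow_le.
by split; rewrite -(meanZ _ IM); apply: eq_mean => w; rewrite mul0r -trig0 mulrC.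
Qed.

Hypothesis N_gt0 : (0 < N)%N.

Let c_gt0 : \forall t \near 0, 0 < c 0 t.
Proof.
have cc : {for 0, continuous (c 0)} by exact: is_derive_cont (c_chain 0 N_gt0).
move: cc => /cvgr_gt; apply.
by have [-> _] := cs_at0 (leq0n N); rewrite mul1r /= ; under eq_mean do rewrite expr0; rewrite mean_cst.
Qed.

Let n2 t := c 0 t ^+ 2 + s 0 t ^+ 2.

(** Real and imaginary parts of [phi' / phi], that is of the conjugate of [phi] times [phi'] over
    [|phi|^2]. Near 0 the real part of [phi] is positive, so the arctangent is the argument. *)
Let dlog : \forall t \near 0,
  isd (log_charfun_re P X) t ((c 0 t * c 1 t + s 0 t * s 1 t) * (n2 t)^-1) /\
  isd (log_charfun_im P X) t ((c 0 t * s 1 t - s 0 t * c 1 t) * (n2 t)^-1).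
Proof.
near=> t.
have ct : 0 < c 0 t by near: t; exact: c_gt0.
have nt : 0 < n2 t by rewrite /n2 ltr_wpDr ?sqr_ge0 // exprn_gt0.
have dc := c_chain t N_gt0; have ds := s_chain t N_gt0.
have dn : isd n2 t (2 * (c 0 t * c 1 t + s 0 t * s 1 t)).
  have dc2 := isdM dc dc; have ds2 := isdM ds ds.
  apply: (isd_eq (isdD dc2 ds2)); ring.
split.
- have dl := @isd_comp _ (@ln R) n2 t _ _ (is_derive1_ln nt) dn.
  have dl2 := isdZ 2^-1 dl.
  have E : (fun t => 2^-1 * ln (n2 t)) = log_charfun_re P X.
    apply/funext => y; rewrite /log_charfun_re c0E s0E -powR12_sqrt ?addr_ge0 ?sqr_ge0 //.
    by rewrite ln_powR.
  by rewrite -E; apply: (isd_eq dl2); field; rewrite gt_eqF.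
- have c0 : c 0 t != 0 by rewrite gt_eqF.
  have dV := is_deriveV c0 dc.
  have da := @isd_comp _ atan _ t _ _ (is_derive1_atan _) (isdM ds dV).
  have E : (fun t => atan (s 0 t * (c 0 t)^-1)) = log_charfun_im P X.
    by apply/funext => y; rewrite /log_charfun_im c0E s0E.
  rewrite -E; apply: (isd_eq da); rewrite /GRing.scale /= /n2.
  by field; rewrite /= gt_eqF //= -?exprMn; move: nt; rewrite /n2 => /gt_eqF ->.
Unshelve. all: end_near. Qed.

Let n2_gt0 : \forall t \near 0, 0 < n2 t.
Proof. by apply: filterS c_gt0 => t ct; rewrite /n2 ltr_wpDr ?sqr_ge0 // exprn_gt0. Qed.

Let U t := (c 0 t * c 1 t + s 0 t * s 1 t) * (n2 t)^-1.
Let V t := (c 0 t * s 1 t - s 0 t * c 1 t) * (n2 t)^-1.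

Let chain_germ (F : nat -> R -> R) m : deriv_chain N F -> (m < N)%N ->
  [/\ smooth_germ m (F 0%N), smooth_germ m (F 1%N),
      forall j, (j <= N)%N -> derive1n j (F 0%N) = F j &
      derive1n m (F 1%N) = F m.+1].
Proof.
move=> dF mN; have dF1 : deriv_chain N.-1 (fun j => F j.+1).
  by move=> j x jN; apply: dF; lia.
have mN' : (m <= N.-1)%N by lia.
split.
- exact: smooth_germ_le (ltnW mN) (deriv_chain_smooth_germ dF).
- exact: smooth_germ_le mN' (deriv_chain_smooth_germ dF1).
- by move=> j; exact: deriv_chain_derive1n.
- exact: (deriv_chain_derive1n dF1 mN').
Qed.

Let UV_germ m : (m < N)%N -> smooth_germ m U /\ smooth_germ m V.
Proof.
move=> mN; have [c0 c1 _ _] := chain_germ c_chain mN; have [s0 s1 _ _] := chain_germ s_chain mN.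
have n2V : smooth_germ m (fun t => (n2 t)^-1).
  apply: smooth_germV; first by apply: filterS n2_gt0 => t; rewrite lt0r => /andP[].
  exact: smooth_germD (smooth_germM c0 c0) (smooth_germM s0 s0).
split; apply: smooth_germM n2V; apply: smooth_germD; first exact: smooth_germM.
- exact: smooth_germM.
- exact: smooth_germM.
- exact: smooth_germN (smooth_germM s0 c1).
Qed.

(* With [phi] the characteristic function, Leibniz' rule for
   [phi' = phi * (log phi)'] at [0] is this recursion, since
   [phi^(n)(0) = i^n E X^n]. *)
Lemma cumulant_of_moments (K : nat -> R) :
  (forall m, (m < N)%N ->
     M m.+1 = \sum_(i < m.+1) 'C(m, i)%:R * (M (m - i)%N * K i.+1)) ->
  forall m, (m < N)%N -> cumulant P X m.+1 = K m.+1.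
Proof.
move=> HK.
have M0 : M 0%N = 1 by under eq_mean do rewrite expr0; rewrite mean_cst.
have UVK m : (m < N)%N -> derive1n m U 0 = (ipow m.+1).1 * K m.+1 /\
    derive1n m V 0 = (ipow m.+1).2 * K m.+1.
  elim/ltn_ind: m => m IH mN.
  have [gc0 gc1 dc dc1] := chain_germ c_chain mN; have [gs0 gs1 ds ds1] := chain_germ s_chain mN.
  have [gU gV] := UV_germ mN.
  have Ec : derive1n m (c 1) 0 = derive1n m (fun t => c 0 t * U t + - (s 0 t * V t)) 0.
    apply: near_derive1n; apply: filterS n2_gt0 => t nt; rewrite /U /V /n2.
    by field; move: nt; rewrite /n2 => /gt_eqF ->.
  have Es : derive1n m (s 1) 0 = derive1n m (fun t => s 0 t * U t + c 0 t * V t) 0.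
    apply: near_derive1n; apply: filterS n2_gt0 => t nt; rewrite /U /V /n2.
    by field; move: nt; rewrite /n2 => /gt_eqF ->.
  have [gcU gcV] := (smooth_germM gc0 gU, smooth_germM gc0 gV).
  have [gsU gsV] := (smooth_germM gs0 gU, smooth_germM gs0 gV).
  move: Ec Es; rewrite dc1 ds1 (derive1n_germD gcU (smooth_germN gsV)) (derive1n_germN gsV).
  rewrite (derive1n_germM gc0 gU) (derive1n_germM gs0 gV).
  rewrite (derive1n_germD gsU gcV) (derive1n_germM gs0 gU) (derive1n_germM gc0 gV).
  have [-> ->] := cs_at0 mN; rewrite HK //.
  have [cE sE] := cs_at0 (leq0n N).
  (* The last Leibniz term holds the unknown [m]-th derivatives of [U] and [V] with coefficient
     [phi(0) = 1]; the others are known by induction. *)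
  rewrite !big_ord_recr /= subnn binn !mul1r M0 dc // ds // cE sE M0 /=.
  have IHi (i : 'I_m) : [/\ derive1n i U 0 = (ipow i.+1).1 * K i.+1,
      derive1n i V 0 = (ipow i.+1).2 * K i.+1,
      derive1n (m - i) (c 0) 0 = (ipow (m - i)).1 * M (m - i)%N &
      derive1n (m - i) (s 0) 0 = (ipow (m - i)).2 * M (m - i)%N].
    have im := ltn_ord i; have [-> ->] := IH i im (ltn_trans im mN).
    have mi : (m - i <= N)%N by lia.
    by have [c1 s1] := cs_at0 mi; rewrite dc // ds.
  have ipowE (i : 'I_m) : ipow m.+1 = ipow ((m - i) + i.+1) by rewrite addnS subnK // ltnW.
  set S := \sum_(i < m) 'C(m, i)%:R * (M (m - i)%N * K i.+1).
  have E1 : \sum_(i < m) 'C(m, i)%:R * (derive1n (m - i) (c 0) 0 * derive1n i U 0) -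
     \sum_(i < m) 'C(m, i)%:R * (derive1n (m - i) (s 0) 0 * derive1n i V 0) = (ipow m.+1).1 * S.
    rewrite -sumrB mulr_sumr; apply: eq_bigr => i _.
    by have [-> -> -> ->] := IHi i; rewrite (ipowE i) ipowD /=; ring.
  have E2 : \sum_(i < m) 'C(m, i)%:R * (derive1n (m - i) (s 0) 0 * derive1n i U 0) +
     \sum_(i < m) 'C(m, i)%:R * (derive1n (m - i) (c 0) 0 * derive1n i V 0) = (ipow m.+1).2 * S.
    rewrite -big_split mulr_sumr; apply: eq_bigr => i _; rewrite [LHS]/=.
    by have [-> -> -> ->] := IHi i; rewrite (ipowE i) ipowD /=; ring.
  move: E1 E2 => /= E1 E2 h2 h1; split; lra.
move=> m mN; have [Um Vm] := UVK m mN.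
have dl : \forall t \near 0, D (log_charfun_re P X) t = U t /\ D (log_charfun_im P X) t = V t.
  by apply: filterS dlog => t [/is_derive1E -> /is_derive1E ->].
have Er : derive1n m.+1 (log_charfun_re P X) 0 = (ipow m.+1).1 * K m.+1.
  rewrite /derive1n iterSr -/(derive1n m _) -Um; apply: near_derive1n.
  by apply: filterS dl => t [].
have Ei : derive1n m.+1 (log_charfun_im P X) 0 = (ipow m.+1).2 * K m.+1.
  rewrite /derive1n iterSr -/(derive1n m _) -Vm; apply: near_derive1n.
  by apply: filterS dl => t [].
rewrite /cumulant; case: ifP (ipow_cumulant_sign m.+1) => _; rewrite ?Er ?Ei.
  by rewrite mulrA => ->; rewrite mul1r.
by rewrite mulrA => ->; rewrite mul1r.
Qed.

End CharacteristicFunction.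

(** * The expansion *)

Section ExpansionIndices.

(* [Gamma q] together with the empty tuple, whose term of the expansion is
   [N h]; only tuples of size at most [n] are listed. *)
Fixpoint tuples (n q : nat) : seq (seq nat) :=
  if n is m.+1 then
    [::] :: [seq rcons t i.+1 | i <- iota 0 q, t <- tuples m (q - i.+1)]
  else [:: [::]].

Lemma mem_tuples n q t :
  (t \in tuples n q) = [&& all (leq 1) t, (sumn t <= q)%N & (size t <= n)%N].
Proof.
elim: n q t => [|n IH] q t; first by rewrite inE; case: t => //= a t; rewrite !andbF.
rewrite /= in_cons; case: (lastP t) => [|{}t a] /=; first by [].
have -> : (rcons t a == [::]) = false by case: t.
rewrite size_rcons all_rcons sumn_rcons ltnS.
rewrite orFb; apply/allpairsPdep/idP => [[i [t' [+ + /rcons_inj[-> ->]]]]|/and3P[/andP[a1 ht] st nt]].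
  by rewrite mem_iota add0n IH => /andP[_ iq] /and3P[-> h ->]; rewrite /= andbT; lia.
exists a.-1, t; rewrite mem_iota IH ht nt prednK //; split=> //; last rewrite andbT /=; lia.
Qed.

Lemma uniq_tuples n q : uniq (tuples n q).
Proof.
elim: n q => // n IH q /=; apply/andP; split.
  by apply/negP => /allpairsPdep[i [[|a t] [_ _]]].
apply: allpairs_uniq_dep => [|i _|]; [exact: iota_uniq|exact: IH|].
by move=> [i t] [i' t'] _ _ /= /rcons_inj[-> ->].
Qed.

(** The last entry belongs to the operator that acts on [h] first, so splitting it off mirrors one
    use of Stein's equation. *)
Lemma big_tuples_rec (R : realType) n q (f : seq nat -> R) :
  \sum_(t <- tuples n.+1 q) f t =
  f [::] + \sum_(i < q) \sum_(t <- tuples n (q - i.+1)) f (rcons t i.+1).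
Proof.
rewrite /= big_cons big_flatten big_map /=; congr (_ + _).
rewrite -[q in iota 0 q]subn0 -/(index_iota 0 q) big_mkord.
by apply: eq_bigr => i _; rewrite big_map.
Qed.

Lemma big_tuples (R : realType) n q (f : seq nat -> R) : (q <= n)%N ->
  \sum_(t <- tuples n q) f t =
  f [::] + \sum_(i < q) \sum_(t <- tuples n.-1 (q - i.+1)) f (rcons t i.+1).
Proof.
case: n => [|n _]; last exact: big_tuples_rec.
by rewrite leqn0 => /eqP ->; rewrite big_ord0 big_seq1 addr0.
Qed.

Lemma Gamma_tuples (R : realType) q (f : seq nat -> R) :
  \sum_(t <- tuples q q) f t = f [::] + \sum_(t \in Gamma q) f t.
Proof.
have t0 : [::] \in tuples q q by rewrite mem_tuples.
rewrite (bigD1_seq [::]) ?uniq_tuples //=; congr (_ + _).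
rewrite -big_filter fsbig_seq ?filter_uniq ?uniq_tuples //.
congr (\big[+%R/0%R]_(t \in _) f t); apply/seteqP; split=> t /=.
  rewrite mem_filter mem_tuples => /andP[tn /and3P[ht st _]]; split=> //.
  by rewrite lt0n size_eq0.
case=> t0' ht st; rewrite mem_filter mem_tuples ht st -size_eq0 -lt0n t0' /=.
apply: leq_trans st; elim: t ht {t0'} => //= a t IH /andP[a1 /IH]; lia.
Qed.

End ExpansionIndices.

Section Expansion.
Context {R : realType}.
Implicit Types (F : nat -> R -> R) (K : nat -> R).
Local Notation N := (normal_prob (0 : R) (1 : R)).

(** The interface between the random field and the analysis. The exponent [L - 1 + w] is one less
    than the smoothness [L + w]; [Theta] restores the loss. The values of [K 1] and [K 2] express
    mean 0 and variance 1. *)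
Record stein_expansion d (Om : measurableType d) (P : probability Om R)
    (W : Om -> R) K (k : nat) (w D e : R) : Prop := SteinExpansion {
  stein_Itg : forall L F H j, (L <= k)%N -> deriv_chain L F -> holder w H (F L) ->
    (j <= L)%N -> Itg P (F j \o W);
  stein_ItgM : forall L F H, (L <= k)%N -> deriv_chain L F -> holder w H (F L) ->
    Itg P (fun om => W om * F 0%N (W om));
  stein_rem : forall L F H, (L <= k)%N -> deriv_chain L F -> holder w H (F L) ->
    `|mean P (fun om => W om * F 0%N (W om)) -
      \sum_(j < L.+1) K j.+1 / j`!%:R * mean P (F j \o W)| <= D * e `^ (L%:R - 1 + w) * H;
  cumulant1 : K 1%N = 0;
  cumulant2 : K 2%N = 1;
  cumulant_small : forall j, (0 < j < k)%N -> `|K (j + 2)%N| <= D * e ^+ j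
}.

Definition expansion_coef K (t : seq nat) : R :=
  (-1) ^+ size t * \prod_(j <- t) (K (j + 2)%N / (j + 1)`!%:R).

Lemma expansion_coef_rcons K t j :
  expansion_coef K (rcons t j) = - (K (j + 2)%N / (j + 1)`!%:R) * expansion_coef K t.
Proof.
by rewrite /expansion_coef size_rcons exprS -cats1 big_cat big_seq1 /=; ring.
Qed.

Lemma Theta_comp_rcons t j (h : R -> R) :
  Theta_comp (rcons t j) h = Theta_comp t (derive1n j.+1 (Theta h)).
Proof. by rewrite /Theta_comp foldr_rcons. Qed.

(** The Stein expansion is applied to [Theta (F 0)]. Its term [j = 0] vanishes, [j = 1] cancels the
    derivative in Stein's equation, and the term in [G i.+2] has a coefficient of order [e^(i + 1)].
    That derivative has [i + 1] orders of smoothness less than [F 0], so its own expansion, known by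
    induction, has exactly the accuracy needed. *)
Lemma expansion_bound (k : nat) (w D : R) : 0 < w -> w <= 1 -> 0 <= D ->
  forall n L, (L <= n)%N -> (L < k)%N -> exists C, 0 <= C /\
  forall d (Om : measurableType d) (P : probability Om R) W K e,
  0 < e -> stein_expansion P W K k w D e ->
  forall F H, deriv_chain L F -> holder w H (F L) ->
  `|mean P (F 0%N \o W) -
    \sum_(t <- tuples n L) expansion_coef K t * gauss_mean (Theta_comp t (F 0%N))|
  <= C * e `^ (L%:R + w) * H.
Proof.
move=> w0 w1 D0; elim/ltn_ind => n IHn L Ln Lk.
have [CT [CT0 hT]] := @Theta_holder R L w w0 w1.
have IH (i : 'I_L) : exists C, 0 <= C /\
  forall d (Om : measurableType d) (P : probability Om R) W K e,
  0 < e -> stein_expansion P W K k w D e ->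
  forall F H, deriv_chain (L - i.+1) F -> holder w H (F (L - i.+1)%N) ->
  `|mean P (F 0%N \o W) -
    \sum_(t <- tuples n.-1 (L - i.+1)) expansion_coef K t * gauss_mean (Theta_comp t (F 0%N))|
  <= C * e `^ ((L - i.+1)%:R + w) * H.
  by have iL := ltn_ord i; apply: IHn; lia.
have [C hC] := choice IH.
exists (CT * D + \sum_(i < L) D * C i * CT); split.
  rewrite addr_ge0 ?mulr_ge0 ?(ltW CT0) // sumr_ge0 // => i _.
  by have [Ci _] := hC i; rewrite !mulr_ge0 // ltW.
move=> d Om P W K e e0 SE F H dF hF.
have pF j : (j <= L)%N -> poly_growth (F j) := chain_poly_growth w0 dF hF.
have [dG pG] := Theta_derivs_chain dF pF.
have hG := hT F H dF hF; set G := Theta_derivs (F 0%N) F in dG pG hG *.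
have H0 := holder_ge0 hF.
have Lk' : (L.+1 <= k)%N by [].
have rem := stein_rem SE Lk' dG hG.
have IG j : (j <= L.+1)%N -> Itg P (G j \o W) := stein_Itg SE Lk' dG hG.
have E1 : mean P (F 0%N \o W) = gauss_mean (F 0%N) + mean P (G 1%N \o W) -
    mean P (fun om => W om * G 0%N (W om)).
  have -> : mean P (F 0%N \o W) = mean P (fun om => gauss_mean (F 0%N) + (G 1%N (W om) - W om * G 0%N (W om))).
    by apply: eq_mean => om; rewrite /G /=; ring.
  have IM := stein_ItgM SE Lk' dG hG.
  by rewrite meanD ?mean_cst ?meanB ?addrA //; [exact: IG|exact: Itg_cst|apply: ItgB => //; exact: IG].
rewrite big_tuples //= {1}/expansion_coef expr0 big_nil !mul1r.
pose cf (i : 'I_L) := K (i.+1 + 2)%N / (i.+1 + 1)`!%:R.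
pose ex (i : 'I_L) := \sum_(t <- tuples n.-1 (L - i.+1))
  expansion_coef K t * gauss_mean (Theta_comp t (G i.+2)).
have -> : \sum_(i < L) \sum_(t <- tuples n.-1 (L - i.+1))
   expansion_coef K (rcons t i.+1) * gauss_mean (Theta_comp (rcons t i.+1) (F 0%N)) =
   - \sum_(i < L) cf i * ex i.
  rewrite -sumrN; apply: eq_bigr => i _; rewrite /ex mulr_sumr -sumrN; apply: eq_bigr => t _.
  rewrite expansion_coef_rcons Theta_comp_rcons (deriv_chain_derive1n dG) ?ltnS ?ltn_ord //.
  by rewrite /cf; ring.
have sumE : \sum_(j < L.+2) K j.+1 / j`!%:R * mean P (G j \o W) =
    mean P (G 1%N \o W) + \sum_(i < L) cf i * mean P (G i.+2 \o W).
  rewrite 2!big_ord_recl /= (cumulant1 SE) (cumulant2 SE) fact0 !mul0r add0r.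
  rewrite divr1 mul1r; congr (_ + _); apply: eq_bigr => i _.
  by rewrite /cf /bump /= !add1n !addn1 addn2.
have -> : mean P (F 0%N \o W) - (gauss_mean (F 0%N) - \sum_(i < L) cf i * ex i) =
   - (mean P (fun om => W om * G 0%N (W om)) - \sum_(j < L.+2) K j.+1 / j`!%:R * mean P (G j \o W))
   - \sum_(i < L) cf i * (mean P (G i.+2 \o W) - ex i).
  rewrite E1 sumE; have -> : \sum_(i < L) cf i * (mean P (G i.+2 \o W) - ex i) =
      \sum_(i < L) cf i * mean P (G i.+2 \o W) - \sum_(i < L) cf i * ex i.
    by rewrite -sumrB; apply: eq_bigr => i _; rewrite mulrBr.
  by ring.
apply: (le_trans (ler_normB _ _)); rewrite normrN !mulrDl; apply: lerD.
  apply: (le_trans rem); rewrite -natr1 addrK.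
  by rewrite le_eqVlt; apply/orP; left; apply/eqP; ring.
apply: (le_trans (ler_norm_sum _ _ _)); rewrite !mulr_suml; apply: ler_sum => i _.
have iL := ltn_ord i; have [Ci hCi] := hC i.
have dGi : deriv_chain (L - i.+1) (deriv_shift i.+2 G).
  have -> : (L - i.+1 = L.+1 - i.+2)%N by rewrite subSS.
  exact: deriv_chain_shift.
have hGi : holder w (CT * H) (deriv_shift i.+2 G (L - i.+1)%N).
  by rewrite /deriv_shift (_ : _ + _ = L.+1)%N // addSn subnKC.
have := hCi _ _ _ _ _ _ e0 SE _ _ dGi hGi; rewrite /deriv_shift addn0 -/(ex i) => hi.
have ci : `|cf i| <= D * e ^+ i.+1.
  rewrite /cf normrM normfV (ger0_norm (ler0n _ _)); apply: (@le_trans _ _ (`|K (i.+1 + 2)%N|)).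
    by rewrite ler_pdivrMr ?ltr0n ?fact_gt0 // ler_peMr // ler1n fact_gt0.
  by apply: (cumulant_small SE); rewrite /= (leq_ltn_trans iL).
rewrite normrM; apply: (le_trans (ler_pM _ _ ci hi)) => //.
have -> : e `^ (L%:R + w) = e ^+ i.+1 * e `^ ((L - i.+1)%:R + w).
  rewrite -powR_mulrn ?(ltW e0) // -powRD; last by rewrite (gt_eqF e0) implybT.
  by congr (_ `^ _); rewrite natrB //; ring.
by rewrite le_eqVlt; apply/orP; left; apply/eqP; ring.
Qed.

Definition monomial (m j : nat) (x : R) : R := (m ^_ j)%:R * x ^+ (m - j).

Lemma monomial_chain m L : deriv_chain L (monomial m).
Proof.
move=> j x _; apply: (isd_eq (isdZ (m ^_ j)%:R (isd_exp (m - j) x))).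
by rewrite /monomial ffactnSr natrM -mulrA subnS.
Qed.

Lemma monomial_holder m L w : (m <= L)%N -> holder w 0 (monomial m L).
Proof.
move=> mL x y; rewrite mul0r /monomial; move: mL; rewrite -subn_eq0 => /eqP ->.
by rewrite subrr normr0.
Qed.

(** The coefficients supplied for different [L] need not agree beforehand. Monomials of degree at
    most [L] have Hölder constant 0, so the expansion is exact on them and becomes the recursion
    that determines cumulants from moments; hence all coefficients are cumulants over factorials.
    The factor in front of [D] bounds these factorials. *)
Lemma stein_expansion_of_local d (Om : measurableType d) (P : probability Om R)
    (W : Om -> R) (k : nat) (w D e : R) : (0 < k)%N -> 0 <= D -> 0 <= e ->
  measurable_fun setT W -> Itg P (fun om => `|W om| ^+ k.+1) ->
  mean P W = 0 -> mean P (fun om => W om ^+ 2) = 1 ->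
  (forall L F H j, (L <= k)%N -> deriv_chain L F -> holder w H (F L) ->
    (j <= L)%N -> Itg P (F j \o W)) ->
  (forall L F H, (L <= k)%N -> deriv_chain L F -> holder w H (F L) ->
    Itg P (fun om => W om * F 0%N (W om))) ->
  (forall L, (L <= k)%N -> exists a : nat -> R,
    (forall j, (j < k)%N -> `|a j.+1| <= D * e ^+ j) /\
    forall F H, deriv_chain L F -> holder w H (F L) ->
      `|mean P (fun om => W om * F 0%N (W om)) -
        \sum_(j < L.+1) a j * mean P (F j \o W)| <= D * e `^ (L%:R - 1 + w) * H) ->
  stein_expansion P W (cumulant P W) k w (k`!%:R * D) e.
Proof.
move=> k0 D0 e0 mW IW EW EW2 I1 I2 loc.
have f1 : (1 : R) <= k`!%:R by rewrite ler1n fact_gt0.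
have DD : D <= k`!%:R * D by rewrite ler_peMl.
pose M m := mean P (fun om => W om ^+ m).
have mom L (a : nat -> R) : (L <= k)%N -> (forall F H, deriv_chain L F -> holder w H (F L) ->
    `|mean P (fun om => W om * F 0%N (W om)) -
      \sum_(j < L.+1) a j * mean P (F j \o W)| <= D * e `^ (L%:R - 1 + w) * H) ->
    forall m, (m <= L)%N ->
    M m.+1 = \sum_(i < m.+1) 'C(m, i)%:R * (M (m - i)%N * (i`!%:R * a i)).
  move=> Lk ha m mL; have := ha _ _ (@monomial_chain m L) (monomial_holder w mL).
  rewrite mulr0 normr_le0 subr_eq0 => /eqP mE.
  have -> : M m.+1 = mean P (fun om => W om * monomial m 0 (W om)).
    by apply: eq_mean => om; rewrite /monomial ffactn0 mul1r subn0 exprS.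
  rewrite mE (big_ord_widen L.+1 (fun i => 'C(m, i)%:R * (M (m - i)%N * (i`!%:R * a i)))) //.
  rewrite [RHS]big_mkcond; apply: eq_bigr => i _ /=.
  have IWm j' : (j' <= m)%N -> Itg P (fun om => W om ^+ j').
    move=> jm; have := I1 L _ _ 0%N Lk (@monomial_chain j' L) (monomial_holder w _).
    move=> /(_ (leq_trans jm mL) (leq0n _)); congr Itg; apply/funext => om /=.
    by rewrite /monomial ffactn0 mul1r subn0.
  case: ifP => [im|/negbT im].
    by rewrite /monomial meanZ ?IWm ?leq_subr // -bin_ffact natrM; rewrite /M; ring.
  have -> : mean P (monomial m i \o W) = 0.
    rewrite -(mean_cst P 0); apply: eq_mean => om /=.
    by rewrite /monomial ffact_small ?mul0r // ltnNge -ltnS.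
  by rewrite mulr0.
have aK L (a : nat -> R) : (L <= k)%N -> (forall F H, deriv_chain L F -> holder w H (F L) ->
    `|mean P (fun om => W om * F 0%N (W om)) -
      \sum_(j < L.+1) a j * mean P (F j \o W)| <= D * e `^ (L%:R - 1 + w) * H) ->
    forall j, (j <= L)%N -> cumulant P W j.+1 = j`!%:R * a j.
  move=> Lk ha j jL.
  have IWL : Itg P (fun om => `|W om| ^+ L.+1).
    apply: (Itg_le (g := fun om => 1 + `|W om| ^+ k.+1)).
    - by apply: measurable_funX; exact: measurableT_comp.
    - move=> om; rewrite normrX normr_id; have [W1|W1] := leP 1 `|W om|.
        by rewrite (le_trans (ler_weXn2l W1 (_ : L.+1 <= k.+1)%N)) // lerDr.
      by rewrite (@le_trans _ _ 1) ?lerDl ?exprn_ge0 // exprn_ile1 // ltW.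
    - by apply: ItgD => //; exact: Itg_cst.
  by apply: (@cumulant_of_moments _ _ _ P W L.+1 mW IWL _ (fun j => j.-1`!%:R * a j.-1)) => // m mL; exact: mom ha m mL.
have [a [a_small ha]] := loc k (leqnn k).
have aE := aK k a (leqnn k) ha.
have M0 : M 0%N = 1 by rewrite -(mean_cst P 1); apply: eq_mean => om; rewrite expr0.
have M1 : M 1%N = 0 by rewrite -EW; apply: eq_mean => om; rewrite expr1.
split=> //.
- move=> L F H Lk dF hF; have [b [_ hb]] := loc L Lk.
  have bE := aK L b Lk hb; have H0 := holder_ge0 hF.
  have -> : \sum_(j < L.+1) cumulant P W j.+1 / j`!%:R * mean P (F j \o W) =
      \sum_(j < L.+1) b j * mean P (F j \o W).
    apply: eq_bigr => j _; rewrite bE; last by rewrite -ltnS.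
    congr (_ * _).
    by field; rewrite pnatr_eq0 -lt0n fact_gt0.
  apply: (le_trans (hb F H dF hF)); rewrite ler_wpM2r // ler_wpM2r ?powR_ge0 //.
- rewrite aE // mul1r; have := mom k a (leqnn k) ha 0%N (leq0n k).
  rewrite big_ord1 bin0 !mul1r subn0 M0 mul1r => <-.
  by rewrite -EW; apply: eq_mean => om; rewrite expr1.
- rewrite aE // mul1r; have := mom k a (leqnn k) ha 1%N k0.
  rewrite big_ord_recr big_ord1 /= bin0 binn !mul1r subn0 subnn M0 M1 mul0r add0r mul1r => <-.
  exact: EW2.
- move=> j /andP[j0 jk]; rewrite addn2 aE // normrM ger0_norm // -mulrA; apply: ler_pM => //; last exact: a_small.
  by rewrite ler_nat leq_fact // ltnW.
Qed.

End Expansion.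

(** * Moving Stein operators onto polynomials under the Gaussian mean *)

Section Duality.
Context {R : realType}.
Implicit Types (F : nat -> R -> R) (p q : {poly R}) (x : R).
Local Notation N := (normal_prob (0 : R) (1 : R)).
Local Notation isd f x d := (is_derive (x : R) (1 : R) (f : R -> R) (d : R)).

Lemma poly_growth_horner p : poly_growth (fun x => p.[x]).
Proof.
elim/poly_ind: p => [|p c IH].
  rewrite (_ : (fun x => _) = (fun=> 0)); first exact: poly_growth_cst.
  by apply/funext => x; rewrite horner0.
rewrite (_ : (fun x => _) = (fun x => p.[x] * x + c)).
  apply: poly_growthD; last exact: poly_growth_cst.
  by apply: poly_growthM => //; exact: poly_growth_id.
by apply/funext => x; rewrite hornerMXaddC.
Qed.

(** The Gaussian adjoint of differentiation. *)
Definition hermite_raise p : {poly R} := 'X * p - p^`().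

Lemma hermite_raiseE p x : (hermite_raise p).[x] = x * p.[x] - p^`().[x].
Proof. by rewrite /hermite_raise !hornerE. Qed.

Lemma gauss_adjoint p (v v' : R -> R) : poly_growth v -> poly_growth v' ->
  (forall x, isd v x (v' x)) ->
  mean N (fun x => p.[x] * v' x) = mean N (fun x => (hermite_raise p).[x] * v x).
Proof.
move=> pv pv' dv.
have pp := poly_growth_horner p; have pp' := poly_growth_horner p^`().
have pM (q : {poly R}) u : poly_growth u -> poly_growth (fun x => q.[x] * u x).
  by move=> pu; apply: poly_growthM => //; exact: poly_growth_horner.
have pv'M := pM p _ pv'; have p'v := pM p^`() _ pv.
have dpv x : isd (fun x => p.[x] * v x) x (p.[x] * v' x + p^`().[x] * v x).
  by apply: (isd_eq (isdM (is_derive_horner p x) (dv x))); ring.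
have := gauss_ibp dpv (pM p _ pv) (poly_growthD pv'M p'v).
rewrite meanD; [|exact: poly_growth_Itg..].
move=> /(canRL (addrK _)) ->.
rewrite -meanB; [|apply: poly_growth_Itg; apply: poly_growthM; [exact: poly_growth_id|exact: pM]|exact: poly_growth_Itg].
by apply: eq_mean => x; rewrite (hermite_raiseE p x) mulrBl mulrA.
Qed.

(** On [X^n] the operator gives [(n + t + 1) X^n] minus the second derivative of [X^n]. The leading
    coefficient never vanishes, so the equation is solved by induction on the degree. *)
Lemma hermite_solve (t : nat) q : exists p, hermite_raise p^`() + t.+1%:R *: p = q.
Proof.
pose solvable q := exists p, hermite_raise p^`() + t.+1%:R *: p = q.
have solvZ (c : R) q1 : solvable q1 -> solvable (c *: q1).
  case=> p <-; exists (c *: p).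
  rewrite /hermite_raise !derivZ -scalerAr [RHS]scalerDr [in RHS]scalerBr !scalerA.
  by rewrite [t.+1%:R * c]mulrC.
have solvD q1 q2 : solvable q1 -> solvable q2 -> solvable (q1 + q2).
  by move=> [p1 <-] [p2 <-]; exists (p1 + p2); rewrite /hermite_raise !derivD scalerDr; ring.
have solv0 : solvable 0.
  by exists 0; rewrite /hermite_raise deriv0 deriv0 mulr0 subr0 scaler0 addr0.
have solvX n : solvable 'X^n.
  elim/ltn_ind: n => n IH.
  have sd : solvable ('X^n)^`()^`().
    case: n IH => [|[|n]] IH; rewrite derivXn /=.
    - by rewrite mulr0n deriv0.
    - by rewrite mulr1n expr0 derivC.
    - rewrite derivMn derivXn /= -mulrnA -scaler_nat.
      by apply: solvZ; apply: IH.
  have nt : (n + t.+1)%:R != 0 :> R by rewrite pnatr_eq0 addnS.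
  have sA : solvable ((n + t.+1)%:R *: 'X^n - ('X^n)^`()^`()).
    have XD : 'X * ('X^n)^`() = n%:R *: 'X^n :> {poly R}.
      by rewrite derivXn scaler_nat; case: (n) => [|m]; rewrite ?mulr0n ?mulr0 // mulrnAr -exprS.
    by exists 'X^n; rewrite /hermite_raise XD natrD scalerDl addrAC.
  by have := solvZ (n + t.+1)%:R^-1 _ (solvD _ _ sA sd); rewrite subrK scalerA mulVf // scale1r.
rewrite -/(solvable q) -[q]coefK poly_def.
elim: (size q) => [|n IH]; first by rewrite big_ord0.
by rewrite big_ord_recr; apply: solvD => //; exact: solvZ.
Qed.

(* [G = Theta_derivs (F 0) F] satisfies [G_(j+2) - x G_(j+1) - (j+1) G_j = F_(j+1)];
   the adjoint of the operator on the left is triangular on polynomials. *)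
Lemma Theta_dual j p : exists q, forall L F, (j < L)%N -> deriv_chain L F ->
  (forall i, (i <= L)%N -> poly_growth (F i)) ->
  mean N (fun x => p.[x] * Theta_derivs (F 0%N) F j.+2 x) =
  mean N (fun x => q.[x] * F j.+1 x).
Proof.
have [q hq] := hermite_solve j (- hermite_raise (hermite_raise p)).
exists q => L F jL dF pF.
have [dG pG] := Theta_derivs_chain dF pF; set G := Theta_derivs _ _ in dG pG *.
have pM (r : {poly R}) u : poly_growth u -> poly_growth (fun x => r.[x] * u x).
  by move=> pu; apply: poly_growthM => //; exact: poly_growth_horner.
have IG (r : {poly R}) i : (i <= L.+1)%N -> Itg N (fun x => r.[x] * G i x).
  by move=> iL; apply: poly_growth_Itg; apply: pM; exact: pG.
have adj (r : {poly R}) i : (i < L.+1)%N ->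
    mean N (fun x => r.[x] * G i.+1 x) = mean N (fun x => (hermite_raise r).[x] * G i x).
  by move=> iL; apply: gauss_adjoint => [||x]; [exact: pG (ltnW iL)|exact: pG|exact: dG].
have jLW : (j < L.+1)%N by exact: ltnW.
rewrite !adj //.
have FE x : F j.+1 x = G j.+2 x - x * G j.+1 x - j.+1%:R * G j x.
  by rewrite -[G j.+2 x]/(x * G j.+1 x + j.+1%:R * G j x + F j.+1 x); ring.
have [j2 j1 j0] : [/\ (j.+2 <= L.+1)%N, (j.+1 <= L.+1)%N & (j <= L.+1)%N] by split=> //; exact: ltnW.
have -> : mean N (fun x => q.[x] * F j.+1 x) = mean N (fun x => q.[x] * G j.+2 x) -
    mean N (fun x => ('X * q).[x] * G j.+1 x) - mean N (fun x => (j.+1%:R *: q).[x] * G j x).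
  rewrite -(meanB (IG q _ j2) (IG ('X * q) _ j1)).
  rewrite -(meanB (ItgB (IG q _ j2) (IG ('X * q) _ j1)) (IG _ _ j0)).
  apply: eq_mean => x; rewrite FE !hornerE.
  by rewrite !mulrBr -!mulrA; congr (_ - _ - _); rewrite mulrCA.
rewrite adj // -(meanB (IG _ _ j1) (IG _ _ j1)).
have -> : mean N (fun x => (hermite_raise q).[x] * G j.+1 x - ('X * q).[x] * G j.+1 x) =
    mean N (fun x => (- q^`()).[x] * G j.+1 x).
  by apply: eq_mean => x; rewrite -mulrBl hermite_raiseE !hornerE addrAC subrr add0r.
rewrite adj // -(meanB (IG _ _ j0) (IG _ _ j0)).
apply: eq_mean => x; rewrite -mulrBl; congr (_ * _).
rewrite -[LHS]opprK -hornerN -hq !(hermite_raiseE, hornerE, derivN); ring.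
Qed.

Lemma Theta_comp_chain L F s : (sumn s <= L)%N -> deriv_chain L F ->
  (forall i, (i <= L)%N -> poly_growth (F i)) ->
  exists G, [/\ G 0%N = Theta_comp s (F 0%N), deriv_chain (L - sumn s) G &
    forall i, (i <= L - sumn s)%N -> poly_growth (G i)].
Proof.
elim: s => [|a s IH] /= sL dF pF; first by exists F; rewrite subn0.
have sL' : (sumn s <= L)%N by lia.
have [G [G0 dG pG]] := IH sL' dF pF.
have [dT pT] := Theta_derivs_chain dG pG.
exists (deriv_shift a.+1 (Theta_derivs (G 0%N) G)); split.
- by rewrite /deriv_shift addn0 -G0 -(deriv_chain_derive1n dT) //; lia.
- have -> : (L - (a + sumn s) = (L - sumn s).+1 - a.+1)%N by lia.
  exact: deriv_chain_shift.
- by move=> i iL; apply: pT; lia.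
Qed.

(** For [a = 0] and [p = 1] the Gaussian mean of [Theta_comp s h] becomes that of a polynomial times
    one derivative of [h]. The parameters [a] and [p] are there for the induction on [s]; [q] is
    chosen before [F]. *)
Lemma Theta_comp_dual s : all (leq 1) s -> forall a p, exists q, forall L F,
  (a + sumn s <= L)%N -> deriv_chain L F -> (forall i, (i <= L)%N -> poly_growth (F i)) ->
  mean N (fun x => p.[x] * derive1n a (Theta_comp s (F 0%N)) x) =
  mean N (fun x => q.[x] * F (a + sumn s)%N x).
Proof.
elim: s => [|b s IH] /= hs a p.
  by exists p => L F aL dF pF; rewrite addn0 in aL *; rewrite (deriv_chain_derive1n dF).
move: hs => /andP[b1 /IH{}IH].
have [q hq] := Theta_dual (a + b).-1 p.
have [r hr] := IH (a + b)%N q; exists r => L F abL dF pF.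
have sL : (sumn s <= L)%N by lia.
have [G [G0 dG pG]] := Theta_comp_chain sL dF pF.
have [dT pT] := Theta_derivs_chain dG pG.
have abG : ((a + b).-1 < L - sumn s)%N by lia.
have ab : (a + b)%N = (a + b).-1.+1 by lia.
rewrite addnA -(hr L) -?addnA //.
transitivity (mean N (fun x => q.[x] * G (a + b)%N x)); last first.
  by apply: eq_mean => x; rewrite -(deriv_chain_derive1n dG) ?G0 //; lia.
rewrite [in RHS]ab -(hq _ _ abG dG pG); apply: eq_mean => x; congr (_ * _).
rewrite -ab -G0.
have -> : derive1n a (derive1n b.+1 (Theta (G 0%N))) = derive1n (a + b).+1 (Theta (G 0%N)).
  by rewrite /derive1n -iterD addnS.
by rewrite (deriv_chain_derive1n dT) //; lia.
Qed.

End Duality.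

(** * Quantile coupling *)

Section Quantile.
Context {R : realType}.
Local Notation N := (normal_prob (0 : R) (1 : R)).
Local Notation mu := (@lebesgue_measure R).
Local Notation pdf := (normal_pdf (0 : R) (1 : R)).
Implicit Types x y z : R.

Definition gauss_cdf x : R := (\int[mu]_(t in `]-oo, x]) pdf t)%R.

Lemma gauss_cdfE x : N `]-oo, x] = (gauss_cdf x)%:E.
Proof.
rewrite /gauss_cdf /Rintegral fineK //.
apply: integrable_fin_num => //.
exact: integrableS (integrable_normal_pdf _ _).
Qed.

Lemma is_derive_gauss_cdf x : is_derive x (1 : R) gauss_cdf (pdf x).
Proof.
have xx : x < x + 1 by rewrite ltrDl.
have ix : mu.-integrable `]-oo, x + 1] (EFin \o pdf).
  exact: integrableS (integrable_normal_pdf _ _).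
have cp : {for x, continuous pdf} by apply: continuous_normal_pdf; rewrite oner_eq0.
have [d e] := @continuous_FTC1 R _ -oo%O x (x + 1) xx ix (ltNyr x) cp.
exact: isd_of d e.
Qed.

Lemma gauss_cdf_lt x y : x < y -> gauss_cdf x < gauss_cdf y.
Proof.
move=> xy; have [||c _] := @MVT R gauss_cdf pdf x y xy.
- by move=> z _; exact: is_derive_gauss_cdf.
- apply: continuous_subspaceT => z; exact: is_derive_cont (is_derive_gauss_cdf z).
move=> /(canRL (subrK _)) ->; rewrite ltrDr mulr_gt0 ?subr_gt0 //.
rewrite normal_pdfE ?oner_eq0 //; apply: mulr_gt0; last exact: expR_gt0.
by rewrite normal_peak_gt0 ?oner_eq0.
Qed.

Lemma gauss_cdf_itv x : 0 < gauss_cdf x < 1.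
Proof.
have h y : 0 <= gauss_cdf y <= 1.
  by rewrite -!lee_fin -gauss_cdfE measure_ge0 probability_le1.
have := gauss_cdf_lt (_ : x < x + 1); have := gauss_cdf_lt (_ : x - 1 < x).
have := h (x - 1); have := h (x + 1).
rewrite ltrDl ltr01 gtrDl oppr_lt0 ltr01 => /andP[_ h1] /andP[h2 _] /(_ isT) h3 /(_ isT) h4.
by rewrite (le_lt_trans h2 h3) (lt_le_trans h4 h1).
Qed.

Lemma gauss_cdf_le x y : x <= y -> gauss_cdf x <= gauss_cdf y.
Proof. by rewrite le_eqVlt => /orP[/eqP -> //|/gauss_cdf_lt/ltW]. Qed.

Lemma gauss_cdf_onto u : 0 < u < 1 -> exists z, gauss_cdf z = u.
Proof.
move=> /andP[u0 u1].
have ip := integrable_normal_pdf (0 : R) 1.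
have Ny : gauss_cdf x @[x --> -oo] --> 0 := integral_ray_Ny ip.
have y1 : gauss_cdf x @[x --> +oo] --> (1 : R).
  have := integral_ray_y ip; have -> // : (\int[mu]_t pdf t)%R = 1.
  by rewrite /Rintegral integral_normal_pdf.
have [a au] : exists a, gauss_cdf a < u.
  by have /cvgr_lt /(_ _ u0) /filter_ex := Ny.
have [b ub] : exists b, u < gauss_cdf b.
  by have /cvgr_gt /(_ _ u1) /filter_ex := y1.
have ab : a <= b.
  by rewrite leNgt; apply/negP => /gauss_cdf_lt ba; have := lt_trans (lt_trans au ub) ba; rewrite ltxx.
have [||c _ cu] := @IVT R gauss_cdf a b u ab.
- by apply: continuous_subspaceT => z; exact: is_derive_cont (is_derive_gauss_cdf z).
- by rewrite ge_min le_max (ltW au) (ltW ub) orbT.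
- by exists c.
Qed.

Lemma gauss_sublevel u : 0 <= u <= 1 -> N [set z | gauss_cdf z <= u] = u%:E.
Proof.
move=> /andP[u0 u1].
have [u1'|u1'] := eqVneq u 1.
  rewrite (_ : [set _ | _] = setT) ?probability_setT ?u1' //.
  apply/seteqP; split=> z //= _.
  by have /andP[_ /ltW] := gauss_cdf_itv z.
have [u0'|u0'] := eqVneq u 0.
  rewrite (_ : [set _ | _] = set0) ?measure0 ?u0' //.
  apply/seteqP; split=> z //=; rewrite leNgt.
  by have /andP[-> _] := gauss_cdf_itv z.
have u01 : 0 < u < 1 by rewrite lt_neqAle eq_sym u0' u0 lt_neqAle u1' u1.
have [z zu] := gauss_cdf_onto u01.
rewrite -zu -gauss_cdfE; congr N; apply/seteqP; split=> y /=; rewrite in_itv /=.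
  by rewrite leNgt => h; rewrite leNgt; apply: contra h; exact: gauss_cdf_lt.
exact: gauss_cdf_le.
Qed.

Section QuantileTransform.
Context {d : measure_display} {Om : measurableType d} (P : probability Om R).
Variable W : {RV P >-> R}.

Let F x : R := fine (cdf W x).

Let F_le x y : x <= y -> F x <= F y.
Proof. by move=> xy; rewrite fine_le ?fin_num_measure // cdf_nondecreasing. Qed.

Let F_itv x : 0 <= F x <= 1.
Proof. by rewrite fine_ge0 ?cdf_ge0 //= -lee_fin fineK ?fin_num_measure // cdf_le1. Qed.

(** The generalized inverse of the distribution function of [W], composed with the Gaussian one: the
    monotone transport map from N(0,1) to the law of [W]. *)
Definition quantile z : R := inf [set x | gauss_cdf z <= F x].

Let quantile_set z : has_inf [set x | gauss_cdf z <= F x].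
Proof.
have /andP[z0 z1] := gauss_cdf_itv z; split.
  have : F x @[x --> +oo] --> (1 : R) by exact/fine_cvg/cvg_cdfy1.
  by move/cvgr_ge => /(_ _ z1) /filter_ex.
have : F x @[x --> -oo] --> (0 : R) by exact/fine_cvg/cvg_cdfNy0.
move/cvgr_lt => /(_ _ z0) /filter_ex [a az]; exists a => x /= zx.
by rewrite leNgt; apply/negP => xa; have := le_lt_trans (le_trans zx (F_le (ltW xa))) az; rewrite ltxx.
Qed.

(** Right-continuity of [F] makes the infimum attained, which is the direction from left to
    right. *)
Lemma quantile_le z x : (quantile z <= x) = (gauss_cdf z <= F x).
Proof.
apply/idP/idP => [qx|]; last by move=> zx; apply: ge_inf => //; case: (quantile_set z).
have Frc : F y @[y --> x^'+] --> F x.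
  by apply: fine_cvg; rewrite fineK ?fin_num_measure //; exact: cdf_right_continuous.
apply: (cvgr_to_ge Frc); near=> y.
have xy : x < y by near: y; exact: nbhs_right_gt.
have [t zt ty] := inf_lt (proj1 (quantile_set z)) (le_lt_trans qx xy).
exact: le_trans zt (F_le (ltW ty)).
Unshelve. all: end_near. Qed.

Lemma quantile_homo : {homo quantile : x y / x <= y}.
Proof.
move=> x y xy; rewrite quantile_le; apply: le_trans (gauss_cdf_le xy) _.
by rewrite -quantile_le.
Qed.

Lemma measurable_quantile : @measurable_fun _ _ (measurableTypeR R) R setT quantile.
Proof. by apply: nondecreasing_measurable => //; exact: quantile_homo. Qed.

(** By [quantile_le] the preimage of a ray is a sublevel set of [gauss_cdf], whose mass is its
    level; rays determine a law. *)
Lemma quantile_law (A : set R) : measurable A -> N (quantile @^-1` A) = distribution P W A.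
Proof.
pose Qm : {mfun measurableTypeR R >-> R} :=
  @mfun_Sub _ _ (measurableTypeR R) R quantile (mem_set measurable_quantile).
have rayC (nu : probability R R) x : nu `]x, +oo[%classic = (1 - nu `]-oo, x]%classic)%E.
  by rewrite -setCitvl probability_setC.
have law x : distribution N Qm `]-oo, x]%classic = distribution P W `]-oo, x]%classic.
  have -> : distribution N Qm `]-oo, x]%classic = N [set z | gauss_cdf z <= F x].
    by congr N; apply/seteqP; split=> z /=; rewrite in_itv /= quantile_le.
  by rewrite gauss_sublevel // fineK ?fin_num_measure.
move=> mA; rewrite -[LHS]/(distribution N Qm A).
apply: (measure_unique (@RGenOInfty.G R) (fun n => `]- n%:R, +oo[%classic)) => //.
- exact: RGenOInfty.measurableE.
- move=> _ _ [x ->] [y ->]; exists (Num.max x y).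
  apply/seteqP; split=> z /=; rewrite !in_itv /= !andbT gt_max.
    by move=> [-> ->].
  by move=> /andP[].
- by move=> n; exists (- n%:R).
- apply/seteqP; split=> // x _; exists (Num.truncn `|x|).+1 => //=; rewrite in_itv /= andbT ltrNl.
  by rewrite (le_lt_trans (ler_norm _)) // normrN truncnS_gt.
- move=> _ [x ->]; apply: etrans (rayC (distribution N Qm) x) _.
  apply: etrans (congr1 (fun u => (1 - u)%E) (law x)) _.
  by apply/esym; exact: (rayC (distribution P W)).
- by move=> n; apply: le_lt_trans (ltry 1); exact: (@probability_le1 _ _ _ (distribution N Qm)).
Qed.

Lemma quantile_Itg (f : R -> R) : measurable_fun setT f -> Itg P (f \o W) ->
  Itg N (f \o quantile) /\ mean N (f \o quantile) = mean P (f \o W).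
Proof.
move=> mf If.
pose Qm : {mfun measurableTypeR R >-> R} :=
  @mfun_Sub _ _ (measurableTypeR R) R quantile (mem_set measurable_quantile).
have mfE : measurable_fun setT (EFin \o f) by exact/measurable_EFinP.
have IQ : Itg N (f \o quantile).
  apply/integrableP; split.
    by apply/measurable_EFinP; apply: (@measurableT_comp _ _ _ _ _ _ f) => //; exact: measurable_quantile.
  have mfn : measurable_fun setT (fun y => `|(f y)%:E|%E) by exact: measurableT_comp.
  rewrite -(ge0_integral_distribution Qm mfn) //.
  rewrite (@eq_measure_integral _ _ _ setT (distribution P W)); last first.
    by move=> B mB _; exact: quantile_law.
  rewrite (ge0_integral_distribution W mfn) //.
  by case/integrableP: If.
split=> //; apply: EFin_inj; rewrite !EFin_mean //.
rewrite -(integral_distribution (X := Qm) mfE IQ) -(integral_distribution (X := W) mfE If).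
by apply: eq_measure_integral => B mB _; exact: quantile_law.
Qed.

Lemma Wasserstein_quantile (p : R) : Itg N (fun z => `|quantile z - z| `^ p) ->
  (Wasserstein p (distribution P W) N <=
    (mean N (fun z => `|quantile z - z| `^ p) `^ p^-1)%:E)%E.
Proof.
move=> IA.
have mQ : @measurable_fun _ _ (measurableTypeR R) (R * R)%type setT (fun z => (quantile z, z)).
  by apply/measurable_fun_pair => //; exact: measurable_quantile.
pose G : {mfun measurableTypeR R >-> (R * R)%type} :=
  @mfun_Sub _ _ (measurableTypeR R) (R * R)%type (fun z => (quantile z, z)) (mem_set mQ).
have mf : measurable_fun setT (fun z : R * R => (`|z.1 - z.2| `^ p)%:E).
  apply/measurable_EFinP; apply: measurableT_comp (measurable_powR p) _.
  by apply: measurableT_comp => //; exact: measurable_funB.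
apply: ereal_inf_lbound; exists (distribution N G).
  move=> A mA; split; last first.
    by rewrite -[RHS]/(N A); congr N; apply/seteqP; split=> z /=; tauto.
  rewrite -quantile_law // -[RHS]/(N (quantile @^-1` A)).
  by congr N; apply/seteqP; split=> z /=; tauto.
rewrite (ge0_integral_distribution G mf); last by move=> z; rewrite lee_fin powR_ge0.
by rewrite -poweR_EFin; congr poweR; rewrite EFin_mean.
Qed.

End QuantileTransform.

End Quantile.

(** * The test function *)

Section TestFunction.
Context {R : realType}.
Local Notation isd f x d := (is_derive (x : R) (1 : R) (f : R -> R) (d : R)).
Local Notation mu := (@lebesgue_measure R).
Implicit Types (x y z w : R).

Lemma MVT_derive (f f' : R -> R) a b : a < b -> (forall x, a <= x <= b -> isd f x (f' x)) ->
  exists2 c, a < c < b & f b - f a = f' c * (b - a).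
Proof.
move=> ab df; have [||c + cE] := @MVT R f f' a b ab.
- by move=> x; rewrite in_itv /= => /andP[ax xb]; apply: df; rewrite !ltW.
- apply: continuous_in_subspaceT => x; rewrite inE /= in_itv /= => xab.
  exact: is_derive_cont (df x xab).
by rewrite in_itv /= => cab; exists c.
Qed.

Lemma eq_derive_itv (f u v : R -> R) (n : R) : 0 < n ->
  (forall x, `|x| < n -> isd u x (f x)) -> (forall x, `|x| < n -> isd v x (f x)) ->
  u 0 = v 0 -> forall x, `|x| < n -> u x = v x.
Proof.
move=> n0 du dv uv0 x; rewrite ltr_norml => /andP[nx xn].
have d0 y : - n < y < n -> isd (fun y => u y - v y) y 0.
  by move=> yn; rewrite -(subrr (f y)); apply: isdB; [apply: du|apply: dv]; rewrite ltr_norml.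
have [x0|x0|->//] := ltgtP x 0.
- have [|c _] := @MVT_derive (fun y => u y - v y) (fun=> 0) x 0 x0.
    by move=> y /andP[y1 y2]; apply: d0; apply/andP; split; lra.
  by rewrite mul0r uv0 subrr sub0r => /eqP; rewrite oppr_eq0 subr_eq0 => /eqP.
- have [|c _] := @MVT_derive (fun y => u y - v y) (fun=> 0) 0 x x0.
    by move=> y /andP[y1 y2]; apply: d0; apply/andP; split; lra.
  by rewrite mul0r uv0 subrr subr0 => /eqP; rewrite subr_eq0 => /eqP.
Qed.

(** The primitives from [- n], normalized at 0, agree on common intervals and glue together. *)
Lemma primitive_exists (f : R -> R) : continuous f -> exists F, forall x, isd F x (f x).
Proof.
move=> cf.
pose G (n : nat) x := (\int[mu]_(t in `[- n%:R, x]) f t)%R.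
have dG n x : `|x| < n%:R -> isd (fun x => G n x - G n 0) x (f x).
  rewrite ltr_norml => /andP[nx xn]; suff dGx : isd (G n) x (f x).
    by apply: (isd_eq (isdB dGx (isd_cst (G n 0) x))); rewrite subr0.
  have xx : x < x + 1 by rewrite ltrDl.
  have ix : mu.-integrable `[- n%:R, x + 1] (EFin \o f).
    apply: continuous_compact_integrable; first exact: segment_compact.
    by apply: continuous_subspaceT => y; exact: cf.
  have [d e] := @continuous_FTC1_closed R f (- n%:R) x (x + 1) xx ix nx (cf x).
  exact: isd_of d e.
pose N x := (Num.truncn `|x|).+1.
have NP x : `|x| < (N x)%:R by exact: truncnS_gt.
exists (fun x => G (N x) x - G (N x) 0) => x0.
pose M := ((N x0).+1)%N.
apply: (near_eq_is_derive _ (dG M x0 _)); last first.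
  by rewrite (lt_trans (NP x0)) // ltr_nat.
near=> x.
have xM : (N x <= M)%N.
  have x1 : `|x| < `|x0| + 1.
    rewrite -[x](subrK x0) (le_lt_trans (ler_normD _ _)) // addrC ltrD2l distrC.
    by near: x; exact: nbhsx_ballx.
  have x2 : (Num.truncn `|x|)%:R <= `|x| by rewrite truncn_le.
  have : (Num.truncn `|x|)%:R < M%:R :> R.
    by rewrite (le_lt_trans x2) // (lt_trans x1) // /M -natr1 ltrD2r.
  by rewrite ltr_nat.
apply: (@eq_derive_itv f (fun x => G M x - G M 0) (fun y => G (N x) y - G (N x) 0) (N x)%:R).
- by rewrite ltr0n.
- by move=> y yN; apply: dG; rewrite (lt_le_trans yN) // ler_nat.
- by move=> y yN; exact: dG.
- by rewrite !subrr.
- exact: NP.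
Unshelve. all: end_near. Qed.

(** If [|x - y| <= r x / 2], then [r >= |x - y|] between the points and the mean value inequality
    applies. Otherwise [r x] and [r y] are at most 2 and 3 times [|x - y|], and sizes suffice: 5 = 2
    + 3. *)
Lemma holder_of_scale (f f' r : R -> R) (B w : R) :
  0 < w -> w <= 1 -> 0 <= B -> (forall x, 0 < r x) ->
  (forall x y, `|r x - r y| <= `|x - y|) -> (forall x, isd f x (f' x)) ->
  (forall x, `|f x| <= B * r x `^ w) -> (forall x, `|f' x| <= B * r x `^ (w - 1)) ->
  holder w (B * 5) f.
Proof.
move=> w0 w1 B0 r0 r_lip df fB f'B x y.
have [->|xy] := eqVneq x y.
  by rewrite !subrr normr0 mulr_ge0 ?powR_ge0 // mulr_ge0.
have n0 : 0 < `|x - y| by rewrite normr_gt0 subr_eq0.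
have [small|large] := leP `|x - y| (r x / 2).
  rewrite distrC; apply: (@le_trans _ _ (B * `|x - y| `^ (w - 1) * `|y - x|)).
    apply: (mvt_bound df) => z zxy.
    have zx : `|x - z| <= `|x - y|.
      rewrite !ler_norml; move: zxy; rewrite ge_min le_max => /andP[zxy1 zxy2].
      have := ler_norm (x - y); have := ler_norm (y - x); rewrite (distrC y x) => h1 h2.
      by case/orP: zxy1 => ?; case/orP: zxy2 => ?; apply/andP; split; lra.
    apply: (le_trans (f'B z)); rewrite ler_wpM2l // powR_anti ?subr_le0 //.
    have := r_lip x z; rewrite ler_norml => /andP[_ h]; lra.
  rewrite (powR_pred w n0) (distrC y x).
  have : 0 <= B * (`|x - y| * `|x - y| `^ (w - 1)) by rewrite !mulr_ge0 ?powR_ge0.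
  lra.
have ry : r y <= 3 * `|x - y| by have := r_lip x y; rewrite ler_norml => /andP[h _]; lra.
have rx : r x <= 2 * `|x - y| by lra.
have pow_le (a c : R) : 0 < a -> 0 <= c -> a <= c * `|x - y| -> 1 <= c ->
    a `^ w <= c * `|x - y| `^ w.
  move=> a0 c0 ac c1; apply: (@le_trans _ _ ((c * `|x - y|) `^ w)).
    by apply: ge0_ler_powR; rewrite ?nnegrE ?mulr_ge0 ?(ltW a0) ?(ltW w0).
  by rewrite powRM // ler_wpM2r ?powR_ge0 // -[X in _ <= X]powRr1 // ler_powR.
apply: (le_trans (ler_normB _ _)); apply: (le_trans (lerD (fB x) (fB y))).
rewrite -mulrDr -mulrA ler_wpM2l //.
have := pow_le _ 2 (r0 x) (ler0n _ _) rx; have := pow_le _ 3 (r0 y) (ler0n _ _) ry.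
rewrite !ler1n => /(_ isT) h1 /(_ isT) h2; lra.
Qed.

Section Minorant.
Variable D : R -> R.
Hypothesis D_ge0 : forall x, 0 <= D x.

(** The largest 1-Lipschitz function below [D]. The displacement of a monotone map may jump, whereas
    the regularization needs a Lipschitz scale. *)
Definition minorant x : R := inf [set D y + `|x - y| | y in setT].

Let minorant_set x : has_inf [set D y + `|x - y| | y in setT].
Proof.
split; first by exists (D x + `|x - x|), x.
by exists 0 => _ [y _ <-]; rewrite addr_ge0.
Qed.

Lemma minorant_ge x c : (forall y, c <= D y + `|x - y|) -> c <= minorant x.
Proof.
move=> h; apply: lb_le_inf; first by case: (minorant_set x).
by move=> _ [y _ <-].
Qed.

Lemma minorant_le x y : minorant x <= D y + `|x - y|.
Proof. by apply: ge_inf; [case: (minorant_set x)|exists y]. Qed.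

Lemma minorant_le_self x : minorant x <= D x.
Proof. by have := minorant_le x x; rewrite subrr normr0 addr0. Qed.

Lemma minorant_ge0 x : 0 <= minorant x.
Proof. by apply: minorant_ge => y; rewrite addr_ge0. Qed.

Lemma minorant_lip x y : `|minorant x - minorant y| <= `|x - y|.
Proof.
have h u v : minorant u - minorant v <= `|u - v|.
  rewrite lerBlDl -lerBlDr; apply: minorant_ge => t.
  rewrite lerBlDr (le_trans (minorant_le u t)) // -addrA lerD2l addrC.
  by have := ler_normD (u - v) (v - t); rewrite addrA subrK.
by rewrite ler_norml lerNl opprB h distrC h.
Qed.

End Minorant.

Lemma increment_lower (h g : R -> R) a b c1 c2 : a < b -> (forall x, isd h x (g x)) ->
  (forall x, a < x < b -> - c1 <= g x) ->
  (forall x, (b - a) / 4 <= x - a -> (b - a) / 4 <= b - x -> c2 - c1 <= g x) ->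
  c2 * (b - a) / 2 - c1 * (b - a) <= h b - h a.
Proof.
move=> ab dh g1 g2; pose l := (b - a) / 4; have l0 : 0 < l by rewrite divr_gt0 ?subr_gt0.
have [ba lE] : b - a = 4 * l /\ b = a + 4 * l by rewrite /l; split; field.
have [x1 /andP[? ?] e1] := @MVT_derive h g a (a + l) ltac:(lra) (fun x _ => dh x).
have [x2 /andP[? ?] e2] := @MVT_derive h g (a + l) (b - l) ltac:(lra) (fun x _ => dh x).
have [x3 /andP[? ?] e3] := @MVT_derive h g (b - l) b ltac:(lra) (fun x _ => dh x).
have i1 : - c1 * l <= g x1 * l by rewrite ler_pM2r // g1 //; apply/andP; split; lra.
have i3 : - c1 * l <= g x3 * l by rewrite ler_pM2r // g1 //; apply/andP; split; lra.
have i2 : (c2 - c1) * (2 * l) <= g x2 * (2 * l).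
  by apply: ler_wpM2r; [rewrite mulr_ge0 // ltW|apply: g2; rewrite -/l; lra].
have -> : h b - h a = (h b - h (b - l)) + (h (b - l) - h (a + l)) + (h (a + l) - h a) by ring.
have e1' : a + l - a = l by ring.
have e2' : b - l - (a + l) = 2 * l by rewrite lE; ring.
have e3' : b - (b - l) = l by ring.
rewrite e1 e2 e3 e1' e2' e3' ba; lra.
Qed.

Section Displacement.
Variable Q : R -> R.
Hypothesis Q_homo : {homo Q : x y / x <= y}.

Definition displacement_pos x : R := Num.max 0 (Q x - x).
Definition displacement_neg x : R := Num.max 0 (x - Q x).

Lemma displacement_pos_ge0 x : 0 <= displacement_pos x.
Proof. by rewrite /displacement_pos le_max lexx. Qed.

Lemma displacement_neg_ge0 x : 0 <= displacement_neg x.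
Proof. by rewrite /displacement_neg le_max lexx. Qed.

Lemma displacement_le x : displacement_pos x <= `|Q x - x| /\ displacement_neg x <= `|Q x - x|.
Proof. by rewrite /displacement_pos /displacement_neg !ge_max normr_ge0 {2}distrC !ler_norm. Qed.

Let vanish D x : (forall x, 0 <= D x) -> D x = 0 -> minorant D x = 0.
Proof.
by move=> D0 Dx; apply/eqP; rewrite eq_le minorant_ge0 // andbT -Dx minorant_le_self.
Qed.

(** Points [y <= z] are at distance at least [x - z] from [x]. For [y > z] monotonicity gives
    [Q y >= Q z], so displacement plus distance is at least [Q z - x]; for the same reason the
    displacement at [x] is not negative. *)
Lemma minorant_right z x : z < x < Q z ->
  Num.min (x - z) (Q z - x) <= minorant displacement_pos x /\ minorant displacement_neg x = 0.
Proof.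
move=> /andP[zx xQ]; split; last first.
  apply: vanish; first exact: displacement_neg_ge0.
  by have := Q_homo (ltW zx); rewrite /displacement_neg => h; apply/max_idPl; lra.
apply: minorant_ge => [|y]; first exact: displacement_pos_ge0.
have d0 := displacement_pos_ge0 y; have n1 := ler_norm (x - y).
rewrite ge_min; have [yz|zy] := leP y z; apply/orP; [left; lra|right].
have d1 : Q y - y <= displacement_pos y by rewrite le_max lexx orbT.
by have := Q_homo (ltW zy); have := ler_norm (y - x); rewrite (distrC y x); lra.
Qed.

Lemma minorant_left z x : Q z < x < z ->
  Num.min (z - x) (x - Q z) <= minorant displacement_neg x /\ minorant displacement_pos x = 0.
Proof.
move=> /andP[Qx xz]; split; last first.
  apply: vanish; first exact: displacement_pos_ge0.
  by have := Q_homo (ltW xz); rewrite /displacement_pos => h; apply/max_idPl; lra.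
apply: minorant_ge => [|y]; first exact: displacement_neg_ge0.
have d0 := displacement_neg_ge0 y; have n1 := ler_norm (y - x); rewrite (distrC y x) in n1.
rewrite ge_min; have [zy|yz] := leP z y; apply/orP; [left; lra|right].
have d1 : y - Q y <= displacement_neg y by rewrite le_max lexx orbT.
by have := Q_homo (ltW yz); have := ler_norm (x - y); lra.
Qed.

End Displacement.

(* [h'] is the difference of the regularized powers of the two one-sided
   displacements, made Lipschitz by [minorant] and shifted by [e]. Between [z]
   and [Q z] one minorant vanishes and the other is at least the distance to the
   endpoints. *)
Lemma test_function (k : nat) w : (1 < k)%N -> 0 < w -> w <= 1 ->
  let p := k%:R - 1 + w in
  exists C c : R, [/\ 0 < C, 0 < c & forall (Q : R -> R) (e : R), {homo Q : x y / x <= y} -> 0 < e ->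
    exists F, [/\ deriv_chain k.-1 F, holder w C (F k.-1),
      forall j x, (0 < j < k)%N -> `|F j x| <= C * (`|Q x - x| + e) `^ (p - j%:R) &
      forall z, c * `|Q z - z| `^ p - C * e `^ (p - 1) * `|Q z - z| <= F 0%N (Q z) - F 0%N z]].
Proof.
case: k => [//|[//|k]] _ w0 w1 p.
have pE : p = k%:R + 1 + w by rewrite /p -!natr1; ring.
clearbody p; pose m := k.+1.
have [a aE] : exists a, a = p - 1 by exists (p - 1).
have k0 : 0 <= k%:R :> R by [].
have a0 : 0 < a by rewrite aE pE; lra.
have cst0 j : (j <= m)%N -> 0 < 2 * regularization_cst m a j.
  by move=> jm; rewrite mulr_gt0 // regularization_cst_gt0.
have [B Bj] : exists B, forall j, (j <= m)%N -> 2 * regularization_cst m a j <= B.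
  exists (\sum_(j < m.+1) 2 * regularization_cst m a j) => j jm.
  rewrite (bigD1 (Ordinal (jm : (j < m.+1)%N))) //= lerDl sumr_ge0 // => i _.
  by rewrite ltW // cst0 // -ltnS.
have B0 : 0 < B by rewrite (lt_le_trans (cst0 0%N _) (Bj 0%N _)).
pose cl := regularization_low_cst m a; have cl0 : 0 < cl := regularization_low_cst_gt0 m a.
(* [10 B] adds the Hölder constants [5 B] of the two regularized powers. On the middle half of the
   interval between [z] and [Q z], of length [L], the minorant is at least [L / 4], which yields
   [cl (L / 4)^a L / 2]. *)
exists (10 * B), (cl / (2 * 4 `^ a)); split.
- by rewrite mulr_gt0.
- by rewrite divr_gt0 // mulr_gt0 // powR_gt0.
move=> Q e Qh e0.
pose rp x := minorant (displacement_pos Q) x + e.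
pose rm x := minorant (displacement_neg Q) x + e.
have rp0 x : 0 < rp x by rewrite ltr_wpDl // minorant_ge0 //; exact: displacement_pos_ge0.
have rm0 x : 0 < rm x by rewrite ltr_wpDl // minorant_ge0 //; exact: displacement_neg_ge0.
have rp_lip x y : `|rp x - rp y| <= `|x - y|.
  by rewrite /rp opprD addrACA subrr addr0 minorant_lip //; exact: displacement_pos_ge0.
have rm_lip x y : `|rm x - rm y| <= `|x - y|.
  by rewrite /rm opprD addrACA subrr addr0 minorant_lip //; exact: displacement_neg_ge0.
have rp_le x : rp x <= `|Q x - x| + e.
  rewrite lerD2r (le_trans (minorant_le_self _ _)) //; first exact: displacement_pos_ge0.
  by have [] := displacement_le Q x.
have rm_le x : rm x <= `|Q x - x| + e.
  rewrite lerD2r (le_trans (minorant_le_self _ _)) //; first exact: displacement_neg_ge0.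
  by have [] := displacement_le Q x.
pose wp := regularization m a rp; pose wm := regularization m a rm.
have wp_bd j x : (j <= m)%N -> `|wp j x| <= B * rp x `^ (a - j%:R).
  by move=> jm; rewrite (le_trans (regularization_bound a rp0 rp_lip x jm)) // ler_wpM2r ?powR_ge0 // Bj.
have wm_bd j x : (j <= m)%N -> `|wm j x| <= B * rm x `^ (a - j%:R).
  by move=> jm; rewrite (le_trans (regularization_bound a rm0 rm_lip x jm)) // ler_wpM2r ?powR_ge0 // Bj.
have wp_chain : deriv_chain m wp := regularization_chain a rp0 rp_lip.
have wm_chain : deriv_chain m wm := regularization_chain a rm0 rm_lip.
have wp_low x : cl * rp x `^ a <= wp 0%N x := regularization_low m a rp0 rp_lip x.
have wm_low x : cl * rm x `^ a <= wm 0%N x := regularization_low m a rm0 rm_lip x.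
clearbody cl wp wm.
pose g x := wp 0%N x - wm 0%N x.
have cg : continuous g.
  by move=> x; apply: is_derive_cont (isdB (wp_chain 0%N x isT) (wm_chain 0%N x isT)).
have [h dh] := primitive_exists cg.
pose F j := if j is i.+1 then (fun x => wp i x - wm i x) else h.
exists F; split.
- case=> [|j] x jm; first exact: dh.
  by apply: isdB; [apply: wp_chain|apply: wm_chain]; exact: ltnW.
- have ak : a - k%:R = w by rewrite aE pE; ring.
  have ak1 : a - k.+1%:R = w - 1 by rewrite -natr1 -ak; ring.
  have hp : holder w (B * 5) (wp k).
    apply: (@holder_of_scale _ (wp k.+1) rp) => // [|x|x|x]; first exact: ltW.
    + exact: wp_chain.
    + by rewrite -ak wp_bd.
    + by rewrite -ak1 wp_bd.
  have hm : holder w (B * 5) (wm k).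
    apply: (@holder_of_scale _ (wm k.+1) rm) => // [|x|x|x]; first exact: ltW.
    + exact: wm_chain.
    + by rewrite -ak wm_bd.
    + by rewrite -ak1 wm_bd.
  move=> x y /=; have -> : wp k x - wm k x - (wp k y - wm k y) = (wp k x - wp k y) - (wm k x - wm k y) by ring.
  by apply: (le_trans (ler_normB _ _)); have := hp x y; have := hm x y; lra.
- move=> [//|j] x jk /=; have jm : (j <= m)%N by exact: ltnW.
  have jk' : 0 <= a - j%:R.
    by rewrite aE pE; have : j%:R <= k%:R :> R by [rewrite ler_nat]; lra.
  have -> : p - j.+1%:R = a - j%:R by rewrite aE -natr1; ring.
  have pow r : 0 < r -> r <= `|Q x - x| + e -> r `^ (a - j%:R) <= (`|Q x - x| + e) `^ (a - j%:R).
    by move=> r0 rle; apply: ge0_ler_powR; rewrite ?nnegrE // ltW // (lt_le_trans r0).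
  apply: (le_trans (ler_normB _ _)).
  have h1 := le_trans (wp_bd j x jm) (ler_wpM2l (ltW B0) (pow _ (rp0 x) (rp_le x))).
  have h2 := le_trans (wm_bd j x jm) (ler_wpM2l (ltW B0) (pow _ (rm0 x) (rm_le x))).
  have h3 : 0 <= B * (`|Q x - x| + e) `^ (a - j%:R) by rewrite mulr_ge0 ?powR_ge0 // ltW.
  by apply: (le_trans (lerD h1 h2)); lra.
- move=> z; rewrite -aE.
  have low (r : R -> R) (j : nat -> R -> R) L x : 0 < L -> L / 4 <= r x ->
      cl * r x `^ a <= j 0%N x -> cl * (L / 4) `^ a <= j 0%N x.
    move=> L0 Lr; apply: le_trans; rewrite ler_wpM2l ?(ltW cl0) //.
    have L4 : 0 <= L / 4 by rewrite divr_ge0 // ltW.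
    by apply: ge0_ler_powR; rewrite ?nnegrE ?(ltW a0) // (le_trans L4).
  have fin L : 0 < L -> cl / (2 * 4 `^ a) * L `^ p - 10 * B * e `^ a * L <=
      cl * (L / 4) `^ a * L / 2 - B * e `^ a * L.
    move=> L0; have -> : cl / (2 * 4 `^ a) * L `^ p = cl * (L / 4) `^ a * L / 2.
      rewrite (powR_pred p L0) -aE powRM ?(ltW L0) ?invr_ge0 //.
      have -> : (4^-1 : R) `^ a = (4 `^ a)^-1 by rewrite -powRN -mulN1r powRrM powR_inv1.
      by field; rewrite gt_eqF // powR_gt0.
    have : 0 <= B * e `^ a * L by rewrite !mulr_ge0 ?powR_ge0 ?(ltW B0) ?(ltW L0).
    lra.
  have [zQ|Qz|Qz] := ltgtP z (Q z).
  + have L0 : 0 < Q z - z by rewrite subr_gt0.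
    rewrite (gtr0_norm L0) (le_trans (fin _ L0)) //.
    (* Where the other minorant vanishes its scale is [e], so the regularized power subtracted there
       costs at most [B e^a]. *)
    have gx x : z < x < Q z -> - (B * e `^ a) + cl * rp x `^ a <= g x.
      move=> /(minorant_right Qh)[_ rm0x].
      have h1 := wp_low x.
      have h2 := le_trans (ler_norm _) (wm_bd 0%N x isT).
      by move: h2; rewrite /rm rm0x add0r subr0 /g; lra.
    apply: (increment_lower zQ dh).
      by move=> x /gx; have : 0 <= cl * rp x `^ a by [rewrite mulr_ge0 ?powR_ge0 // ltW]; lra.
    move=> x x1 x2; have zxQ : z < x < Q z by apply/andP; split; lra.
    have [mn _] := minorant_right Qh zxQ.
    have r4 : (Q z - z) / 4 <= rp x.
      have : (Q z - z) / 4 <= Num.min (x - z) (Q z - x) by rewrite le_min x1 x2.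
      by rewrite /rp; lra.
    have := low rp (fun _ x => cl * rp x `^ a) _ x L0 r4 (lexx _).
    by have := gx x zxQ; lra.
  + have L0 : 0 < z - Q z by rewrite subr_gt0.
    rewrite distrC (gtr0_norm L0) (le_trans (fin _ L0)) //.
    have gx x : Q z < x < z -> - (B * e `^ a) + cl * rm x `^ a <= - g x.
      move=> /(minorant_left Qh)[_ rp0x].
      have h1 := wm_low x.
      have h2 := le_trans (ler_norm _) (wp_bd 0%N x isT).
      by move: h2; rewrite /rp rp0x add0r subr0 /g; lra.
    have -> : F 0%N (Q z) - F 0%N z = - h z - - h (Q z) by rewrite /F; ring.
    apply: (increment_lower Qz (fun x => isdN (dh x))).
      by move=> x /gx; have : 0 <= cl * rm x `^ a by [rewrite mulr_ge0 ?powR_ge0 // ltW]; lra.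
    move=> x x1 x2; have zxQ : Q z < x < z by apply/andP; split; lra.
    have [mn _] := minorant_left Qh zxQ.
    have r4 : (z - Q z) / 4 <= rm x.
      have : (z - Q z) / 4 <= Num.min (z - x) (x - Q z) by rewrite le_min x1 x2.
      by rewrite /rm; lra.
    have := low rm (fun _ x => cl * rm x `^ a) _ x L0 r4 (lexx _).
    by have := gx x zxQ; lra.
  + have p0 : p != 0 by rewrite gt_eqF // pE; lra.
    by rewrite -Qz !subrr normr0 powR0 // !mulr0 subrr.
Qed.

End TestFunction.

(** * The Wasserstein bound *)

Section WassersteinBound.
Context {R : realType}.
Local Notation N := (normal_prob (0 : R) (1 : R)).
Implicit Types (x y z w e t a b c p C U del : R).

Lemma powR_natM x (j : nat) a : 0 < x -> x ^+ j * x `^ (a - j%:R) = x `^ a.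
Proof.
move=> x0; rewrite -powR_mulrn ?(ltW x0) // -powRD; last by rewrite (gt_eqF x0) implybT.
by rewrite addrC subrK.
Qed.

Lemma powRD_le a b p : 0 <= a -> 0 <= b -> 0 <= p -> (a + b) `^ p <= 2 `^ p * (a `^ p + b `^ p).
Proof.
move=> a0 b0 p0; pose c := Num.max a b.
have c0 : 0 <= c by rewrite le_max a0.
have abc : a + b <= 2 * c.
  by have : a <= c /\ b <= c by [rewrite !le_max !lexx orbT]; case; lra.
apply: (@le_trans _ _ ((2 * c) `^ p)).
  by apply: ge0_ler_powR; rewrite ?nnegrE ?addr_ge0 ?mulr_ge0.
rewrite powRM // ler_wpM2l ?powR_ge0 // /c; case: (leP a b) => _.
  by rewrite lerDr powR_ge0.
by rewrite lerDl powR_ge0.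
Qed.

(** If [e U <= del t], the first term dominates. Otherwise [t] is below [s = e U / del], the
    left-hand side is at most [s^p], and [U / del >= 1] allows the exponent [p] to be raised to
    [k]. *)
Lemma young_split (j k : nat) p e t U del : (0 < j)%N -> (j%:R <= p) -> (p <= k%:R) ->
  0 < e -> 0 < t -> 1 <= U -> 0 < del -> del <= 1 ->
  e ^+ j * U * t `^ (p - j%:R) <= del * t `^ p + e `^ p * (U / del) ^+ k.
Proof.
move=> j0 jp pk e0 t0 U1 d0 d1.
have U0 : 0 < U by exact: lt_le_trans U1.
have UU : U <= U ^+ j by rewrite -[X in X <= _]expr1 ler_weXn2l.
have eU : e ^+ j * U <= (e * U) ^+ j by rewrite exprMn ler_wpM2l // exprn_ge0 // ltW.
have ep : 0 <= e `^ p * (U / del) ^+ k.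
  by rewrite mulr_ge0 ?powR_ge0 // exprn_ge0 // divr_ge0 ?ltW.
have [h|h] := leP (e * U) (del * t).
  apply: (@le_trans _ _ (del * t `^ p)); last by rewrite lerDl.
  rewrite -(powR_natM j p t0) mulrA ler_wpM2r ?powR_ge0 // (le_trans eU) //.
  apply: (@le_trans _ _ ((del * t) ^+ j)).
    by apply: lerXn2r; rewrite ?nnegrE ?mulr_ge0 ?(ltW e0) ?(ltW U0) ?(ltW d0) ?(ltW t0).
  rewrite exprMn ler_wpM2r ?exprn_ge0 ?(ltW t0) //.
  by rewrite -[X in _ <= X]expr1 ler_wiXn2l // ltW.
set s := e * U / del; have s0 : 0 < s by rewrite divr_gt0 ?mulr_gt0.
have ts : t <= s by rewrite /s ler_pdivlMr // mulrC ltW.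
apply: (@le_trans _ _ (s `^ p)); last first.
  have -> : s = e * (U / del) by rewrite /s mulrA.
  have Ud : 1 <= U / del by rewrite ler_pdivlMr // mul1r (le_trans d1).
  rewrite powRM ?divr_ge0 ?(ltW e0) ?(ltW U0) ?(ltW d0) //.
  apply: (@le_trans _ _ (e `^ p * (U / del) ^+ k)); last first.
    by rewrite lerDr mulr_ge0 ?powR_ge0 // ltW.
  rewrite ler_wpM2l ?powR_ge0 // -powR_mulrn ?divr_ge0 ?(ltW U0) ?(ltW d0) //.
  by rewrite ler_powR.
rewrite -(powR_natM j p s0); apply: ler_pM.
- by rewrite mulr_ge0 ?exprn_ge0 // ltW.
- by rewrite powR_ge0.
- apply: (le_trans eU); apply: lerXn2r; rewrite ?nnegrE ?mulr_ge0 ?(ltW e0) ?(ltW U0) ?invr_ge0 ?(ltW d0) //.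
  by rewrite /s ler_pdivlMr // ler_piMr // mulr_ge0 // ltW.
- by apply: ge0_ler_powR; rewrite ?nnegrE ?subr_ge0 // ltW.
Qed.

(** The left-hand side equals [c / 2 * t^p] at [t = M e]; above this threshold the first term
    dominates, below it the second. *)
Lemma young_linear p c C : 1 < p -> 0 < c -> 0 < C -> exists C', 0 < C' /\ forall e t,
  0 < e -> 0 <= t -> C * e `^ (p - 1) * t <= c / 2 * t `^ p + C' * e `^ p.
Proof.
move=> p1 c0 C0; have p10 : 0 < p - 1 by rewrite subr_gt0.
pose M := (2 * C / c) `^ (p - 1)^-1.
have M0 : 0 < M by rewrite powR_gt0 // divr_gt0 // mulr_gt0.
have Mp : M `^ (p - 1) = 2 * C / c.
  by rewrite -powRrM mulVf ?gt_eqF // powRr1 // divr_ge0 ?mulr_ge0 ?ltW.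
exists (C * M); split; first by rewrite mulr_gt0.
move=> e t e0 t0; have [h|h] := leP t (M * e).
  apply: (@le_trans _ _ (C * M * e `^ p)); last first.
    by rewrite lerDr mulr_ge0 ?powR_ge0 // divr_ge0 // ltW.
  rewrite (powR_pred p e0).
  have := ler_wpM2l (mulr_ge0 (ltW C0) (powR_ge0 e (p - 1))) h; lra.
have t0' : 0 < t by rewrite (le_lt_trans _ h) // mulr_ge0 // ltW.
apply: (@le_trans _ _ (c / 2 * t `^ p)); last first.
  by rewrite lerDl !mulr_ge0 ?powR_ge0 // ltW.
have : (M * e) `^ (p - 1) <= t `^ (p - 1).
  by apply: ge0_ler_powR; rewrite ?nnegrE ?mulr_ge0 // ltW.
rewrite powRM ?(ltW M0) ?(ltW e0) // Mp (powR_pred p t0') => h2.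
have := ler_wpM2r (ltW t0') (ler_wpM2l (_ : 0 <= c / 2) h2); rewrite divr_ge0 ?(ltW c0) // => /(_ isT).
have -> : c / 2 * (2 * C / c * e `^ (p - 1)) * t = C * e `^ (p - 1) * t by field; rewrite gt_eqF.
lra.
Qed.

Lemma coef_bound d (Om : measurableType d) (P : probability Om R) W K k w D e s :
  0 <= D -> 0 <= e -> stein_expansion P W K k w D e -> all (leq 1) s -> (sumn s < k)%N ->
  `|expansion_coef K s| <= D ^+ size s * e ^+ sumn s.
Proof.
move=> D0 e0 SE hs sk; rewrite /expansion_coef normrM normrX normrN normr1 expr1n mul1r.
elim: s hs sk => [|a s IH] /=; first by rewrite big_nil normr1 !expr0 mul1r.
move=> /andP[a1 hs] sk; rewrite big_cons normrM exprS exprD.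
have h1 : `|K (a + 2)%N / (a + 1)`!%:R| <= D * e ^+ a.
  rewrite normrM normfV (ger0_norm (ler0n _ _)); apply: (@le_trans _ _ (`|K (a + 2)%N|)).
    by rewrite ler_pdivrMr ?ltr0n ?fact_gt0 // ler_peMr // ler1n fact_gt0.
  by apply: (cumulant_small SE); rewrite a1 (leq_ltn_trans _ sk) // leq_addr.
have h2 := IH hs (leq_ltn_trans (leq_addl _ _) sk).
by apply: (le_trans (ler_pM _ _ h1 h2)) => //; rewrite le_eqVlt; apply/orP; left; apply/eqP; ring.
Qed.

(** Duality followed by [young_split] at every point, with [U = 1 + |q|]. [M] is the Gaussian mean
    of [(U / del)^k], so it depends on neither [F], [t] nor [e]; [t] will be [|Q x - x| + e]. *)
Lemma Theta_comp_bound (k : nat) w C del : (0 < k)%N -> 0 < w -> w <= 1 -> 0 <= C -> 0 < del -> del <= 1 ->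
  let p := k%:R - 1 + w in
  forall s, all (leq 1) s -> (0 < size s)%N -> (sumn s < k)%N -> exists M, 0 <= M /\
  forall F (t : R -> R) e, 0 < e -> (forall x, 0 < t x) -> Itg N (fun x => t x `^ p) ->
    deriv_chain k.-1 F -> (forall i, (i < k)%N -> poly_growth (F i)) ->
    (forall j x, (0 < j < k)%N -> `|F j x| <= C * t x `^ (p - j%:R)) ->
    e ^+ sumn s * `|gauss_mean (Theta_comp s (F 0%N))| <=
      C * (del * mean N (fun x => t x `^ p) + M * e `^ p).
Proof.
move=> k0 w0 w1 C0 d0 d1 p s hs s0 sk.
have sum0 : (0 < sumn s)%N by case: s hs s0 sk => //= a s /andP[a1 _] _ _; rewrite addn_gt0 a1.
have [q hq] := Theta_comp_dual hs 0%N (1 : {poly R}).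
pose U x := 1 + `|q.[x]|.
have pU : poly_growth U.
  apply: poly_growthD; first exact: poly_growth_cst.
  by apply: poly_growth_norm; exact: poly_growth_horner.
have pUk : poly_growth (fun x => (U x / del) ^+ k).
  have pUd : poly_growth (fun x => U x / del).
    by rewrite (_ : (fun x => _) = (fun x => del^-1 * U x)); [exact: poly_growthZ|apply/funext => x; rewrite mulrC].
  elim: (k) => [|n IH].
    by rewrite (_ : (fun x => _) = (fun=> 1)); [exact: poly_growth_cst|apply/funext => x; rewrite expr0].
  rewrite (_ : (fun x => _) = (fun x => (U x / del) * (U x / del) ^+ n)); first exact: poly_growthM.
  by apply/funext => x; rewrite exprS.
exists (mean N (fun x => (U x / del) ^+ k)); split.
  by apply: mean_ge0 => x; apply/exprn_ge0/divr_ge0; [exact: addr_ge0|exact: ltW].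
move=> F t e e0 t0 It dF pF FC.
have Fq : gauss_mean (Theta_comp s (F 0%N)) = mean N (fun x => q.[x] * F (sumn s) x).
  rewrite -[sumn s]add0n -(hq _ _ _ dF) ?add0n //.
  - by apply: eq_mean => x; rewrite hornerC mul1r.
  - by rewrite -ltnS prednK.
  - by move=> i ik; apply: pF; rewrite -(prednK k0).
have pqF : poly_growth (fun x => q.[x] * F (sumn s) x).
  by apply: poly_growthM; [exact: poly_growth_horner|exact: pF].
have IqF := poly_growth_Itg pqF.
have IU : Itg N (fun x => (U x / del) ^+ k) := poly_growth_Itg pUk.
rewrite Fq -[X in X * _](ger0_norm (exprn_ge0 _ (ltW e0))) -normrM -(meanZ _ IqF).
have -> : C * (del * mean N (fun x => t x `^ p) + mean N (fun x => (U x / del) ^+ k) * e `^ p) =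
    mean N (fun x => C * (del * t x `^ p + e `^ p * (U x / del) ^+ k)).
  rewrite meanZ; last by apply: ItgD; apply: ItgZ.
  by rewrite meanD ?meanZ //; [rewrite [_ * e `^ p]mulrC|exact: ItgZ|exact: ItgZ].
apply: mean_bound.
- exact: ItgZ.
- by apply: ItgZ; apply: ItgD; apply: ItgZ.
move=> x; have jk : (0 < sumn s < k)%N by rewrite sum0.
have jp : (sumn s)%:R <= p.
  rewrite /p; have : (sumn s)%:R <= k%:R - 1 :> R by rewrite lerBrDr natr1 ler_nat.
  by lra.
have pk : p <= k%:R by rewrite /p; lra.
have U1 : 1 <= U x by rewrite /U lerDl.
have Y := young_split sum0 jp pk e0 (t0 x) U1 d0 d1.
apply: (@le_trans _ _ (C * (e ^+ sumn s * U x * t x `^ (p - (sumn s)%:R)))); last first.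
  by rewrite ler_wpM2l.
rewrite !normrM (ger0_norm (exprn_ge0 _ (ltW e0))).
have h := FC (sumn s) x jk.
have qU : `|q.[x]| <= U x by rewrite /U lerDr.
have h3 := ler_pM (normr_ge0 _) (normr_ge0 _) qU h.
have h4 := ler_wpM2l (exprn_ge0 (sumn s) (ltW e0)) h3.
by apply: (le_trans h4); rewrite le_eqVlt; apply/orP; left; apply/eqP; ring.
Qed.

Lemma Wasserstein_bound (k : nat) w D : (1 < k)%N -> 0 < w -> w <= 1 -> 0 <= D ->
  let p := k%:R - 1 + w in
  exists C, 0 <= C /\ forall d (Om : measurableType d) (P : probability Om R)
    (W : {RV P >-> R}) K e, 0 < e -> stein_expansion P W K k w D e ->
    Itg P (fun om => `|W om| `^ p) ->
    (Wasserstein p (distribution P W) N <= (C * e)%:E)%E.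
Proof.
move=> k1 w0 w1 D0 p.
have k0 : (0 < k)%N by exact: ltnW.
have k2 : 2 <= k%:R :> R by rewrite ler_nat.
have p1 : 1 < p by rewrite /p; lra.
have p0 : 0 < p by exact: lt_trans p1.
have [C [c [C0 c0 TF]]] := test_function k1 w0 w1.
have [C' [C'0 YL]] := young_linear p1 c0 C0.
have kk : (k.-1 < k)%N by rewrite prednK.
have [Ce [Ce0 EB]] := expansion_bound w0 w1 D0 (leqnn k.-1) kk.
pose S := [seq t <- tuples k.-1 k.-1 | t != [::]].
have SP s : s \in S -> [/\ all (leq 1) s, (0 < size s)%N & (sumn s < k)%N].
  rewrite mem_filter mem_tuples => /andP[sn /and3P[hs ss _]]; split=> //.
    by rewrite lt0n size_eq0.
  by rewrite -(prednK k0) ltnS.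
have SE (f : seq nat -> R) : \sum_(t <- tuples k.-1 k.-1) f t = f [::] + \sum_(t <- S) f t.
  by rewrite big_filter (bigD1_seq [::]) ?uniq_tuples //= mem_tuples.
pose G1 := \sum_(s <- S) D ^+ size s * C.
have G10 : 0 <= G1 by rewrite sumr_ge0 // => s _; rewrite mulr_ge0 ?exprn_ge0 // ltW.
(* All expansion terms together then contribute at most [c / 4] times [A], up to [O(e^p)], which is
   half of the lower bound [c / 2 * A]. The factor [2^p] comes from splitting
   [(|Q x - x| + e)^p]. *)
pose del := Num.min 1 (c / (4 * (G1 * 2 `^ p + 1))).
have G1p : 0 <= G1 * 2 `^ p by rewrite mulr_ge0 // powR_ge0.
have del0 : 0 < del by rewrite lt_min ltr01 divr_gt0 // mulr_gt0 // ltr_wpDl.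
have del1 : del <= 1 by rewrite ge_min lexx.
have delG : G1 * (del * 2 `^ p) <= c / 4.
  have h : del <= c / (4 * (G1 * 2 `^ p + 1)) by rewrite ge_min lexx orbT.
  have h2 : 0 < G1 * 2 `^ p + 1 by rewrite ltr_wpDl.
  apply: (@le_trans _ _ (c / (4 * (G1 * 2 `^ p + 1)) * (G1 * 2 `^ p + 1))).
    rewrite mulrCA; apply: ler_pM => //; first exact: ltW.
    by rewrite lerDl.
  by rewrite le_eqVlt; apply/orP; left; apply/eqP; field; rewrite gt_eqF.
have Mex (s : seq nat) : exists M, 0 <= M /\ (s \in S -> forall F (t : R -> R) e,
    0 < e -> (forall x, 0 < t x) -> Itg N (fun x => t x `^ p) ->
    deriv_chain k.-1 F -> (forall i, (i < k)%N -> poly_growth (F i)) ->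
    (forall j x, (0 < j < k)%N -> `|F j x| <= C * t x `^ (p - j%:R)) ->
    e ^+ sumn s * `|gauss_mean (Theta_comp s (F 0%N))| <=
      C * (del * mean N (fun x => t x `^ p) + M * e `^ p)).
  have [sS|sS] := boolP (s \in S); last by exists 0.
  have [hs ss sk] := SP s sS.
  have [Ms [Ms0 hM]] := Theta_comp_bound k0 w0 w1 (ltW C0) del0 del1 hs ss sk.
  by exists Ms.
have [M MP] := choice Mex.
pose G2 := \sum_(s <- S) D ^+ size s * (C * M s).
have G20 : 0 <= G2.
  by rewrite sumr_ge0 // => s _; rewrite mulr_ge0 ?exprn_ge0 // mulr_ge0 ?(ltW C0) //; case: (MP s).
pose C5 := 4 / c * (C' + Ce * C + c / 4 + G2).
have C50 : 0 <= C5.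
  by rewrite mulr_ge0 ?divr_ge0 ?addr_ge0 ?divr_ge0 ?mulr_ge0 ?(ltW c0) ?(ltW C0) ?(ltW C'0).
exists (C5 `^ p^-1); split; first exact: powR_ge0.
move=> d Om P W K e e0 SW IW.
pose Q := quantile W.
have Qh : {homo Q : x y / x <= y} := quantile_homo W.
have [F [dF hF FC Fz]] := TF Q e Qh e0.
have pF i : (i < k)%N -> poly_growth (F i).
  by move=> ik; apply: (chain_poly_growth w0 dF hF); rewrite -ltnS prednK.
have mpow : measurable_fun setT (fun x => `|x| `^ p).
  by apply: measurableT_comp (measurable_powR p) _; exact: normr_measurable.
have [IQp _] := quantile_Itg mpow IW.
have Ixp : Itg N (fun x => `|x| `^ p).
  apply: (@Itg_le _ _ _ N _ (fun x => (1 + `|x|) ^+ k)) => [|x|].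
  - exact: mpow.
  - rewrite ger0_norm ?powR_ge0 // (@le_trans _ _ ((1 + `|x|) `^ p)) //.
      by apply: ge0_ler_powR; rewrite ?nnegrE ?(ltW p0) ?lerDr ?addr_ge0.
    by rewrite -powR_mulrn ?addr_ge0 // ler_powR ?lerDl // /p; lra.
  - apply: poly_growth_Itg; apply: (@poly_growth_le _ _ 1 k).
      move=> x; apply: (@continuous_comp _ _ _ (fun x => 1 + `|x|) (fun y => y ^+ k)); last exact: exprn_continuous.
      by apply: cvgD; [exact: cvg_cst|exact: norm_continuous].
    by move=> x; rewrite mul1r ger0_norm // exprn_ge0 // addr_ge0.
have mQ : measurable_fun (setT : set (measurableTypeR R)) Q := measurable_quantile W.
have mQx : measurable_fun (setT : set (measurableTypeR R)) (fun x => `|Q x - x|).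
  by apply: measurableT_comp => //; exact: measurable_funB.
have IA : Itg N (fun x => `|Q x - x| `^ p).
  apply: (@Itg_le _ _ _ N _ (fun x => 2 `^ p * (`|Q x| `^ p + `|x| `^ p))) => [|x|].
  - exact: measurableT_comp (measurable_powR p) mQx.
  - rewrite ger0_norm ?powR_ge0 //; apply: le_trans (powRD_le _ _ _) => //; last exact: ltW.
    by apply: ge0_ler_powR; rewrite ?nnegrE ?(ltW p0) ?ler_normB ?addr_ge0.
  - by apply: ItgZ; exact: ItgD.
set A := mean N (fun x => `|Q x - x| `^ p).
pose t x := `|Q x - x| + e.
have t0 x : 0 < t x by rewrite ltr_wpDl.
have tle x : t x `^ p <= 2 `^ p * (`|Q x - x| `^ p + e `^ p) by apply: powRD_le => //; exact: ltW.
have Ig : Itg N (fun x => 2 `^ p * (`|Q x - x| `^ p + e `^ p)).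
  by apply: ItgZ; apply: ItgD => //; exact: Itg_cst.
have It : Itg N (fun x => t x `^ p).
  apply: (Itg_le _ _ Ig).
    by apply: measurableT_comp (measurable_powR p) _; exact: measurable_funD.
  by move=> x; rewrite ger0_norm ?powR_ge0.
have tA : mean N (fun x => t x `^ p) <= 2 `^ p * (A + e `^ p).
  apply: (le_trans (mean_le It Ig tle)).
  by rewrite meanZ ?meanD ?mean_cst //; [exact: Itg_cst|apply: ItgD => //; exact: Itg_cst].
have ep0 : 0 <= e `^ p by exact: powR_ge0.
have A0 : 0 <= A by apply: mean_ge0 => x; exact: powR_ge0.
have IFW : Itg P (F 0%N \o W) := stein_Itg SW (leq_pred k) dF hF (leq0n _).
have mF0 : measurable_fun setT (F 0%N) by apply: continuous_measurable_fun; case: (pF 0%N k0).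
have [IFQ FQ] := quantile_Itg mF0 IFW.
have IF0 : Itg N (F 0%N) := poly_growth_Itg (pF 0%N k0).
have low : c / 2 * A - C' * e `^ p <= mean P (F 0%N \o W) - gauss_mean (F 0%N).
  rewrite -FQ -(meanB IFQ IF0).
  have -> : c / 2 * A - C' * e `^ p = mean N (fun x => c / 2 * `|Q x - x| `^ p - C' * e `^ p).
    by rewrite meanB ?mean_cst ?meanZ //; [exact: ItgZ|exact: Itg_cst].
  apply: mean_le.
  - by apply: ItgB; [exact: ItgZ|exact: Itg_cst].
  - exact: ItgB.
  - move=> x; have := Fz x; have := YL e `|Q x - x| e0 (normr_ge0 _); rewrite -/p /=; lra.
have up : mean P (F 0%N \o W) - gauss_mean (F 0%N) <= Ce * C * e `^ p + (c / 4 * (A + e `^ p) + G2 * e `^ p).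
  have := EB d Om P W K e e0 SW F C dF hF; rewrite SE {1}/expansion_coef expr0 big_nil !mul1r.
  have -> : k.-1%:R + w = p by rewrite /p -[in RHS](prednK k0) -natr1; ring.
  rewrite opprD addrA -/(gauss_mean (F 0%N)) => /ler_normlW h1.
  have h2 : \sum_(s <- S) expansion_coef K s * gauss_mean (Theta_comp s (F 0%N)) <=
     c / 4 * (A + e `^ p) + G2 * e `^ p.
    apply: (@le_trans _ _ (\sum_(s <- S) (D ^+ size s * C * (del * (2 `^ p * (A + e `^ p))) +
        D ^+ size s * (C * M s) * e `^ p))).
      rewrite big_seq [X in _ <= X]big_seq; apply: ler_sum => s sS.
      have [hs ss sk] := SP s sS.
      have [Ms0 /(_ sS) /(_ F t e e0 t0 It dF pF FC) h] := MP s.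
      apply: (le_trans (ler_norm _)); rewrite normrM.
      have cb := coef_bound D0 (ltW e0) SW hs sk.
      apply: (le_trans (ler_wpM2r (normr_ge0 _) cb)); rewrite -[_ * `|_|]mulrA.
      have Ds := exprn_ge0 (size s) D0.
      have h3 := lerD (ler_wpM2l (ltW del0) tA) (lexx (M s * e `^ p)).
      apply: (le_trans (ler_wpM2l Ds (le_trans h (ler_wpM2l (ltW C0) h3)))).
      by rewrite le_eqVlt; apply/orP; left; apply/eqP; ring.
    rewrite big_split /= -!mulr_suml -/G2 lerD2r [X in X * (del * _)]mulr_suml -/G1.
    have -> : G1 * (del * (2 `^ p * (A + e `^ p))) = G1 * (del * 2 `^ p) * (A + e `^ p) by ring.
    by rewrite ler_wpM2r // addr_ge0.
  by move: h1; rewrite -[gauss_mean (Theta_comp _ _)]/(gauss_mean (F 0%N)); lra.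
(* The term [c / 4 * A] of the upper bound is absorbed by the lower bound. *)
have AC : A <= C5 * e `^ p.
  have h := le_trans low up.
  have h3 : c / 4 * A <= (C' + Ce * C + c / 4 + G2) * e `^ p by lra.
  have c4 : 0 <= 4 / c by rewrite divr_ge0 // ltW.
  have := ler_wpM2l c4 h3; rewrite mulrA /C5.
  have -> : 4 / c * (c / 4) = 1 by field; rewrite gt_eqF.
  by rewrite mul1r mulrA.
apply: (le_trans (Wasserstein_quantile IA)); rewrite lee_fin.
have pV : 0 <= p^-1 by rewrite invr_ge0 ltW.
apply: (@le_trans _ _ ((C5 * e `^ p) `^ p^-1)).
  apply: ge0_ler_powR => //; exact: mulr_ge0.
by rewrite powRM // -powRrM mulfV ?gt_eqF // powRr1 // ltW.
Qed.

End WassersteinBound.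

(** * Mixing random fields *)

Section IndependentProduct.
Context {R : realType} {d : measure_display} {Om : measurableType d}.
Variable P : probability Om R.

(** The joint law agrees with the product of the marginal laws on rectangles, hence everywhere, and
    Fubini's theorem applies. *)
Lemma mean_indepM (Y V : Om -> R) : Itg P Y -> Itg P V ->
  (forall A B : set R, measurable A -> measurable B ->
    (P (Y @^-1` A `&` V @^-1` B) = P (Y @^-1` A) * P (V @^-1` B))%E) ->
  mean P (fun om => Y om * V om) = mean P Y * mean P V.
Proof.
move=> IY IV ind.
have [mY mV] := (Itg_measurable IY, Itg_measurable IV).
pose Ym : {mfun Om >-> R} := mfun_Sub (mem_set mY).
pose Vm : {mfun Om >-> R} := mfun_Sub (mem_set mV).
have mYV : measurable_fun setT (fun om => (Y om, V om)) by exact/measurable_fun_pair.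
pose Z : {mfun Om >-> (R * R)%type} := mfun_Sub (mem_set mYV).
pose m1 := distribution P Ym; pose m2 := distribution P Vm.
have prodE A : measurable A -> (m1 \x m2)%E A = distribution P Z A.
  by apply: product_measure_unique => B C mB mC; exact: ind.
pose f (z : R * R) := (z.1 * z.2)%:E.
have mf : measurable_fun setT f.
  by apply/measurable_EFinP; apply: measurable_funM.
have Iid (U : {mfun Om >-> R}) : Itg P U -> (distribution P U).-integrable setT (EFin : R -> _).
  move=> IU; apply/integrableP; split; first exact/measurable_EFinP.
  rewrite (ge0_integral_distribution U) //; last by exact/measurableT_comp/measurable_EFinP.
  by have /integrableP[] := IU.
have int_id (U : {mfun Om >-> R}) : Itg P U -> (\int[distribution P U]_x x%:E = (mean P U)%:E)%E.
  by move=> IU; rewrite (integral_distribution (X := U)) ?EFin_mean //; exact/measurable_EFinP.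
have If : (m1 \x m2)%E.-integrable setT f.
  apply/integrable12ltyP => //.
  have aE (U : {mfun Om >-> R}) : Itg P U ->
      (\int[distribution P U]_x (`|x|)%:E = (mean P (fun om => `|U om|))%:E)%E.
    move=> IU; rewrite (ge0_integral_distribution U) ?EFin_mean //; first exact: Itg_norm.
    by apply/measurable_EFinP; exact: normr_measurable.
  under eq_integral => x _.
    under eq_integral => y _ do rewrite /f /= normrM EFinM.
    rewrite ge0_integralZl ?lee_fin // ?aE //; last by apply/measurable_EFinP; exact: normr_measurable.
    over.
  rewrite /= ge0_integralZr ?lee_fin ?mean_ge0 //; last by apply/measurable_EFinP; exact: normr_measurable.
  by rewrite aE // -EFinM ltry.
have IZ : P.-integrable setT (f \o Z).
  apply/integrableP; split; first exact: measurableT_comp.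
  have maf : measurable_fun setT (abse \o f) by exact: measurableT_comp.
  rewrite -(ge0_integral_distribution Z maf); last by move=> z; exact: abse_ge0.
  rewrite (eq_measure_integral (m1 \x m2)%E); first by case/integrableP: If.
  by move=> A mA _; exact/esym/prodE.
apply: EFin_inj; rewrite EFin_mean // -(integral_distribution (X := Z) mf IZ).
rewrite (eq_measure_integral (m1 \x m2)%E); last by move=> A mA _; exact/esym/prodE.
rewrite -integral12_prod_meas1 // /fubini_F.
under eq_integral => x _.
  under eq_integral => y _ do rewrite /f /= EFinM.
  rewrite integralZl ?int_id //; last exact: Iid.
  over.
by rewrite /= integralZr ?int_id ?EFinM //; exact: Iid.
Qed.

End IndependentProduct.

Section MixingIndependence.
Context {R : realType} {d : measure_display} {Om : measurableType d}.
Variables (P : probability Om R) (dim : nat) (T : {fset 'rV[int]_dim}).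
Variables (X : 'rV[int]_dim -> {RV P >-> R}) (k r : nat).
Hypothesis mixing : (alpha_mixing P T X k.+1 r.+1 = 0)%E.

Lemma sigma_field_measurable (U : {fset 'rV[int]_dim}) (E : set Om) :
  sigma_field X U E -> measurable E.
Proof.
apply: smallest_sub; first exact: sigma_algebra_measurable.
by move=> _ [i [_ [B mB ->]]]; rewrite -[X in measurable X]setTI; exact: measurable_funP.
Qed.

Lemma sigma_field_indep (U1 U2 : {fset 'rV[int]_dim}) (E F : set Om) :
  (U1 `<=` T)%fset -> (U2 `<=` T)%fset -> (#|` U1| <= k.+1)%N -> Defs.separated r.+1 U1 U2 ->
  sigma_field X U1 E -> sigma_field X U2 F -> (P (E `&` F) = P E * P F)%E.
Proof.
move=> U1T U2T U1k sep EU FU.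
have : (`|P (E `&` F) - P E * P F| <= alpha_mixing P T X k.+1 r.+1)%E.
  apply: (@le_trans _ _ (alpha P (sigma_field X U1) (sigma_field X U2))).
    by apply: ereal_sup_ubound; exists E, F.
  by rewrite /alpha_mixing le_max; apply/orP; right; apply: ereal_sup_ubound; exists U1, U2.
have [mE mF] := (sigma_field_measurable EU, sigma_field_measurable FU).
have mEF := measurableI _ _ mE mF.
rewrite mixing -(fineK (fin_num_measure P _ mE)) -(fineK (fin_num_measure P _ mF)).
rewrite -(fineK (fin_num_measure P _ mEF)) -EFinM -EFinB abse_EFin lee_fin normr_le0 subr_eq0.
by move=> /eqP ->.
Qed.

Lemma sigma_field_measurable_fun (U : {fset 'rV[int]_dim}) i : i \in U ->
  @measurable_fun _ _ (g_sigma_algebraType [set E | exists i, i \in U /\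
         exists2 B : set R, measurable B & E = X i @^-1` B]) R setT (X i).
Proof.
move=> iU _ B mB; rewrite setTI; apply: sub_sigma_algebra.
by exists i; split=> //; exists B.
Qed.

Definition neighbourhood (J : seq 'rV[int]_dim) : seq 'rV[int]_dim :=
  [seq j <- T | has (fun i => maxnorm (i - j) <= r)%N J].

Lemma neighbourhood_sub J : {subset neighbourhood J <= T}.
Proof. by move=> j; rewrite mem_filter => /andP[]. Qed.

(** [J] may repeat indices, so its set of entries has at most [k + 1] elements; the remaining sum
    only involves indices at distance at least [r + 1] from it. *)
Lemma neighbourhood_indep (J : seq 'rV[int]_dim) (g : R -> R) :
  {subset J <= T} -> (size J <= k.+1)%N -> continuous g -> Itg P (prodX X J) ->
  Itg P (fun om => g (sumX X T om - sumX X (neighbourhood J) om)) ->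
  mean P (fun om => prodX X J om * g (sumX X T om - sumX X (neighbourhood J) om)) =
  mean P (prodX X J) * mean P (fun om => g (sumX X T om - sumX X (neighbourhood J) om)).
Proof.
move=> JT Jk cg IJ Ig.
pose U1 := [fset x in J]%fset.
pose U2 := [fset j in T | ~~ has (fun i => maxnorm (i - j) <= r)%N J]%fset.
have SE om : sumX X T om - sumX X (neighbourhood J) om =
    \sum_(j <- T | ~~ has (fun i => maxnorm (i - j) <= r)%N J) X j om.
  rewrite /sumX /neighbourhood big_filter.
  rewrite (bigID (fun j => has (fun i => maxnorm (i - j) <= r)%N J)) /=.
  by rewrite addrC addrK.
apply: mean_indepM => // A B mA mB.
apply: (@sigma_field_indep U1 U2).
- by apply/fsubsetP => j; rewrite in_fset; exact: JT.
- by apply/fsubsetP => j; rewrite !inE => /andP[].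
- by rewrite (leq_trans _ Jk) // card_fseq size_undup.
- move=> i j; rewrite in_fset !inE => iJ /andP[_ /hasPn/(_ i iJ)].
  by rewrite -ltnNge.
- suff : @measurable_fun _ _ (g_sigma_algebraType [set E | exists i, i \in U1 /\
         exists2 B : set R, measurable B & E = X i @^-1` B]) R setT (prodX X J).
    by move=> /(_ measurableT A mA); rewrite setTI.
  apply: measurable_prod => i iJ; apply: sigma_field_measurable_fun.
  by rewrite in_fset.
- pose V om := \sum_(j <- [seq j <- T | ~~ has (fun i => maxnorm (i - j) <= r)%N J]) X j om.
  have -> : (fun om => g (sumX X T om - sumX X (neighbourhood J) om)) = g \o V.
    by apply/funext => om; rewrite /= SE /V big_filter.
  suff : @measurable_fun _ _ (g_sigma_algebraType [set E | exists i, i \in U2 /\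
         exists2 B : set R, measurable B & E = X i @^-1` B]) R setT (g \o V).
    by move=> /(_ measurableT B mB); rewrite setTI.
  apply: (@measurableT_comp _ _ _ _ _ _ g); first exact: continuous_measurable_fun.
  rewrite /V.
  have : {subset [seq j <- T | ~~ has (fun i => maxnorm (i - j) <= r)%N J] <= U2}.
    by move=> j; rewrite mem_filter !inE andbC.
  elim: [seq _ <- _ | _] => [_|i s IH sU].
    by rewrite (_ : (fun _ => _) = cst 0) //; apply/funext => om; rewrite big_nil.
  rewrite (_ : (fun _ => _) = (fun om : Om => X i om + \sum_(j <- s) X j om)); last first.
    by apply/funext => om; rewrite big_cons.
  apply: measurable_funD.
    by apply: sigma_field_measurable_fun; apply: sU; rewrite mem_head.
  by apply: IH => j js; apply: sU; rewrite in_cons js orbT.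
Qed.

(** A point of the ball is determined by its coordinates relative to [i], which lie between [0] and
    [2 r] after a shift by [r]. *)
Lemma ball_size (i : 'rV[int]_dim) :
  (size [seq j <- T | (maxnorm (i - j) <= r)%N] <= (2 * r).+1 ^ dim)%N.
Proof.
pose f (j : 'rV[int]_dim) : {ffun 'I_dim -> 'I_(2 * r).+1} :=
  [ffun c => inord `|(j ord0 c - i ord0 c + r%:Z)%R|%N].
have near j c : (maxnorm (i - j) <= r)%N -> (`|(i ord0 c - j ord0 c)%R| <= r)%N.
  move=> h; apply: leq_trans h; rewrite /maxnorm.
  by apply: leq_trans (leq_bigmax c); rewrite !mxE.
have uf : uniq [seq f j | j <- [seq j <- T | (maxnorm (i - j) <= r)%N]].
  rewrite map_inj_in_uniq ?filter_uniq ?fset_uniq // => j j'.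
  rewrite !mem_filter => /andP[jr _] /andP[jr' _] ff; apply/rowP => c.
  rewrite -[LHS]/(j ord0 c) -[RHS]/(j' ord0 c).
  have := near j c jr; have := near j' c jr'; have : f j c = f j' c by rewrite ff.
  rewrite !ffunE; move: (i ord0 c) (j ord0 c) (j' ord0 c) => a b b' + hb' hb.
  by move=> /(congr1 val) /=; rewrite !inordK; lia.
rewrite -(size_map f) -(card_uniqP uf) (leq_trans (max_card _)) //.
by rewrite card_ffun !card_ord.
Qed.

Lemma neighbourhood_size (J : seq 'rV[int]_dim) : (size J <= k.+1)%N ->
  (size (neighbourhood J) <= k.+1 * (2 * r).+1 ^ dim)%N.
Proof.
move=> Jk; pose s := flatten [seq [seq j <- T | (maxnorm (i - j) <= r)%N] | i <- J].
have sub : {subset neighbourhood J <= s}.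
  move=> j; rewrite mem_filter => /andP[/hasP[i iJ ij] jT].
  by apply/flatten_mapP; exists i => //; rewrite mem_filter ij.
have un : uniq (neighbourhood J) by rewrite filter_uniq // fset_uniq.
apply: (leq_trans (uniq_leq_size un sub)).
apply: (@leq_trans (size J * (2 * r).+1 ^ dim)); last by rewrite leq_mul2r Jk orbT.
rewrite /s; elim: (J) => //= i l IH; rewrite size_cat mulSn leq_add //.
exact: ball_size.
Qed.

End MixingIndependence.

(** * Normalization of a single random field *)

Section RandomField.
Context {R : realType}.
Local Notation N := (normal_prob (0 : R) (1 : R)).

(** With [e = n^(-1/2)] the variance bound reads [s^-1 <= e / c], and [n] itself is [e^-2]; this
    removes two powers of [e]. *)
Lemma scale_bound (c n s u : R) (j : nat) : 0 < c -> c <= 1 -> 0 < n -> 0 < s ->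
  c ^+ 2 * n <= s ^+ 2 -> 0 <= u ->
  let e := n `^ (- (1 / 2)) in
  n * s ^- j.+2 <= (c^-1) ^+ j.+2 * e ^+ j /\
  n * s ^- j.+1 * s `^ (- u) <= (c^-1) ^+ j.+1 * (c^-1) `^ u * e `^ (j%:R - 1 + u).
Proof.
move=> c0 c1 n0 s0 cns u0 e.
have e0 : 0 < e by exact: powR_gt0.
have e2 : e ^+ 2 = n^-1.
  have -> : n^-1 = n `^ (-1) by rewrite powR_inv1 // ltW.
  by rewrite -powR_mulrn ?(ltW e0) // /e -powRrM; congr powR; field.
have se : s^-1 <= e / c.
  rewrite -[X in X <= _]mul1r ler_pdivrMr // mulrAC ler_pdivlMr // mul1r.
  rewrite -(@ler_pXn2r _ 2) ?nnegrE ?mulr_ge0 ?(ltW c0) ?(ltW s0) ?(ltW e0) //.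
  by rewrite exprMn e2 mulrC ler_pdivlMr.
have s'0 : 0 <= s^-1 by rewrite invr_ge0 ltW.
have ec0 : 0 <= e / c by rewrite divr_ge0 // ltW.
have n_e : n = (e ^+ 2)^-1 by rewrite e2 invrK.
have pow i : s ^- i <= (c^-1) ^+ i * e ^+ i.
  by rewrite -exprVn mulrC -exprMn; apply: lerXn2r.
split.
  apply: (le_trans (ler_wpM2l (ltW n0) (pow _))).
  rewrite n_e -[j.+2]addn2 !exprD le_eqVlt; apply/orP; left; apply/eqP; field.
  by rewrite !gt_eqF.
have spow : s `^ (- u) <= (c^-1) `^ u * e `^ u.
  have -> : s `^ (- u) = (s^-1) `^ u by rewrite -powR_inv1 ?(ltW s0) // -powRrM mulN1r.
  rewrite mulrC -powRM ?invr_ge0 ?(ltW c0) ?(ltW e0) //.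
  by apply: ge0_ler_powR; rewrite ?nnegrE.
have h := ler_pM _ _ (ler_wpM2l (ltW n0) (pow j.+1)) spow.
apply: (le_trans (h _ _)); rewrite ?mulr_ge0 ?powR_ge0 ?invr_ge0 ?exprn_ge0 ?(ltW n0) ?(ltW s0) //.
have -> : e `^ (j%:R - 1 + u) = e ^+ j * e^-1 * e `^ u.
  rewrite powRD; last by rewrite (gt_eqF e0) implybT.
  rewrite powRD; last by rewrite (gt_eqF e0) implybT.
  by rewrite powR_mulrn ?(ltW e0) // powR_inv1 // ltW.
rewrite n_e -[j.+1]addn1 !exprD le_eqVlt; apply/orP; left; apply/eqP; field.
by rewrite !gt_eqF.
Qed.

Section Field.
Context {disp : measure_display} {Om : measurableType disp} (P : probability Om R).
Variables (dim : nat) (T : {fset 'rV[int]_dim}) (X : 'rV[int]_dim -> {RV P >-> R}).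

Lemma field_sumE om : field_sum T X om = sumX X T om.
Proof.
rewrite /field_sum /sumX; elim: (enum_fset T) => [|i s IH]; first by rewrite !big_nil.
by rewrite !big_cons -IH.
Qed.

Lemma normalized_sumE om : normalized_sum T X om = sumX X T om / sigma T X.
Proof. by rewrite -field_sumE. Qed.

Variables (k r : nat) (w M c : R).
Hypotheses (w_gt0 : 0 < w) (k_gt0 : (0 < k)%N) (M_ge0 : 0 <= M).
Hypothesis mixing : (alpha_mixing P T X k.+1 r.+1 = 0)%E.
Hypothesis X_int : forall i, i \in T -> Itg P (fun om => `|X i om| `^ (k%:R + 1 + w)).
Hypothesis X_mom : forall i, i \in T -> mean P (fun om => `|X i om| `^ (k%:R + 1 + w)) <= M.
Hypothesis X_mean : forall i, i \in T -> mean P (X i) = 0.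
Hypotheses (c_gt0 : 0 < c) (c_le1 : c <= 1) (T_gt0 : (0 < #|` T|)%N).
Hypothesis sigma_low : c ^+ 2 * #|` T|%:R <= fine (sigma2 T X).

Let q : R := k%:R + 1 + w.
Let S om := sumX X T om.
Let mX i : measurable_fun setT (X i). Proof. exact: measurable_funP. Qed.

Let S_int a : 0 <= a -> a <= q -> Itg P (fun om => `|S om| `^ a).
Proof.
move=> a0 aq; have IS := sumX_Itg w_gt0 mX X_int.
have mS : measurable_fun setT S by exact: measurable_sum.
apply: (Itg_le (g := fun om => 1 + `|S om| `^ q)).
- apply: measurableT_comp (measurable_powR a) _; exact: measurableT_comp.
- move=> om; rewrite ger0_norm ?powR_ge0 //; have [S1|/ltW S1] := leP 1 `|S om|.
    by rewrite (@le_trans _ _ (`|S om| `^ q)) ?ler_powR // lerDr.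
  by rewrite (@le_trans _ _ 1) ?powR_le1 // lerDl powR_ge0.
- by apply: ItgD => //; exact: Itg_cst.
Qed.

Let q_ge2 : 2 <= q.
Proof.
have k1 : 1 <= k%:R :> R by rewrite ler1n.
by apply: (@le_trans _ _ (k%:R + 1)); [rewrite -[2]/(1 + 1) lerD2r|rewrite lerDl ltW].
Qed.

Let X_Itg i : i \in T -> Itg P (X i).
Proof.
move=> iT; apply: (Itg_le (g := fun om => 1 + `|X i om| `^ q)) => //.
- move=> om; have [S1|/ltW S1] := leP 1 `|X i om|.
    rewrite -[leLHS]powRr1 // (@le_trans _ _ (`|X i om| `^ q)) ?lerDr //.
    by rewrite ler_powR // (le_trans _ q_ge2) // ler1n.
  by rewrite (@le_trans _ _ 1) ?lerDl ?powR_ge0.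
- by apply: ItgD; [exact: Itg_cst|exact: X_int].
Qed.

Let S_mean : mean P S = 0.
Proof. by rewrite mean_sum // big_seq big1. Qed.

Let S2_int : Itg P (fun om => S om ^+ 2).
Proof.
have := S_int (ler0n R 2) q_ge2; congr Itg; apply/funext => om.
by rewrite powR_mulrn // real_normK // num_real.
Qed.

Lemma sigma2E : sigma2 T X = (mean P (fun om => sumX X T om ^+ 2))%:E.
Proof.
have E0 : fine 'E_P[field_sum T X] = 0.
  rewrite expectation.unlock -S_mean; congr fine; apply: eq_integral => om _.
  by rewrite field_sumE.
rewrite /sigma2 /variance covariance.unlock E0 expectation.unlock.
rewrite (EFin_mean S2_int); apply: eq_integral => om _; congr EFin.
by rewrite -[LHS]/((field_sum T X om - 0) * (field_sum T X om - 0)) subr0 field_sumE expr2.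
Qed.

Let s := sigma T X.

Let n_gt0 : 0 < #|` T|%:R :> R. Proof. by rewrite ltr0n. Qed.

Let s2 : s ^+ 2 = fine (sigma2 T X).
Proof.
rewrite sqr_sqrtr //; apply: le_trans sigma_low.
by rewrite mulr_ge0 // sqr_ge0.
Qed.

Let s_gt0 : 0 < s.
Proof.
rewrite sqrtr_gt0; apply: lt_le_trans sigma_low.
by rewrite mulr_gt0 // exprn_gt0.
Qed.

Let B := (k.+1 * (2 * r).+1 ^ dim)%N.

Definition field_cst : R :=
  (\sum_(L < k.+1) `|approx_cst k B w M L|) * ((c^-1) ^+ k.+1 * (c^-1) `^ w).

Lemma field_cst_ge0 : 0 <= field_cst.
Proof.
by rewrite !mulr_ge0 ?exprn_ge0 ?powR_ge0 ?sumr_ge0 // invr_ge0 ltW.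
Qed.

Let W := normalized_sum T X.
Let WE : (W : Om -> R) = fun om => S om / s.
Proof. by apply/funext => om; exact: normalized_sumE. Qed.

Lemma normalized_sum_Itg a : 0 <= a -> a <= q -> Itg P (fun om => `|W om| `^ a).
Proof.
move=> a0 aq; have := ItgZ (s^-1 `^ a) (S_int a0 aq); congr Itg; apply/funext => om.
rewrite WE normrM (ger0_norm (_ : 0 <= s^-1)) ?invr_ge0 ?(ltW s_gt0) //.
by rewrite powRM ?invr_ge0 ?(ltW s_gt0) // mulrC.
Qed.

Lemma field_stein_expansion :
  stein_expansion P W (cumulant P W) k w (k`!%:R * field_cst) (#|` T|%:R `^ (- (1 / 2))).
Proof.
have cV : 1 <= c^-1 by rewrite invf_ge1.
have cV0 : 0 <= c^-1 by exact: le_trans cV.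
have A0 : 0 <= \sum_(L < k.+1) `|approx_cst k B w M L| by rewrite sumr_ge0.
have D0 := field_cst_ge0.
have AL L : (L <= k)%N -> approx_cst k B w M L <= \sum_(L < k.+1) `|approx_cst k B w M L|.
  move=> Lk; rewrite (bigD1 (Ordinal (Lk : (L < k.+1)%N))) //=.
  by rewrite (le_trans (ler_norm _)) // lerDl sumr_ge0.
have B0 : (0 < B)%N by rewrite muln_gt0 expn_gt0.
have scale j u := @scale_bound c #|` T|%:R s u j c_gt0 c_le1 n_gt0 s_gt0.
have low : c ^+ 2 * #|` T|%:R <= s ^+ 2 by rewrite s2.
set e := #|` T|%:R `^ (- (1 / 2)).
have e0 : 0 <= e by exact: powR_ge0.
apply: stein_expansion_of_local => //.
- have q1 : k.+1%:R <= q by rewrite /q natr1 lerDl ltW.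
  have := normalized_sum_Itg (ler0n R k.+1) q1; congr Itg; apply/funext => om.
  by rewrite powR_mulrn.
- rewrite WE; under eq_mean do rewrite mulrC.
  rewrite meanZ ?S_mean ?mulr0 //; exact: Itg_sum.
- rewrite WE; under eq_mean do rewrite exprMn mulrC.
  by rewrite meanZ // -[mean _ _]/(fine (mean _ _)%:E) -sigma2E -s2 exprVn mulVf // expf_neq0 // gt_eqF.
- by move=> L F H j Lk dF hF jL; rewrite WE; exact: (chain_Itg w_gt0 mX X_int s Lk dF hF jL).
- by move=> L F H Lk dF hF; rewrite WE; exact: (chainM_Itg w_gt0 mX X_int s Lk dF hF).
move=> L Lk.
have [a [ha hF]] := local_stein w_gt0 mX X_int X_mom M_ge0 B0 (@neighbourhood_sub _ T r)
  (fun J => @neighbourhood_size _ T k r J) (neighbourhood_indep mixing) Lk s_gt0.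
exists a; split.
  move=> j jk; apply: (le_trans (ha j.+1)).
  have [h _] := scale j 0 low (lexx 0).
  rewrite mulrAC [_ / _ * _]mulrC -mulrA.
  have ns : 0 <= #|` T|%:R * s ^- j.+2 by rewrite mulr_ge0 // invr_ge0 exprn_ge0 // ltW.
  apply: (le_trans (ler_wpM2r ns (AL L Lk))); apply: ler_wpM2l => //.
  apply: (le_trans h); apply: ler_wpM2r; first exact: exprn_ge0.
  apply: (@le_trans _ _ ((c^-1) ^+ k.+1)); first by rewrite ler_weXn2l.
  by rewrite ler_peMr ?exprn_ge0 // powR_ge1 // ltW.
move=> F H dF hFH; have H0 := holder_ge0 hFH.
have := hF F H dF hFH; rewrite WE => h; apply: (le_trans h); rewrite ler_wpM2r //.
have [_ h2] := scale L w low (ltW w_gt0).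
have ns : 0 <= #|` T|%:R * s ^- L.+1 * s `^ (- w).
  by rewrite !mulr_ge0 ?powR_ge0 // invr_ge0 exprn_ge0 // ltW.
have -> : #|` T|%:R * approx_cst k B w M L / s ^+ L.+1 * s `^ (- w) =
  approx_cst k B w M L * (#|` T|%:R * s ^- L.+1 * s `^ (- w)) by ring.
apply: (le_trans (ler_wpM2r ns (AL L Lk))); rewrite /field_cst -[leRHS]mulrA ler_wpM2l //.
apply: (le_trans h2); rewrite ler_wpM2r ?powR_ge0 // ler_wpM2r ?powR_ge0 //.
by rewrite ler_weXn2l.
Qed.

End Field.

Lemma natceil_itv (p : R) : 1 <= p -> p \isn't a Num.int ->
  (1 < natceil p)%N /\ (natceil p)%:R - 1 < p < (natceil p)%:R.
Proof.
move=> p1 pn.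
have c0 : (0 <= Num.ceil p)%R by rewrite ceil_ge0 (lt_le_trans _ p1) // ltrN10.
have cE : (natceil p)%:R = (Num.ceil p)%:~R :> R.
  by rewrite /natceil natr_absz ger0_norm.
have pc : p < (natceil p)%:R.
  rewrite cE lt_neqAle ceil_ge andbT; apply: contra pn => /eqP ->.
  exact: intr_int.
have cp : (natceil p)%:R - 1 < p by have := ceilB1_lt p; rewrite cE intrB.
split; last by rewrite cp.
by have := le_lt_trans p1 pc; rewrite ltr1n.
Qed.

Lemma Lambda_chain (p : R) (h : R -> R) : Lambda p h ->
  deriv_chain (natceil p).-1 (fun j => derive1n j h) /\
  holder (p + 1 - (natceil p)%:R) 1 (derive1n (natceil p).-1 h).
Proof.
move=> [[[dh _] _] hh]; split=> [j x jk|x y].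
  by apply: isd_of; [exact: dh|rewrite derive1nS].
rewrite mul1r; have [->|xy] := eqVneq x y; first by rewrite subrr normr0 powR_ge0.
have : ((`|derive1n (natceil p).-1 h x - derive1n (natceil p).-1 h y| /
    `|x - y| `^ (p + 1 - (natceil p)%:R))%:E <= (1 : R)%:E)%E.
  by apply: le_trans hh; apply: ereal_sup_ubound; exists x, y.
by rewrite lee_fin ler_pdivrMr ?mul1r // powR_gt0 // normr_gt0 subr_eq0.
Qed.

Lemma Lnorm_bound d (Om : measurableType d) (P : probability Om R) (X : {RV P >-> R}) (q C : R) :
  0 < q -> ('N[P]_(q%:E)[EFin \o X] <= C%:E)%E ->
  Itg P (fun om => `|X om| `^ q) /\ mean P (fun om => `|X om| `^ q) <= C `^ q.
Proof.
move=> q0 hC.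
have E : (\int[P]_om (`|X om| `^ q)%:E <= (C `^ q)%:E)%E.
  have -> : (\int[P]_om (`|X om| `^ q)%:E = 'N[P]_(q%:E)[EFin \o X] `^ q)%E.
    by rewrite powR_Lnorm ?gt_eqF //; apply: eq_integral => om _; rewrite /= poweR_EFin.
  rewrite -poweR_EFin; apply: gt0_ler_poweR; rewrite ?in_itv /= ?leey ?andbT ?Lnorm_ge0 ?(ltW q0) //.
  exact: le_trans (Lnorm_ge0 _ _ _) hC.
have I : Itg P (fun om => `|X om| `^ q).
  apply/integrableP; split.
    apply/measurable_EFinP; apply: measurableT_comp (measurable_powR q) _.
    exact: measurableT_comp.
  apply: le_lt_trans (ltry (C `^ q)).
  by under eq_integral do rewrite /= ger0_norm ?powR_ge0 //.
by split=> //; rewrite -lee_fin EFin_mean.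
Qed.

End RandomField.

(** * Uniform constants along the sequence of fields *)

Lemma limn_einf_gt0 (R : realType) (u : nat -> \bar R) : (0 < limn_einf u)%E ->
  exists c n0, [/\ (0 < c)%R & forall n, (n0 <= n)%N -> (c%:E <= u n)%E].
Proof.
rewrite limn_einf_lim (cvg_lim _ (@cvg_einfs_sup R u)) // => /ereal_sup_gt[_ [n0 _ <-]] h.
have le n : (n0 <= n)%N -> (einfs u n0 <= u n)%E.
  by move=> nn; apply: ereal_inf_lbound; exists n.
move: h le; case: (einfs u n0) => [c| |] h le; last by rewrite ltNge leNye in h.
  by exists c, n0; split; [rewrite -lte_fin|].
by exists 1%R, n0; split => // n /le; rewrite leye_eq => /eqP ->; exact: leey.
Qed.

Theorem corollary2p4 (R : realType) (d : nat) (d_gt0 : (0 < d)%N)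
    (T : nat -> {fset 'rV[int]_d})
    (T_nonempty : forall n, T n != fset0)
    (T_incr : forall n, (T n `<=` T n.+1)%fset)
    (T_infty : #|` T n| @[n --> \oo] --> \oo)
    (disp : nat -> measure_display)
    (Om : forall n, measurableType (disp n))
    (P : forall n, probability (Om n) R)
    (X : forall n, 'rV[int]_d -> {RV (P n) >-> R})
    (X_L2 : forall n i, i \in T n -> (X n i : Om n -> R) \in Lfun (P n) 2%:E)
    (X_mean0 : forall n i, i \in T n -> ('E_(P n)[X n i] = 0)%E)
    (p : R) (p_ge1 : 1 <= p) (p_nonint : p \isn't a Num.int)
    (k : nat) (k_def : k = natceil p)
    (nondegenerate : (0 < limn_einf (fun n =>
       sigma2 (T n) (X n) * ((#|` T n|%:R : R)^-1)%:E))%E)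
    (moments : (ereal_sup [set x | exists n i, i \in T n /\
       x = 'N[P n]_((p + 2)%:E)[EFin \o X n i]] < +oo)%E)
    (r : nat) (r_gt0 : (0 < r)%N)
    (mixing : forall n, (alpha_mixing (P n) (T n) (X n) k.+1 r.+1 = 0)%E) :
  [/\ exists C : R, \forall n \near \oo, forall h, Lambda p h ->
        (`| 'E_(P n)[h \o normalized_sum (T n) (X n)] - (gauss_mean h)%:E
          - (\sum_(s \in Gamma k.-1) (-1) ^+ size s *
              (\prod_(sj <- s)
                 (cumulant (P n) (normalized_sum (T n) (X n)) (sj + 2)
                  / ((sj + 1)`!)%:R)) *
              gauss_mean (Theta_comp s h))%:E |
         <= (C * (#|` T n|%:R) `^ (- (p / 2)))%:E)%E,
      forall j : nat, (1 <= j <= k.-1)%N ->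
        exists C : R, \forall n \near \oo,
          `| cumulant (P n) (normalized_sum (T n) (X n)) (j + 2) |
          <= C * (#|` T n|%:R) `^ (- (j%:R / 2)) &
      exists C : R, \forall n \near \oo,
        (Wasserstein p (distribution (P n) (normalized_sum (T n) (X n)))
           (normal_prob 0 1)
         <= (C * (#|` T n|%:R) `^ (- (1 / 2)))%:E)%E ].
Proof.
have [k1 /andP[kp pk]] := natceil_itv p_ge1 p_nonint; rewrite -k_def in k1 kp pk.
pose w := p + 1 - k%:R.
have w0 : 0 < w by rewrite /w; lra.
have w1 : w <= 1 by rewrite /w; lra.
have pE : k%:R - 1 + w = p by rewrite /w; ring.
have qE : p + 2 = k%:R + 1 + w by rewrite /w; ring.
have k0 : (0 < k)%N by exact: ltnW.
have T0 n : (0 < #|` T n|)%N by rewrite cardfs_gt0 T_nonempty.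
have [M1 M10 hM1] : exists2 M1 : R, 0 <= M1 & forall n i, i \in T n ->
    ('N[P n]_((p + 2)%:E)[EFin \o X n i] <= M1%:E)%E.
  move: moments; set s := ereal_sup _ => slt.
  have sub n i : i \in T n -> ('N[P n]_((p + 2)%:E)[EFin \o X n i] <= s)%E.
    by move=> iT; apply: ereal_sup_ubound; exists n, i.
  move: slt sub; case: s => [s|//|] _ sub.
    exists `|s|; first by [].
    by move=> n i /sub h; apply: (le_trans h); rewrite lee_fin ler_norm.
  by exists 0 => // n i /sub h; apply: (le_trans h); exact: leNye.
pose M := M1 `^ (p + 2); have M0 : 0 <= M by exact: powR_ge0.
have p20 : 0 < p + 2 by lra.
have XI n i : i \in T n -> Itg (P n) (fun om => `|X n i om| `^ (k%:R + 1 + w)).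
  by move=> iT; rewrite -qE; have [] := Lnorm_bound p20 (hM1 n i iT).
have XM n i : i \in T n -> mean (P n) (fun om => `|X n i om| `^ (k%:R + 1 + w)) <= M.
  by move=> iT; rewrite -qE; have [] := Lnorm_bound p20 (hM1 n i iT).
have X0 n i : i \in T n -> mean (P n) (X n i) = 0.
  move=> iT; have := X_mean0 n i iT; rewrite expectation.unlock => h.
  by rewrite /mean /Rintegral h.
have [c0 [n0 [c00 hc0]]] := limn_einf_gt0 nondegenerate.
(* The cap at 1 makes the powers of [c^-1] increase with the exponent, so the largest one serves for
   all orders. *)
pose c := Num.min 1 (Num.sqrt c0).
have c_gt0 : 0 < c by rewrite lt_min ltr01 sqrtr_gt0.
have c_le1 : c <= 1 by rewrite ge_min lexx.
have sigma_low n : (n0 <= n)%N -> c ^+ 2 * #|` T n|%:R <= fine (sigma2 (T n) (X n)).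
  move=> nn; have := hc0 n nn.
  rewrite (sigma2E w0 k0 (@XI n) (@X0 n)) -EFinM lee_fin ler_pdivlMr ?ltr0n // => h.
  apply: le_trans h; rewrite ler_wpM2r //.
  have : c <= Num.sqrt c0 by rewrite ge_min lexx orbT.
  rewrite -(@ler_pXn2r _ 2) ?nnegrE ?sqrtr_ge0 ?(ltW c_gt0) // sqr_sqrtr //.
  exact: ltW.
pose D : R := k`!%:R * field_cst d k r w M c.
have D0 : 0 <= D by rewrite mulr_ge0 // field_cst_ge0.
pose e n : R := #|` T n|%:R `^ (- (1 / 2)).
have e0 n : 0 < e n by rewrite powR_gt0 // ltr0n.
have eE n a : e n `^ a = #|` T n|%:R `^ (- (a / 2)).
  by rewrite /e -powRrM; congr powR; field.
pose W n := normalized_sum (T n) (X n).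
have SE n : (n0 <= n)%N ->
    stein_expansion (P n) (W n) (cumulant (P n) (W n)) k w D (e n).
  move=> nn; exact: (field_stein_expansion w0 k0 M0 (mixing n) (@XI n) (@XM n) (@X0 n)
    c_gt0 c_le1 (T0 n) (sigma_low n nn)).
split.
- have kk : (k.-1 < k)%N by rewrite prednK.
  have [C [C0 hC]] := expansion_bound w0 w1 D0 (leqnn k.-1) kk.
  exists C; exists n0 => // n /= nn h Lh.
  have [dh hh] := Lambda_chain Lh; rewrite -k_def -/w in dh hh.
  have Ih : Itg (P n) (h \o W n) := stein_Itg (SE n nn) (leq_pred k) dh hh (leq0n _).
  have := hC _ _ _ _ _ _ (e0 n) (SE n nn) _ _ dh hh.
  rewrite Gamma_tuples {1}/expansion_coef expr0 big_nil !mul1r mulr1.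
  have -> : k.-1%:R + w = p by rewrite -pE -[in RHS](prednK k0) -natr1; ring.
  rewrite eE opprD addrA => hb.
  rewrite expectation.unlock -(EFin_mean Ih) -!EFinB abse_EFin lee_fin.
  exact: hb.
- move=> j /andP[j1 jk]; exists D; exists n0 => // n /= nn.
  rewrite -eE powR_mulrn ?(ltW (e0 n)) //.
  by apply: (cumulant_small (SE n nn)); rewrite j1 -(prednK k0).
- have [C [C0 hC]] := Wasserstein_bound k1 w0 w1 D0.
  exists C; exists n0 => // n /= nn.
  have IW : Itg (P n) (fun om => `|W n om| `^ p).
    apply: (normalized_sum_Itg w0 (@XI n) c_gt0 (T0 n) (sigma_low n nn)).
      by lra.
    by rewrite -qE; lra.
  have := hC _ _ _ (W n) _ _ (e0 n) (SE n nn); rewrite pE => /(_ IW).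
  by rewrite /e.
Qed.
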